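(* Let $X$ be a dendrite and $f:X\to X$ a continuous map. If some iterate $f^m$ ($m\ge1$) of $f$ has an arc horseshoe, then $f$ has an uncountable DC1 set (i.e. $f$ is DC$1_u$) and $f$ is $\omega$-chaotic.
   Context: A dendrite is a locally connected continuum (compact connected metric space) containing no subset homeomorphic to the circle. For a continuous self-map $g$ of a dendrite $X$, arcs $A,B\subset X$ form an arc horseshoe for $g$ if $A$ and $B$ intersect at most in their endpoints and $g(A)\cap g(B)\supset A\cup B$; $g$ has an arc horseshoe if such arcs exist. Let $d$ be the metric of $X$. For $x,y\in X$ and $\delta>0$ put $$\Phi_{(f,x,y)}(\delta)=\liminf_{n\to\infty}\frac1n\#\{0\le k\le n: d(f^k(x),f^k(y))<\delta\},\qquad \Phi^*_{(f,x,y)}(\delta)=\limsup_{n\to\infty}\frac1n\#\{0\le k\le n: d(f^k(x),f^k(y))<\delta\}.$$ A pair $(x,y)\in X^2$ is a DC1 pair if $\Phi^*_{(f,x,y)}(\delta)=1$ for every $0<\delta\le \operatorname{diam}X$ and $\Phi_{(f,x,y)}(\epsilon)=0$ for some $0<\epsilon\le\operatorname{diam}X$. A set $S\subset X$ is a DC1 set if every pair of distinct points of $S$ is a DC1 pair. $\omega_f(x)$ denotes the set of limit points of the sequence $(f^n(x))_{n\in\mathbb N}$ (the $\omega$-limit set of $x$). A set $S\subset X$ is $\omega$-scrambled for $f$ if it contains at least two points and for any two distinct $x,y\in S$: (1) $\omega_f(x)\setminus\omega_f(y)$ is uncountable; (2) $\omega_f(x)\cap\omega_f(y)$ is nonempty;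 (3) $\omega_f(x)$ is not contained in the set of periodic points of $f$. The map $f$ is $\omega$-chaotic if it has an uncountable $\omega$-scrambled set. *)

(* Defs.v *)
From HB Require Import structures.
From mathcomp Require Import all_boot all_order all_algebra.
From mathcomp Require Import all_classical all_reals all_analysis.

Set Implicit Arguments.
Unset Strict Implicit.
Unset Printing Implicit Defensive.

Import Order.TTheory GRing.Theory Num.Theory.
Import numFieldNormedType.Exports.

Local Open Scope classical_set_scope.
Local Open Scope ring_scope.

(* The subspaces A and B are homeomorphic via f, with inverse g.  Values of f
   off A and of g off B are irrelevant, so total functions lose nothing as soon
   as A and B are nonempty; below, one of them is [0, 1] or the circle. *)
Definition homeomorphism (T U : topologicalType) (A : set T) (B : set U)
    (f : T -> U) (g : U -> T) : Prop :=
  [/\ set_fun A B f, set_fun B A g,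
      {in A, cancel f g} & {in B, cancel g f}] /\
  ({within A, continuous f} /\ {within B, continuous g}).

Definition homeomorphic (T U : topologicalType) (A : set T) (B : set U) : Prop :=
  exists f g, homeomorphism A B f g.

Definition unit_circle (R : realType) : set (R * R) :=
  [set p | p.1 ^+ 2 + p.2 ^+ 2 = 1].

Definition locally_connected (T : topologicalType) : Prop :=
  forall (x : T) (U : set T), nbhs x U ->
    exists V : set T, [/\ open V, connected V, V x & V `<=` U].

Definition dendrite (R : realType) (X : metricType R) : Prop :=
  [/\ compact [set: X], connected [set: X], locally_connected X &
      forall S : set X, ~ homeomorphic (@unit_circle R) S].

Definition is_arc (R : realType) (X : metricType R) (A : set X) (a b : X) : Prop :=
  exists (h : R -> X) (k : X -> R),
    [/\ homeomorphism (`[0, 1]%classic : set R) A h k, h 0 = a & h 1 = b].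

(* Every common point of the two arcs is an endpoint of each of them. *)
Definition arc_horseshoe (R : realType) (X : metricType R) (g : X -> X)
    (A B : set X) : Prop :=
  exists a a' b b' : X,
    [/\ is_arc A a a', is_arc B b b',
        A `&` B `<=` [set a; a'] `&` [set b; b'] &
        A `|` B `<=` (g @` A) `&` (g @` B)].

Definition has_arc_horseshoe (R : realType) (X : metricType R) (g : X -> X) :
    Prop :=
  exists A B : set X, arc_horseshoe g A B.

Definition diam (R : realType) (X : metricType R) : R :=
  sup [set mdist p.1 p.2 | p in [set: X * X]].

(* n+1 indices are counted but the normalisation is by n; the ratio is
   bounded by 2, so its real-valued limsup and liminf are the genuine ones. *)
Definition close_freq (R : realType) (X : metricType R) (f : X -> X) (x y : X)
    (delta : R) (n : nat) : R :=
  #|[pred k : 'I_n.+1 | mdist (iter k f x) (iter k f y) < delta]|%:R / n%:R.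

Definition Phi_inf (R : realType) (X : metricType R) (f : X -> X) (x y : X)
    (delta : R) : R :=
  limn_inf (close_freq f x y delta).

Definition Phi_sup (R : realType) (X : metricType R) (f : X -> X) (x y : X)
    (delta : R) : R :=
  limn_sup (close_freq f x y delta).

Definition DC1_pair (R : realType) (X : metricType R) (f : X -> X) (x y : X) :
    Prop :=
  (forall delta, 0 < delta <= diam X -> Phi_sup f x y delta = 1) /\
  (exists2 eps, 0 < eps <= diam X & Phi_inf f x y eps = 0).

Definition DC1_set (R : realType) (X : metricType R) (f : X -> X) (S : set X) :
    Prop :=
  forall x y, S x -> S y -> x <> y -> DC1_pair f x y.

Definition DC1u (R : realType) (X : metricType R) (f : X -> X) : Prop :=
  exists2 S : set X, ~ countable S & DC1_set f S.

Definition omega_limit (T : topologicalType) (f : T -> T) (x : T) : set T :=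
  cluster ((fun n => iter n f x) @ \oo).

Definition periodic_points (T : Type) (f : T -> T) : set T :=
  [set x | exists2 n, (0 < n)%N & iter n f x = x].

Definition omega_scrambled (T : topologicalType) (f : T -> T) (S : set T) :
    Prop :=
  (exists x y, [/\ S x, S y & x <> y]) /\
  (forall x y, S x -> S y -> x <> y ->
    [/\ ~ countable (omega_limit f x `\` omega_limit f y),
        omega_limit f x `&` omega_limit f y !=set0 &
        ~ (omega_limit f x `<=` periodic_points f)]).

Definition omega_chaotic (T : topologicalType) (f : T -> T) : Prop :=
  exists2 S : set T, ~ countable S & omega_scrambled f S.

(* Main.v *)
Require Import Defs.
From mathcomp Require Import all_boot all_order all_algebra.
From mathcomp Require Import all_classical all_reals all_analysis.
From mathcomp Require Import ring lra zify.

Set Implicit Arguments.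
Unset Strict Implicit.
Unset Printing Implicit Defensive.

Import Order.TTheory GRing.Theory Num.Theory.
Import numFieldNormedType.Exports.

Local Open Scope classical_set_scope.
Local Open Scope ring_scope.

(** Since the space contains no circle, a path between two points of an arc
covers the part of the arc between them (path_covers_arc): otherwise a piece of
the path would leave the arc and come back elsewhere, and an arc inside this
piece would close up to a circle. The arc inside the piece is obtained by
collapsing a maximal family of loops of the path (monotone_path) and by
parametrising the outcome by the size of its past (arc_of_monotone_path).
Consequently segments of an arc can be lifted in order along an iterate of the
map, exactly as for maps of an interval, although the image of an arc may leave
the arc.

In this way an arc horseshoe yields an arc with two disjoint segments, each of
which some iterate G runs across the whole arc (disjoint_horseshoe). If the two
given arcs touch, this is a matter of order. If they are disjoint, one of them
may branch off in the middle of the other, and counting replaces order: the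
first arc contains four disjoint closed sets, each covering the whole arc under
the third iterate, so that, when the arc is cut into short pieces, at least 4^n
words of pieces of length n can be followed; were no piece to return over itself
along two different words of equal length, there would be at most K 3^n of them
(two_fold_of_coverings).

Points are then coded by 0-1 sequences (cylinder_coding): each finite word has a
segment, the segments of different words of equal length are disjoint, and at a
place where two codes differ the orbits are a definite distance apart. The
diameter of a cylinder, the image of a segment in the space, need not tend to
zero with the length of the word. But as the segments of one length are
disjoint, only boundedly many cylinders of that length have diameter above a
given constant, and only countably many sequences have cylinders that do not
shrink to a point. Both parts of the theorem choose sequences that avoid the
large cylinders, by means of Toeplitz sequences.

For distributional chaos, an aperiodic Toeplitz sequence is used whose long
words occur rarely (toeplitz_rigid). Points whose codes share very long words of
this sequence are therefore close to each other most of the time (dc1_close).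
Between these words the codes have constant blocks, much longer than all that
precedes them, whose value is read off from a parameter; where the parameters
differ, the orbits are far apart for most of the time (dc1_far).

For omega-chaos, there are uncountably many disjoint minimal sets of Toeplitz
sequences, all but countably many of which consist of sequences with shrinking
cylinders. For such a parameter a, take the point coded by a sequence in which
longer and longer prefixes of the Toeplitz sequences of a and of one fixed
parameter alternate: its omega-limit set under G contains the corresponding two
minimal parts, and each of its points has a code that ends with one of their
codes. If G is the M-th iterate of f, the omega-limit set under f is the union of
the images of this set under the iterates of f of order below M. By minimality
such an iterate takes a minimal part to points of at most one other part
(minimal_part_image), so each parameter is related to at most countably many
others, and an uncountable set of pairwise unrelated parameters remains
(uncountable_independent); the points built from these are scrambled. *)

(** * Paths in metric spaces *)

Section metric_basics.
Context {R : realType} {X : metricType R}.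
Implicit Types (g : R -> X) (x y z : X).

Lemma metric_continuousP g : continuous g <->
  forall (t e : R), 0 < e -> exists2 d : R, 0 < d &
    forall s : R, `|s - t| < d -> mdist (g t) (g s) < e.
Proof.
split=> [gc t e e0|gc t].
  have /(gc t) : nbhs (g t) (ball (g t) e) by exact: nbhsx_ballx.
  rewrite nbhs_simpl/= => /nbhs_ballP[d /= d0 dP]; exists d => // s st.
  have /dP : ball t d s by rewrite /ball/= distrC.
  by rewrite ballEmdist.
apply/cvg_ballP => e e0; have [d d0 dP] := gc t e e0.
near=> s; rewrite ballEmdist /=; apply: dP.
near: s; have := @nbhsx_ballx R R t d d0.
by apply: filterS => s; rewrite /ball/= distrC.
Unshelve. all: by end_near. Qed.

Lemma real_continuousP (w : R -> R) : (forall (t e : R), 0 < e ->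
    exists2 d : R, 0 < d & forall s : R, `|s - t| < d -> `|w t - w s| < e) ->
  continuous w.
Proof.
move=> wP t; apply/cvg_ballP => e e0; have [d d0 dP] := wP t e e0.
near=> s; rewrite /ball /=; apply: dP.
near: s; have := @nbhsx_ballx R R t d d0.
by apply: filterS => s; rewrite /ball/= distrC.
Unshelve. all: by end_near. Qed.

Lemma metric_continuous_selfP (f : X -> X) : continuous f ->
  forall (x : X) (e : R), 0 < e -> exists2 d : R, 0 < d &
    forall y, mdist x y < d -> mdist (f x) (f y) < e.
Proof.
move=> fc x e e0.
have /(fc x) : nbhs (f x) (ball (f x) e) by exact: nbhsx_ballx.
rewrite nbhs_simpl/= => /nbhs_ballP[d /= d0 dP]; exists d => // y xy.
have /dP : ball x d y by rewrite ballEmdist.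
by rewrite ballEmdist.
Qed.

Lemma path_image_closed g a b : continuous g -> closed (g @` `[a, b]).
Proof.
move=> gc; apply: compact_closed; first exact: metric_hausdorff.
apply: continuous_compact; last exact: segment_compact.
exact: continuous_subspaceT.
Qed.

Lemma closed_dist_gt0 (C : set X) x : closed C -> ~ C x ->
  exists2 e : R, 0 < e & forall y, C y -> e <= mdist x y.
Proof.
move=> Cc nCx; have /nbhs_ballP[e /= e0 eP] : nbhs x (~` C).
  by apply: open_nbhs_nbhs; split=> //; rewrite openC.
exists e => // y Cy; rewrite leNgt; apply/negP => xy.
by have /eP : ball x e y by rewrite ballEmdist.
Qed.

Lemma closed_path_preimage g (C : set X) :
  continuous g -> closed C -> closed (g @^-1` C).
Proof. by move=> gc; apply: preimage_closed => t _; exact: gc. Qed.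

Lemma closed_max_in (S : set R) a b : closed S -> (exists2 t, S t & a <= t <= b) ->
  exists2 m, S m & a <= m <= b /\ forall t, S t -> a <= t <= b -> t <= m.
Proof.
move=> Sc [t St tab].
pose S' := S `&` `[a, b].
have S't : S' t by split=> //=; rewrite ?in_itv.
have S'u : has_ubound S' by exists b => s [_] /=; rewrite in_itv/= => /andP[].
have : closure S' (sup S') by apply: closure_sup => //; exists t.
have S'c : closed S' by apply: closedI => //; exact: itv_closed.
move=> /S'c[S1 S2]; exists (sup S') => //; rewrite /= in_itv/= in S2; split => //.
by move=> s Ss sab; apply: ub_le_sup => //; split=> //=; rewrite ?in_itv.
Qed.

Lemma closed_min_in (S : set R) a b : closed S -> (exists2 t, S t & a <= t <= b) ->
  exists2 m, S m & a <= m <= b /\ forall t, S t -> a <= t <= b -> m <= t.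
Proof.
move=> Sc [t St tab].
have Nc : closed [set t | S (- t)].
  by apply: (@preimage_closed _ _ -%R) => // u _; exact: opp_continuous.
have [|m Sm [mab mP]] := @closed_max_in _ (- b) (- a) Nc.
  exists (- t); first by rewrite /= opprK.
  by rewrite !lerN2 andbC.
exists (- m) => //; split; first by move: mab; rewrite lerNr lerNl andbC.
move=> s Ss sab; rewrite lerNl; apply: mP; first by rewrite /= opprK.
by rewrite !lerN2 andbC.
Qed.

End metric_basics.

(** The preimage under k of a closed set is the image under w of a compact
set, hence closed. *)
Lemma compact_quotient_continuous (T U V : topologicalType) (A : set T)
    (w : T -> U) (g : T -> V) (k : U -> V) :
  hausdorff_space U -> compact A -> {within A, continuous w} ->
  {within A, continuous g} -> (forall x, A x -> k (w x) = g x) ->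
  {within w @` A, continuous k}.
Proof.
move=> hU cA wc gc kw; apply/continuous_closedP => C Cc.
apply/closed_subspaceP.
exists (w @` (A `&` g @^-1` C)).
  apply: compact_closed => //.
  apply: continuous_compact; first apply: (continuous_subspaceW _ wc).
    by move=> x [].
  have /continuous_closedP/(_ _ Cc)/closed_subspaceP[D Dc DE] := gc.
  by rewrite setIC -DE setIC; apply: compact_closedI.
apply/seteqP; split=> u.
  move=> [[x [Ax gCx] <-] _]; split; last by exists x.
  by change (C (k (w x))); rewrite kw.
move=> [kCu [x Ax wu]]; split; last by exists x.
exists x => //; split=> //; change (C (g x)).
by rewrite -kw // wu.
Qed.

(** * Uniformity on compact sets *)

Section uniformity.
Context {R : realType}.

Lemma compact_uniform (T : pseudoMetricType R) (K : set T) (Q : R -> T -> Prop) :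
  compact K ->
  (forall x, K x -> exists2 e : R, 0 < e &
     forall x' e', ball x e x' -> 0 < e' < e -> Q e' x') ->
  exists2 e : R, 0 < e & forall x, K x -> Q e x.
Proof.
move=> /compact_near_coveringP Kc KQ.
have : \forall e \near 0^'+, K `<=` Q e.
  apply: Kc => x Kx; have [e e0 eP] := KQ x Kx.
  exists (ball x e, [set e' | 0 < e' < e]); last first.
    by move=> [x' e'] [] /= xx' e'e; exact: eP.
  split; first exact: nbhsx_ballx.
  near=> e'; apply/andP; split; near: e'; [exact: nbhs_right_gt|exact: nbhs_right_lt].
move=> KQe; near (0:R)^'+ => e; exists e; first by near: e; exact: nbhs_right_gt.
by near: e; exact: KQe.
Unshelve. all: by end_near. Qed.

Lemma compact_closed_dist (X : metricType R) (A B : set X) :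
  compact A -> closed B -> (forall x, A x -> ~ B x) ->
  exists2 e : R, 0 < e & forall x y, A x -> B y -> e <= mdist x y.
Proof.
move=> Ac Bc AB; have [|e e0 eP] := @compact_uniform X A
    (fun e x => forall y, B y -> e <= mdist x y) Ac.
  move=> x Ax; have [e e0 eP] := closed_dist_gt0 Bc (AB x Ax).
  exists (e / 2); first by rewrite divr_gt0.
  move=> x' e'; rewrite ballEmdist /= => xx' /andP[_ e'e] y By.
  have := eP _ By; have := metric_triangle x x' y; lra.
by exists e => // x y Ax By; exact: eP.
Qed.

Lemma uniform_continuity_segment (X : metricType R) (g : R -> X) a b e :
  continuous g -> 0 < e -> exists2 d : R, 0 < d &
    forall s t, a <= s <= b -> `|s - t| < d -> mdist (g s) (g t) < e.
Proof.
move=> /metric_continuousP gc e0.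
have [|d d0 dP] := @compact_uniform R `[a, b]%classic
    (fun d s => forall t, `|s - t| < d -> mdist (g s) (g t) < e) (@segment_compact _ a b).
  move=> s _; have [|d d0 dP] := gc s (e / 2); first by rewrite divr_gt0.
  exists (d / 2); first by rewrite divr_gt0.
  move=> s' e'; rewrite /ball /= => ss' /andP[_ e'd] t st.
  have H1 : mdist (g s) (g s') < e / 2.
    by apply: dP; rewrite distrC; lra.
  have H2 : mdist (g s) (g t) < e / 2.
    by apply: dP; rewrite distrC; have := ler_distD s' s t; lra.
  have := metric_triangle (g s') (g s) (g t); rewrite (metric_sym (g s') (g s)).
  lra.
by exists d => // s t sab; apply: dP; rewrite /= in_itv.
Qed.

Lemma uniform_continuity_compact (X : metricType R) (f : X -> X) e :
  compact [set: X] -> continuous f -> 0 < e -> exists2 d : R, 0 < d &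
    forall x y, mdist x y < d -> mdist (f x) (f y) < e.
Proof.
move=> Xc /metric_continuous_selfP fc e0.
have [|d d0 dP] := @compact_uniform X [set: X]
    (fun d s => forall t, mdist s t < d -> mdist (f s) (f t) < e) Xc.
  move=> s _; have [|d d0 dP] := fc s (e / 2); first by rewrite divr_gt0.
  exists (d / 2); first by rewrite divr_gt0.
  move=> s' e'; rewrite ballEmdist /= => ss' /andP[_ e'd] t st.
  have H1 : mdist (f s) (f s') < e / 2 by apply: dP; lra.
  have H2 : mdist (f s) (f t) < e / 2.
    by apply: dP; have := metric_triangle s s' t; lra.
  have := metric_triangle (f s') (f s) (f t); rewrite (metric_sym (f s') (f s)).
  lra.
by exists d => // s t; exact: dP.
Qed.
End uniformity.

(** * Monotone paths *)

Section monotone_path.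
Context {R : realType} {X : metricType R}.
Variables (g : R -> X) (p q : R).
Hypothesis gc : continuous g.

Definition gap (U : set R) (x s t : R) :=
  [/\ p <= s < x, x < t <= q, (forall y, s < y < t -> U y), ~ U s /\ ~ U t &
      g s = g t].

(** The set is a disjoint union of open loops of the path; making the path
constant on each of them leaves it continuous. *)
Definition loop_set (U : set R) := forall x, U x -> exists s t, gap U x s t.

Lemma gap_mono (U V : set R) x s t s' t' : U `<=` V -> gap U x s t ->
  gap V x s' t' -> s' <= s /\ t <= t'.
Proof.
move=> UV [/andP[ps sx] /andP[xt tq] UU _ _] [/andP[_ sx'] /andP[xt' _] _ [nVs nVt] _].
split; rewrite leNgt; apply/negP => lt.
  by apply: nVs; apply/UV/UU; rewrite lt (lt_trans sx').
by apply: nVt; apply/UV/UU; rewrite lt andbT (lt_trans sx).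
Qed.

(** Along the chain the loop around a given point grows; its limit ends are
outside of the union, for a loop around one of them would contain the end of
some later loop, and by continuity the path takes the same value at both. *)
Lemma loop_set_chain (F : set (set R)) : F `<=` loop_set ->
  total_on F subset -> loop_set (\bigcup_(V in F) V).
Proof.
move=> FP Ftot x [V0 FV0 V0x].
pose S := [set s | exists V t, [/\ F V, V x & gap V x s t]].
pose T := [set t | exists V s, [/\ F V, V x & gap V x s t]].
have [s1 [t1 gap1]] := FP _ FV0 _ V0x.
have S1 : S s1 by exists V0, t1.
have T1 : T t1 by exists V0, s1.
have Sb : has_lbound S.
  by exists p => s [V [t [_ _ [/andP[]]]]].
have Tb : has_ubound T.
  by exists q => s [V [t [_ _ [_ /andP[]]]]].
have infS s : S s -> inf S <= s by move=> Ss; exact: ge_inf.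
have supT s : T s -> s <= sup T by move=> Ss; exact: ub_le_sup.
have approxS y : inf S < y -> exists V s t, [/\ F V, V x, gap V x s t & s < y].
  move=> iy; have [|s [V [t [? ? ?]]] sy] := inf_lt _ iy; first by exists s1.
  by exists V, s, t.
have approxT y : y < sup T -> exists V s t, [/\ F V, V x, gap V x s t & y < t].
  move=> iy; have [|t [V [s [? ? ?]]] sy] := sup_gt _ iy; first by exists t1.
  by exists V, s, t.
have merge V W : F V -> F W -> exists Z, [/\ F Z, V `<=` Z & W `<=` Z].
  by move=> FV FW; case: (Ftot _ _ FV FW) => ?; [exists W; split|exists V; split].
have sx : inf S < x.
  by case: gap1 => /andP[_ sx] _ _ _ _; apply: le_lt_trans sx; apply: infS.
have xt : x < sup T.
  by case: gap1 => _ /andP[xt _] _ _ _; apply: lt_le_trans xt _; apply: supT.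
have nS : ~ (\bigcup_(V in F) V) (inf S).
  move=> [W FW WS].
  have [Z [FZ V0Z WZ]] := merge _ _ FV0 FW.
  have [a [b [/andP[_ ai] /andP[ib _] abZ _ _]]] := FP _ FZ _ (WZ _ WS).
  have [V' [s [t [FV' V'x gapV' sb]]]] := approxS _ ib.
  have [Y [FY V'Y ZY]] := merge _ _ FV' FZ.
  have [s' [t' gapY]] := FP _ FY _ (V'Y _ V'x).
  have [s's _] := gap_mono V'Y gapV' gapY.
  have is' : inf S <= s' by apply: infS; exists Y, t'; split => //; exact: V'Y.
  case: gapY => _ _ _ [nYs _] _; apply/nYs/ZY/abZ.
  by rewrite (lt_le_trans ai) //= (le_lt_trans s's).
have nT : ~ (\bigcup_(V in F) V) (sup T).
  move=> [W FW WS].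
  have [Z [FZ V0Z WZ]] := merge _ _ FV0 FW.
  have [a [b [/andP[_ ai] /andP[ib _] abZ _ _]]] := FP _ FZ _ (WZ _ WS).
  have [V' [s [t [FV' V'x gapV' sb]]]] := approxT _ ai.
  have [Y [FY V'Y ZY]] := merge _ _ FV' FZ.
  have [s' [t' gapY]] := FP _ FY _ (V'Y _ V'x).
  have [_ s's] := gap_mono V'Y gapV' gapY.
  have is' : t' <= sup T by apply: supT; exists Y, s'; split => //; exact: V'Y.
  case: gapY => _ _ _ [_ nYs] _; apply/nYs/ZY/abZ.
  by rewrite (lt_le_trans sb) //= (le_lt_trans is').
exists (inf S), (sup T); split => //.
- rewrite sx andbT; apply: lb_le_inf; first by exists s1.
  by move=> s [V [t [_ _ [/andP[]]]]].
- rewrite xt /=; apply: ge_sup; first by exists t1.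
  by move=> s [V [t [_ _ [_ /andP[]]]]].
- move=> y /andP[iy yt]; case: (ltP y x) => xy.
    have [V [s [t [FV Vx [_ /andP[xt' _] + _ _] sy]]]] := approxS _ iy.
    by move=> Vst; exists V => //; apply: Vst; rewrite sy (lt_trans xy).
  have [V [s [t [FV Vx [/andP[_ sx'] _ + _ _] sy]]]] := approxT _ yt.
  by move=> Vst; exists V => //; apply: Vst; rewrite sy (lt_le_trans sx').
apply: contrapT => /eqP; rewrite -mdist_gt0 => d0.
have d20 : 0 < mdist (g (inf S)) (g (sup T)) / 2 by rewrite divr_gt0.
have /metric_continuousP gc' := gc.
have [ds ds0 dsP] := gc' (inf S) _ d20.
have [dt dt0 dtP] := gc' (sup T) _ d20.
have [|V [s [t [FV Vx gV sV]]]] := approxS (inf S + ds); first by rewrite ltrDl.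
have [|W [s' [t' [FW Wx gW sW]]]] := approxT (sup T - dt).
  by rewrite ltrBlDr ltrDl.
have [Z [FZ VZ WZ]] := merge _ _ FV FW.
have [a [b gZ]] := FP _ FZ _ (VZ _ Vx).
have [as_ _] := gap_mono VZ gV gZ.
have [_ tb] := gap_mono WZ gW gZ.
have ia : inf S <= a by apply: infS; exists Z, b; split=> //; exact: VZ.
have bs : b <= sup T by apply: supT; exists Z, a; split=> //; exact: VZ.
have gab : g a = g b by case: gZ.
have H1 := dsP a _; have H2 := dtP b _.
have {}H1 : mdist (g (inf S)) (g a) < mdist (g (inf S)) (g (sup T)) / 2.
  by apply: H1; rewrite ger0_norm ?subr_ge0 // ltrBlDl (le_lt_trans as_).
have {}H2 : mdist (g (sup T)) (g b) < mdist (g (inf S)) (g (sup T)) / 2.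
  by apply: H2; rewrite ler0_norm ?subr_le0 // opprB; lra.
have := metric_triangle (g (inf S)) (g a) (g (sup T)).
rewrite {2}gab (metric_sym (g b)).
by move: H1 H2; set u := mdist _ _; set v := mdist _ _; set w := mdist _ _; lra.
Qed.

Lemma loop_set_maximal :
  exists U, loop_set U /\ forall V, U `<=` V -> loop_set V -> V `<=` U.
Proof.
have [|U [PU Umax]] := @Zorn_bigcup _ loop_set.
  by move=> F FP Ft; exact: loop_set_chain.
exists U; split => // V UV PV; apply: contrapT => nVU.
by apply: (Umax V) => //; split.
Qed.

(** Collapse a maximal family of loops: were two points outside of it on one
fibre, the interval between them would be a further loop. *)
Lemma monotone_path : exists g' : R -> X,
  [/\ continuous g', g' p = g p, g' q = g q,
      (forall x, p <= x <= q -> exists2 y, p <= y <= q & g' x = g y) &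
      forall x y z, p <= x -> x <= y -> y <= z -> z <= q -> g' x = g' z ->
        g' y = g' x].
Proof.
have [U [PU Umax]] := loop_set_maximal.
have gapE x s t s' t' : gap U x s t -> gap U x s' t' -> s = s' /\ t = t'.
  move=> g1 g2; have [? ?] := gap_mono (@subset_refl _ U) g1 g2.
  have [? ?] := gap_mono (@subset_refl _ U) g2 g1.
  by split; apply/eqP; rewrite eq_le; apply/andP.
have gapS x s t y : gap U x s t -> s < y < t -> gap U y s t.
  move=> [/andP[ps sx] /andP[xt tq] UU UN gg] /andP[sy yt].
  by split => //; apply/andP; split.
have Upq x : U x -> p < x < q.
  by move=> /PU[s [t [/andP[a b] /andP[c d] _ _ _]]]; rewrite (le_lt_trans a) //= (lt_le_trans c).
pose l x := if pselect (U x) is left Ux then sval (cid (PU _ Ux)) else x.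
have lN x : ~ U x -> l x = x by rewrite /l; case: pselect.
have lU x s t : gap U x s t -> l x = s.
  move=> gx; rewrite /l; case: pselect => [Ux|[]]; last first.
    by case: gx => /andP[_ sx] /andP[xt _] + _ _; apply; rewrite sx xt.
  by case: (cid _) => s' /= [t' g']; have [] := gapE _ _ _ _ _ gx g'.
have gap_of x : U x -> exists s t, [/\ gap U x s t, l x = s & g (l x) = g t].
  move=> Ux; have [s [t gst]] := PU _ Ux; exists s, t; split => //; first exact: lU gst.
  by rewrite (lU _ _ _ gst); case: gst.
have /metric_continuousP gc' := gc.
exists (g \o l); split.
- apply/metric_continuousP => x e e0; case: (pselect (U x)) => Ux.
    have [s [t [gst lx _]]] := gap_of _ Ux.
    case: (gst) => /andP[_ sx] /andP[xt _] _ _ _.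
    exists (Num.min (x - s) (t - x)); first by rewrite lt_min !subr_gt0 sx.
    move=> y; rewrite lt_min => /andP[H1 H2] /=.
    have -> : l y = s.
      apply: lU; apply: (gapS _ _ _ _ gst); move: H1 H2; rewrite !ltr_norml; lra.
    by rewrite lx mdistxx.
  have [d d0 dP] := gc' x _ e0; exists d => // y xy /=.
  rewrite (lN _ Ux); case: (pselect (U y)) => Uy; last by rewrite (lN _ Uy); apply: dP.
  have [s [t [gst ly gly]]] := gap_of _ Uy.
  case: (gst) => /andP[_ sy] /andP[yt _] stU _ _.
  case: (ltP x y) => xyl.
    rewrite ly; apply: dP.
    have xs : x <= s.
      by rewrite leNgt; apply/negP => sx; apply: Ux; apply: stU; rewrite sx (lt_trans xyl).
    by move: xy; rewrite !ltr_norml; lra.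
  rewrite gly; apply: dP.
  have xs : t <= x.
    by rewrite leNgt; apply/negP => sx; apply: Ux; apply: stU; rewrite sx andbT (lt_le_trans sy).
  by move: xy; rewrite !ltr_norml; lra.
- by rewrite /= lN // => /Upq; rewrite ltxx.
- by rewrite /= lN // => /Upq; rewrite ltxx andbF.
- move=> x /andP[px xq]; exists (l x) => //.
  case: (pselect (U x)) => [Ux|/lN -> //]; last by rewrite px.
  have [s [t [[/andP[ps sx] _ _ _ _] -> _]]] := gap_of _ Ux.
  by rewrite ps (le_trans (ltW sx)).
move=> x y z px xy yz zq /= gxz.
have [x' [xx' nx' gx' gapx]] : exists x', [/\ x <= x', ~ U x', g (l x) = g x' &
    forall y, x <= y -> y < x' -> g (l y) = g (l x)].
  case: (pselect (U x)) => [Ux|nUx]; last first.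
    exists x; split => //; first by rewrite lN.
    by move=> w /le_lt_trans /[apply]; rewrite ltxx.
  have [s [t [gst ls gl]]] := gap_of _ Ux; exists t; split => //.
  - by case: gst => _ /andP[/ltW].
  - by case: gst => _ _ _ [].
  move=> w xw wt; rewrite ls (lU w s t) //; apply: (gapS _ _ _ _ gst); rewrite wt andbT.
  by case: gst => /andP[_ /lt_le_trans] + _ _ _ _; apply.
have [z' [zz' nz' gz' gapz]] : exists z', [/\ z' <= z, ~ U z', g (l z) = g z' &
    forall y, z' < y -> y <= z -> g (l y) = g (l z)].
  case: (pselect (U z)) => [Uz|nUz]; last first.
    exists z; split => //; first by rewrite lN.
    by move=> w /lt_le_trans /[apply]; rewrite ltxx.
  have [s [t [gst ls gl]]] := gap_of _ Uz; exists s; split => //.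
  - by case: gst => /andP[_ /ltW].
  - by case: gst => _ _ _ [].
  - by rewrite ls.
  move=> w xw wt; rewrite ls (lU w s t) //; apply: (gapS _ _ _ _ gst); rewrite xw /=.
  by case: gst => _ /andP[zt _] _ _ _; rewrite (le_lt_trans wt).
case: (ltP y x') => yx'; first by apply: gapx.
case: (ltP z' y) => z'y; first by rewrite gapz.
have [E|E] := eqVneq x' z'.
  have -> : y = x' by apply/eqP; rewrite eq_le yx' E z'y.
  by rewrite (lN _ nx') gx'.
have x'z' : x' < z' by rewrite lt_neqAle E (le_trans yx').
pose V := U `|` [set w | x' < w < z'].
have VU : V `<=` U.
  apply: Umax; first by move=> w; left.
  have gapV w : x' < w < z' -> gap V w x' z'.
    move=> /andP[xw wz]; split => //.
    - by rewrite xw (le_trans px).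
    - by rewrite wz (le_trans zz').
    - by move=> v vxz; right.
    - by split=> -[//|/andP[]]; rewrite ltxx.
    - by rewrite -gx' gxz gz'.
  move=> w Vw; have [wxz|wxz] := pselect (x' < w < z').
    by exists x', z'; exact: gapV.
  have Uw : U w by case: Vw.
  have [s [t [/andP[ps sw] /andP[wt tq] stU [ns nt] gg]]] := PU _ Uw.
  exists s, t; split; rewrite ?sw ?wt ?ps ?tq //; first by move=> v /stU; left.
  have tx' : t <= x' \/ z' <= s.
    move/negP: wxz; rewrite negb_and -!leNgt => /orP[] c; [left|right].
      by rewrite leNgt; apply/negP => x't; apply: nx'; apply: stU; rewrite x't (lt_le_trans sw).
    by rewrite leNgt; apply/negP => x't; apply: nz'; apply: stU; rewrite x't (le_lt_trans c).
  by split=> -[//|/= /andP[a b]]; case: tx'; lra.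
have Uw w : x' < w < z' -> U w by move=> ?; apply: VU; right.
have [<-|xy'] := eqVneq x' y; first by rewrite (lN _ nx') gx'.
have [yE|yz'] := eqVneq y z'; first by rewrite gxz yE (lN _ nz') gz'.
have xyz : x' < y < z' by rewrite !lt_neqAle xy' yz' yx' z'y.
rewrite gx'; congr g; apply: (lU _ _ z').
move: xyz => /andP[xy1 yz1].
split; rewrite ?xy1 ?yz1 ?andbT ?(le_trans px) //.
  by rewrite (le_trans zz').
by rewrite -gx' gxz gz'.
Qed.
End monotone_path.

(** * Dyadic sums *)

Section dyadic_sum.
Context {R : realType}.
Implicit Types u v : nat -> R.

Definition dyadic_sum u : R := limn (fun N => \sum_(n < N) u n / 2 ^+ n.+1).

Lemma dyadic_weights N : \sum_(n < N) (2 ^- n.+1 : R) = 1 - 2 ^- N.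
Proof.
elim: N => [|N IH]; first by rewrite big_ord0 expr0 invr1 subrr.
rewrite big_ord_recr /= IH -addrA; congr (_ + _).
by rewrite exprS invfM; field; rewrite expf_neq0 // pnatr_eq0.
Qed.

Lemma is_cvg_dyadic_sum u : (forall n, 0 <= u n <= 1) ->
  cvgn (fun N => \sum_(n < N) u n / 2 ^+ n.+1).
Proof.
move=> u01; apply: nondecreasing_is_cvgn.
  apply/nondecreasing_seqP => n; rewrite big_ord_recr /= lerDl divr_ge0 ?exprn_ge0 //.
  by case/andP: (u01 n).
exists 1 => _ [N _ <-]; apply: (@le_trans _ _ (\sum_(n < N) (2 ^- n.+1))).
  apply: ler_sum => n _; rewrite ler_piMl ?invr_ge0 ?exprn_ge0 //.
  by case/andP: (u01 n).
by rewrite dyadic_weights gerBl invr_ge0 exprn_ge0.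
Qed.

Lemma ler_dyadic_sum u v e : (forall n, 0 <= u n <= 1) ->
  (forall n, 0 <= v n <= 1) -> 0 <= e -> (forall n, u n <= v n + e) ->
  dyadic_sum u <= dyadic_sum v + e.
Proof.
move=> u01 v01 e0 uv.
have cu := is_cvg_dyadic_sum u01; have cv := is_cvg_dyadic_sum v01.
have -> : dyadic_sum v + e =
    limn ((fun N => \sum_(n < N) v n / 2 ^+ n.+1) \+ cst e).
  by rewrite limD ?lim_cst //; exact: cvg_cst.
rewrite /dyadic_sum; apply: ler_lim => //; first by apply: is_cvgD => //; apply: is_cvg_cst.
near=> N => /=.
apply: (@le_trans _ _ (\sum_(n < N) (v n / 2 ^+ n.+1 + e * 2 ^- n.+1))).
  by apply: ler_sum => n _; rewrite -mulrDl ler_wpM2r // invr_ge0 exprn_ge0.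
rewrite big_split /= lerD2l -mulr_sumr dyadic_weights.
by rewrite ler_piMr // gerBl invr_ge0 exprn_ge0.
Unshelve. all: by end_near. Qed.

Lemma ltr_dyadic_sum u v m : (forall n, 0 <= u n <= 1) ->
  (forall n, 0 <= v n <= 1) -> (forall n, u n <= v n) -> u m < v m ->
  dyadic_sum u < dyadic_sum v.
Proof.
move=> u01 v01 uv uvm.
have cu := is_cvg_dyadic_sum u01; have cv := is_cvg_dyadic_sum v01.
pose d := (v m - u m) / 2 ^+ m.+1.
have d0 : 0 < d by rewrite divr_gt0 ?exprn_gt0 // subr_gt0.
suff : dyadic_sum u + d <= dyadic_sum v by apply: lt_le_trans; rewrite ltrDl.
have -> : dyadic_sum u + d =
    limn ((fun N => \sum_(n < N) u n / 2 ^+ n.+1) \+ cst d).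
  by rewrite limD ?lim_cst //; exact: cvg_cst.
rewrite /dyadic_sum; apply: ler_lim => //; first by apply: is_cvgD => //; apply: is_cvg_cst.
exists m.+1 => // N /= mN.
rewrite (bigD1 (Ordinal mN)) //= [leRHS](bigD1 (Ordinal mN)) //=.
rewrite addrAC /d mulrBl subrKC lerD2l; apply: ler_sum => n _.
by rewrite ler_wpM2r // invr_ge0 exprn_ge0.
Qed.
End dyadic_sum.

Section clamp.
Context {R : realType} {X : metricType R}.

Definition clamp (a b x : R) : R := Num.max a (Num.min b x).

Lemma clamp_in a b x : a <= b -> a <= clamp a b x <= b.
Proof. by move=> ab; rewrite /clamp le_max lexx /= ge_max ab ge_min lexx. Qed.

Lemma clamp_id a b x : a <= x <= b -> clamp a b x = x.
Proof. by move=> /andP[ax xb]; rewrite /clamp min_r // max_r. Qed.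

Lemma clamp_mono a b x y : x <= y -> clamp a b x <= clamp a b y.
Proof.
move=> xy; rewrite /clamp ge_max !le_max lexx /=; apply/orP; right.
by rewrite le_min ge_min lexx /= ge_min xy orbT.
Qed.

Lemma clamp_lip a b x y : `|clamp a b x - clamp a b y| <= `|x - y|.
Proof.
have lip u v (m : R -> R -> R) : m = Num.max \/ m = Num.min ->
    forall c, `|m c u - m c v| <= `|u - v|.
  have := ler_norm (u - v); have := ler_norm (v - u); rewrite (distrC v u).
  by move=> H1 H2 [] -> c; rewrite /Num.max /Num.min;
    do ![case: ifPn; rewrite -?leNgt => ?]; rewrite ler_norml; apply/andP; split; lra.
apply: le_trans (lip _ _ Num.min _ b); last by right.
by rewrite /clamp; apply: (lip _ _ Num.max); left.
Qed.

Lemma clamp_continuous (g : R -> X) a b : a <= b ->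
  {within `[a, b], continuous g} -> continuous (g \o clamp a b).
Proof.
move=> ab /subspace_continuousP gc; apply/metric_continuousP => t e e0.
have /gc : `[a, b]%classic (clamp a b t) by rewrite /= in_itv /= clamp_in.
move=> /cvg_ballP/(_ _ e0) [d /= d0 dP]; exists d => // s st /=.
have := dP (clamp a b s); rewrite ballEmdist /=; apply.
  by rewrite /ball /= distrC (le_lt_trans (clamp_lip _ _ _ _)).
by rewrite /= in_itv /= clamp_in.
Qed.
End clamp.

(** * Parametrisation of arcs *)

Section arc_parametrisation.
Context {R : realType} {X : metricType R}.
Variables (g : R -> X) (p : R).
Hypothesis gp : forall x, x <= p -> g x = g p.
Hypothesis gc : continuous g.
Hypothesis gmono :
  forall x y z, x <= y -> y <= z -> g x = g z -> g y = g x.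

Definition dense_point (n : nat) : X := g (ratr (odflt 0 (unpickle n)) : R).

(** Truncated at 1, so that its dyadic sum over n converges. *)
Definition past_dist (x : R) (n : nat) : R :=
  inf [set Num.min 1 (mdist (dense_point n) (g y)) | y in [set y | y <= x]].

Lemma past_distP x n m : (forall y, y <= x -> m <= 1 /\ m <= mdist (dense_point n) (g y)) ->
  m <= past_dist x n.
Proof.
move=> mP; apply: lb_le_inf; first by exists (Num.min 1 (mdist (dense_point n) (g x))), x => /=.
by move=> _ [y /= yx <-]; rewrite le_min; have [-> ->] := mP y yx.
Qed.

Lemma past_dist_le x n y : y <= x ->
  past_dist x n <= 1 /\ past_dist x n <= mdist (dense_point n) (g y).
Proof.
move=> yx; have : past_dist x n <= Num.min 1 (mdist (dense_point n) (g y)).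
  apply: ge_inf; last by exists y.
  by exists 0 => _ [z _ <-]; rewrite le_min ler01 mdist_ge0.
by rewrite le_min => /andP.
Qed.

Lemma past_dist01 x n : 0 <= past_dist x n <= 1.
Proof.
have [-> _] := @past_dist_le x n x (lexx _); rewrite andbT.
by apply: past_distP => y _; rewrite ler01 mdist_ge0.
Qed.

Lemma past_dist_mono x y n : x <= y -> past_dist y n <= past_dist x n.
Proof.
move=> xy; apply: past_distP => z zx.
exact: past_dist_le (le_trans zx xy).
Qed.

Lemma past_dist_lip x y n e : x <= y ->
  (forall z, x <= z <= y -> mdist (g x) (g z) <= e) ->
  past_dist x n <= past_dist y n + e.
Proof.
move=> xy ze; rewrite -lerBlDr.
have e0 : 0 <= e by rewrite (le_trans _ (ze x _)) ?mdist_ge0 // lexx.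
apply: past_distP => z zy; split.
  by rewrite lerBlDr (le_trans (past_dist_le n (lexx x)).1) // lerDl.
case: (leP z x) => zx.
  by rewrite lerBlDr (le_trans (past_dist_le n zx).2) // lerDl.
have := ze z; rewrite (ltW zx) zy => /(_ isT).
have := (past_dist_le n (lexx x)).2.
have := metric_triangle (dense_point n) (g z) (g x).
rewrite (metric_sym (g z)); lra.
Qed.

(** Up to sign, the size of the part of the path run before time x, in the
sense of Whitney. *)
Definition path_size (x : R) : R := dyadic_sum (past_dist x).

Lemma path_size_le x y : x <= y -> path_size y <= path_size x.
Proof.
move=> xy; rewrite -[leRHS]addr0; apply: ler_dyadic_sum => //; try exact: past_dist01.
by move=> n; rewrite addr0; exact: past_dist_mono.
Qed.

Lemma path_size_continuous : continuous path_size.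
Proof.
have /metric_continuousP gc' := gc.
apply: real_continuousP => x e e0; have e20 : 0 < e / 4 by rewrite divr_gt0.
have [d d0 dP] := gc' x _ e20; exists d => // y yd.
case: (leP x y) => xy.
  have H1 := path_size_le xy.
  have H2 : path_size x <= path_size y + e / 4.
    apply: ler_dyadic_sum; try exact: past_dist01; first exact: ltW.
    move=> n; apply: past_dist_lip => // z /andP[xz zy]; apply/ltW/dP.
    by move: yd; rewrite !ltr_norml; lra.
  by rewrite ltr_norml; lra.
have H1 := path_size_le (ltW xy).
have H2 : path_size y <= path_size x + e / 2.
  apply: ler_dyadic_sum; try exact: past_dist01; first by rewrite divr_ge0 // ltW.
  move=> n; apply: past_dist_lip; [exact: ltW|move=> z /andP[xz zy]].
  have H0 : mdist (g x) (g z) < e / 4 by apply: dP; move: yd; rewrite !ltr_norml; lra.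
  have H3 := dP _ yd; have := metric_triangle (g y) (g x) (g z).
  by rewrite (metric_sym (g y) (g x)); lra.
by rewrite ltr_norml; lra.
Qed.

(** The point g y is off the compact past at time x, so that a point of the
dense sequence near g y detects the difference. *)
Lemma path_size_lt x y : x <= y -> g x <> g y -> path_size y < path_size x.
Proof.
move=> xy gxy; have {}xy : x < y.
  by rewrite lt_neqAle xy andbT; apply/eqP => E; apply: gxy; rewrite E.
have nC z : z <= x -> g z <> g y.
  move=> zx E; apply: gxy; rewrite -E; exact: gmono zx (ltW xy) E.
have nP : ~ (g @` `[p, Num.max p x]) (g y).
  move=> [z /=]; rewrite in_itv/= le_max => /andP[pz /orP[zp|zx]].
    have -> : z = p by apply/eqP; rewrite eq_le zp.
    have [xp|px] := leP x p; last by apply: nC; exact: ltW.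
    by rewrite -(gp xp); apply: nC.
  exact: nC zx.
have [e e0 eP] := closed_dist_gt0 (path_image_closed (a := p) (b := Num.max p x) gc) nP.
have {}eP z : z <= x -> e <= mdist (g y) (g z).
  move=> zx; apply: eP; have [zp|pz] := leP z p.
    by rewrite (gp zp); exists p => //=; rewrite in_itv/= lexx le_max lexx.
  by exists z => //=; rewrite in_itv/= (ltW pz) le_max zx orbT.
pose e' := Num.min e 1.
have e'0 : 0 < e' by rewrite lt_min e0 ltr01.
have [e'e e'1] : e' <= e /\ e' <= 1 by rewrite /e' !ge_min !lexx orbT.
have /metric_continuousP/(_ y (e' / 3)) := gc.
rewrite divr_gt0 // => /(_ isT)[d d0 dP].
have [r] : exists r : rat, ratr r \in `](y - d), y[ .
  by apply: rat_in_itvoo; rewrite ltrBlDr ltrDl.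
rewrite in_itv/= => /andP[r1 r2].
have rn : dense_point (pickle r) = g (ratr r) by rewrite /dense_point pickleK.
have dr : mdist (g y) (g (ratr r)) < e' / 3 by apply: dP; rewrite ltr_norml; lra.
apply: (@ltr_dyadic_sum _ _ _ (pickle r)); try exact: past_dist01.
  by move=> n; apply: past_dist_mono; exact: ltW.
have [_] := past_dist_le (pickle r) (lexx y); rewrite rn metric_sym => H1.
suff : e' / 3 * 2 <= past_dist x (pickle r) by lra.
apply: past_distP => z zx; split; first by lra.
have := eP _ zx; have := metric_triangle (g y) (g (ratr r)) (g z).
rewrite rn; lra.
Qed.
End arc_parametrisation.

(** The normalised size of the past is a continuous function of time that is
constant exactly on the fibres of the path; hence it is a parameter along the
image. *)
Lemma arc_of_monotone_path {R : realType} {X : metricType R} (g : R -> X) p q :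
  continuous g -> p <= q -> g p <> g q ->
  (forall x y z, p <= x -> x <= y -> y <= z -> z <= q -> g x = g z -> g y = g x) ->
  exists k : R -> X, [/\ continuous k, k 0 = g p, k 1 = g q,
    {in `[0, 1] &, injective k} &
    forall v, exists2 x, p <= x <= q & k v = g x].
Proof.
move=> gc pq gpq gm.
pose G := g \o clamp p q.
have Gc : continuous G by apply: clamp_continuous => //; exact: continuous_subspaceT.
have Gm x y z : x <= y -> y <= z -> G x = G z -> G y = G x.
  move=> xy yz; apply: gm; try exact: clamp_mono.
    by have /andP[] := clamp_in x pq.
  by have /andP[] := clamp_in z pq.
have GE x : p <= x <= q -> G x = g x by move=> xpq; rewrite /G /= clamp_id.
have Gp x : x <= p -> G x = G p.
  move=> xp; rewrite /G /=; congr g; rewrite /clamp.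
  by rewrite min_r ?(le_trans xp) // max_l // min_r // maxxx.
pose W := path_size G.
have Wc : continuous W := path_size_continuous Gc.
have W_lt x y : x <= y -> G x <> G y -> W y < W x.
  exact: (path_size_lt Gp Gc Gm).
have W_le x y : x <= y -> W y <= W x by move=> xy; exact: path_size_le.
have W_eq x y : W x = W y -> G x = G y.
  move=> E; apply: contrapT => n; have [xy|xy] := leP x y.
    by have := W_lt _ _ xy n; rewrite E ltxx.
  by have := W_lt _ _ (ltW xy) (not_eq_sym n); rewrite E ltxx.
have Wpq : W q < W p by apply: W_lt => //; rewrite !GE ?lexx ?pq.
pose w x := (W p - W x) / (W p - W q).
have dW : 0 < W p - W q by rewrite subr_gt0.
have wp : w p = 0 by rewrite /w subrr mul0r.
have wq : w q = 1 by rewrite /w divff // gt_eqF.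
have wc : continuous w.
  move=> x; apply: cvgM; last exact: cvg_cst.
  by apply: cvgB; [exact: cvg_cst|exact: Wc].
have w01 x : p <= x <= q -> 0 <= w x <= 1.
  move=> /andP[px xq]; rewrite /w divr_ge0 ?subr_ge0 ?W_le ?(ltW dW) //=.
  by rewrite ler_pdivrMr // mul1r lerD2l lerN2 W_le.
have w_inj x y : w x = w y -> G x = G y.
  move=> E; apply: W_eq; move: E; rewrite /w => /(mulIf _).
  by rewrite invr_eq0 gt_eqF // => /(_ isT)/addrI/oppr_inj.
have xiP v : exists x, 0 <= v <= 1 -> p <= x <= q /\ w x = v.
  have [v01|] := pselect (0 <= v <= 1); last by exists 0.
  have [] := @IVT R w p q v pq; first exact: continuous_subspaceT.
    by rewrite wp wq min_l // max_r.
  by move=> x; rewrite in_itv/= => xpq wx; exists x.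
have [xi {}xiP] := choice xiP.
pose k0 := G \o xi.
have kw x : p <= x <= q -> k0 (w x) = G x.
  by move=> xpq; have [_ E] := xiP _ (w01 _ xpq); apply: w_inj.
have wim : w @` `[p, q] = `[0, 1]%classic.
  apply/seteqP; split=> [_ [x /= + <-]|v /=]; rewrite !in_itv/=; first exact: w01.
  by move=> /xiP[xpq <-]; exists (xi v) => //=; rewrite in_itv.
have k0c : {within `[0, 1], continuous k0}.
  rewrite -wim; apply: (compact_quotient_continuous (g := G)).
  - exact: Rhausdorff.
  - exact: segment_compact.
  - exact: continuous_subspaceT.
  - exact: continuous_subspaceT.
  - by move=> x /=; rewrite in_itv/=; exact: kw.
exists (k0 \o clamp 0 1); split.
- by apply: clamp_continuous => //; rewrite ler01.
- by rewrite /= clamp_id ?lexx ?ler01 // -wp kw ?lexx // GE ?lexx.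
- by rewrite /= clamp_id ?lexx ?ler01 // -wq kw ?lexx ?pq // GE ?lexx ?pq.
- move=> u v; rewrite !in_itv/= => u01 v01; rewrite /= !clamp_id //.
  have [upq <-] := xiP _ u01; have [vpq <-] := xiP _ v01.
  rewrite !kw // => E; apply: contrapT => n.
  have W_eq' x y : x <= y -> G x = G y -> W x = W y.
    move=> xy Exy; apply/eqP; rewrite eq_le; apply/andP; split; last exact: W_le.
    rewrite -[leRHS]addr0.
    apply: ler_dyadic_sum => //; try exact: past_dist01.
    move=> m; apply: past_dist_lip => // z /andP[xz zy].
    by rewrite (Gm _ _ _ xz zy Exy) mdistxx.
  by apply: n; rewrite /w; have [xy|xy] := leP (xi u) (xi v);
    [rewrite (W_eq' _ _ xy E)|rewrite (W_eq' _ _ (ltW xy) (esym E))].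
move=> v; have [xpq _] := xiP _ (clamp_in v ler01).
by exists (xi (clamp 0 1 v)) => //; rewrite /k0 /= -GE.
Qed.

(** * Circles *)

Section circle.
Context {R : realType} {X : metricType R}.

(** Two arcs with the same ends and no other common point form a circle: map
the upper half of the unit circle to one of them and the lower half to the
other, by means of the first coordinate. *)
Lemma circle_of_two_arcs (h k : R -> X) : continuous h -> continuous k ->
  {in `[0, 1] &, injective h} -> {in `[0, 1] &, injective k} ->
  h 0 = k 0 -> h 1 = k 1 ->
  (forall u v, 0 <= u <= 1 -> 0 <= v <= 1 -> h u = k v ->
    (u = 0 /\ v = 0) \/ (u = 1 /\ v = 1)) ->
  exists S : set X, homeomorphic (@unit_circle R) S.
Proof.
move=> hc kc hi ki hk0 hk1 hk.
pose half (p : R * R) := (1 + p.1) / 2.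
pose F p := if 0 <= p.2 then h (half p) else k (half p).
have C1 (p : R * R) : unit_circle p -> -1 <= p.1 <= 1 /\ -1 <= p.2 <= 1.
  by rewrite /unit_circle /= => E; split; apply/andP; split; nra.
have half01 p : unit_circle p -> 0 <= half p <= 1.
  by move=> /C1[/andP[? ?] _]; rewrite /half; apply/andP; split; lra.
have halfE0 p : half p = 0 -> p.1 = -1 by rewrite /half; lra.
have halfE1 p : half p = 1 -> p.1 = 1 by rewrite /half; lra.
have snd0 (p : R * R) : unit_circle p -> p.1 = -1 \/ p.1 = 1 -> p.2 = 0.
  move=> pC p1; apply/eqP; rewrite -sqrf_eq0; apply/eqP.
  by move: pC; rewrite /unit_circle /=; case: p1 => ->; nra.
have Fi p q : unit_circle p -> unit_circle q -> F p = F q -> p = q.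
  move=> pC qC FE.
  have E1 : p.1 = q.1 /\ ((0 <= p.2) = (0 <= q.2) \/ p.1 = -1 \/ p.1 = 1).
    have hin (x : R * R) : unit_circle x -> half x \in `[0, 1] by rewrite in_itv/=; exact: half01.
    have half_inj : half p = half q -> p.1 = q.1 by rewrite /half; lra.
    move: FE; rewrite /F; case: ifP => p2; case: ifP => q2 E.
    - by split; [apply/half_inj/hi => //; exact: hin|left].
    - by case: (hk _ _ (half01 _ pC) (half01 _ qC) E) => -[e1 e2];
        (split; [by apply: half_inj; rewrite e1 e2|right]); [left; exact: halfE0|right; exact: halfE1].
    - by case: (hk _ _ (half01 _ qC) (half01 _ pC) (esym E)) => -[e1 e2];
        (split; [by apply: half_inj; rewrite e1 e2|right]); [left; exact: halfE0|right; exact: halfE1].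
    - by split; [apply/half_inj/ki => //; exact: hin|left].
  case: E1 => E1 E2; have {E2}E2 : p.2 = q.2.
    case: E2 => [E2|E2]; last by rewrite !snd0 // -E1.
    have : p.2 ^+ 2 = q.2 ^+ 2.
      by move: pC qC; rewrite /unit_circle /= E1; lra.
    move/eqP; rewrite eqf_sqr => /orP[/eqP //|/eqP E3].
    by move: E2 E3; case: (leP 0 q.2); case: (leP 0 p.2) => // p2 q2 _ E3; lra.
  by case: p q E1 E2 {pC qC FE} => [? ?] [? ?] /= -> ->.
have sndc : continuous (fun p : R * R => p.2) by move=> p; exact: cvg_snd.
have fstc : continuous (fun p : R * R => p.1) by move=> p; exact: cvg_fst.
have Cc : closed (@unit_circle R).
  have -> : @unit_circle R = (fun p : R * R => p.1 ^+ 2 + p.2 ^+ 2) @^-1` [set 1] by [].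
  apply: preimage_closed; last exact: closed_eq.
  move=> p _; apply: cvgD.
    by apply: (@cvg_comp _ _ _ fst (fun x : R => x ^+ 2)); [exact: cvg_fst|exact: exprn_continuous].
  by apply: (@cvg_comp _ _ _ snd (fun x : R => x ^+ 2)); [exact: cvg_snd|exact: exprn_continuous].
have Ck : compact (@unit_circle R).
  have Bk : compact ((`[-1, 1]%classic : set R) `*` (`[-1, 1]%classic : set R)).
    by apply: compact_setX; exact: segment_compact.
  apply: (subclosed_compact Cc Bk).
  by move=> p /C1[? ?]; split; rewrite /= in_itv.
have halfc : continuous half.
  move=> p; apply: cvgM; last exact: cvg_cst.
  by apply: cvgD; [exact: cvg_cst|exact: cvg_fst].
have Fc : {within @unit_circle R, continuous F}.
  have -> : @unit_circle R = (@unit_circle R `&` [set p | 0 <= p.2]) `|`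
                             (@unit_circle R `&` [set p | p.2 <= 0]).
    by rewrite -setIUr; apply/seteqP; split=> p [] //; split => //=; apply/orP/le_total.
  apply: withinU_continuous.
  - by apply: closedI => //; apply: (preimage_closed (f := fun p : R * R => p.2)) (@closed_ge R 0).
  - by apply: closedI => //; apply: (preimage_closed (f := fun p : R * R => p.2)) (@closed_le R 0).
  - apply: (@subspace_eq_continuous _ _ _ (h \o half)).
      by move=> p /set_mem[_ /= p2]; rewrite /F /from_subspace p2.
    by apply: continuous_subspaceT => p; apply: continuous_comp; [exact: halfc|exact: hc].
  - apply: (@subspace_eq_continuous _ _ _ (k \o half)).
      move=> p /set_mem[pC /= p2]; rewrite /F /from_subspace; case: ifP => // p2'.
      have : p.2 = 0 by apply/eqP; rewrite eq_le p2.
      move=> E; have : p.1 ^+ 2 = 1 by move: pC; rewrite /unit_circle /= E; lra.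
      move/eqP; rewrite sqrf_eq1 /half => /orP[]/eqP ->.
        by rewrite divff // hk1.
      by rewrite subrr mul0r hk0.
    by apply: continuous_subspaceT => p; apply: continuous_comp; [exact: halfc|exact: kc].
have GP x : exists p, (F @` @unit_circle R) x -> unit_circle p /\ F p = x.
  by have [[p ? ?]|] := pselect ((F @` @unit_circle R) x); [exists p|exists 0].
have [G {}GP] := choice GP.
have GF p : unit_circle p -> G (F p) = p.
  by move=> pC; have [|? ?] := GP (F p); [exists p|exact: Fi].
exists (F @` @unit_circle R), F, G; split; last first.
  split => //; apply: (compact_quotient_continuous (g := id)) => //.
  - exact: metric_hausdorff.
    by apply: continuous_subspaceT => x; exact: cvg_id.
split.
- by move=> p pC; exists p.
- by move=> x /GP[].
- by move=> p /set_mem; exact: GF.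
- by move=> x /set_mem/GP[].
Qed.
End circle.

(** * Paths joining two points of an arc *)

Section uniquely_arcwise.
Context {R : realType} {X : metricType R}.
Hypothesis no_circle : forall S : set X, ~ homeomorphic (@unit_circle R) S.

Definition arc_on (h : R -> X) (a b : R) :=
  continuous h /\ {in `[a, b] &, injective h}.

Lemma arc_onW h a b s t : a <= s -> t <= b -> arc_on h a b -> arc_on h s t.
Proof.
move=> as_ tb [hc hi]; split=> // u v; rewrite !in_itv/= => /andP[su ut] /andP[sv vt].
by apply: hi; rewrite in_itv/= ?(le_trans as_) ?(le_trans _ tb).
Qed.

(** If a path between two points of an arc missed an intermediate point of that
arc, its last passage before that point and its first passage after it would
bound a subpath leaving the arc; an arc inside this subpath closes up to a
circle. *)
Lemma path_covers_arc_up h a b (g : R -> X) p q s r t :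
  arc_on h a b -> continuous g -> p <= q ->
  a <= s -> s <= r -> r <= t -> t <= b -> g p = h s -> g q = h t ->
  exists2 m, p <= m <= q & g m = h r.
Proof.
move=> harc gc pq as_ sr rt tb gp gq; apply: contrapT => nr.
have {}harc : arc_on h s t := arc_onW as_ tb harc.
have [hc hi] := harc.
have ne m : p <= m <= q -> g m <> h r by move=> mpq E; apply: nr; exists m.
have Lc u v : closed (g @^-1` (h @` `[u, v])).
  by apply: closed_path_preimage => //; exact: path_image_closed.
have [q1 [t1 /=]] : exists2 m, (g @^-1` (h @` `[r, t])) m & p <= m <= q /\
    forall m', (g @^-1` (h @` `[r, t])) m' -> p <= m' <= q -> m <= m'.
  apply: closed_min_in; first exact: Lc.
  exists q; last by rewrite pq lexx.
  by exists t => //=; rewrite in_itv/= rt lexx.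
rewrite in_itv/= => /andP[rt1 t1t] gq1 [/andP[pq1 q1q] q1min].
have [p1 [s1 /=]] : exists2 m, (g @^-1` (h @` `[s, r])) m & p <= m <= q1 /\
    forall m', (g @^-1` (h @` `[s, r])) m' -> p <= m' <= q1 -> m' <= m.
  apply: closed_max_in; first exact: Lc.
  exists p; last by rewrite pq1 lexx.
  by exists s => //=; rewrite in_itv/= sr lexx.
rewrite in_itv/= => /andP[ss1 s1r] gp1 [/andP[pp1 p1q1] p1max].
have {}rt1 : r < t1.
  rewrite lt_neqAle rt1 andbT; apply/eqP => E; apply: (ne q1); first by rewrite pq1.
  by rewrite -gq1 E.
have {}s1r : s1 < r.
  rewrite lt_neqAle s1r andbT; apply/eqP => E; apply: (ne p1).
    by rewrite pp1 (le_trans p1q1).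
  by rewrite -gp1 E.
have s1t1 : s1 < t1 by exact: lt_trans rt1.
have hne : h s1 <> h t1.
  move=> /hi; rewrite !in_itv/= => E; have := s1t1; rewrite E ?ltxx //.
    by rewrite ss1 (le_trans (ltW s1t1)).
  by rewrite t1t (le_trans ss1 (ltW s1t1)).
have inside m u : p1 <= m <= q1 -> s1 <= u <= t1 -> g m = h u -> m = p1 \/ m = q1.
  move=> /andP[p1m mq1] /andP[s1u ut1] E; have [ur|ru] := leP u r.
    left; apply/eqP; rewrite eq_le p1m andbT; apply: p1max.
      by exists u => //=; rewrite in_itv/= ur (le_trans ss1).
    by rewrite mq1 (le_trans pp1).
  right; apply/eqP; rewrite eq_le mq1 /=; apply: q1min.
    by exists u => //=; rewrite in_itv/= (ltW ru) (le_trans ut1).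
  by rewrite (le_trans pp1) ?(le_trans mq1).
have [g' [g'c g'p g'q g'im g'mono]] := monotone_path p1 q1 gc.
have g'ne : g' p1 <> g' q1 by rewrite g'p g'q -gp1 -gq1.
have [k [kc k0 k1 ki kim]] := arc_of_monotone_path g'c p1q1 g'ne g'mono.
pose l u := h (s1 + u * (t1 - s1)).
have l_in u : 0 <= u <= 1 -> s1 <= s1 + u * (t1 - s1) <= t1.
  by move=> /andP[u0 u1]; apply/andP; split; nra.
have in_st u : s1 <= u <= t1 -> u \in `[s, t].
  by rewrite in_itv/= => /andP[? ?]; rewrite (le_trans ss1) ?(le_trans _ t1t).
have ac : continuous (fun u : R => s1 + u * (t1 - s1)).
  by move=> u; apply: cvgD; [exact: cvg_cst|apply: cvgM; [exact: cvg_id|exact: cvg_cst]].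
have lc : continuous l by move=> u; exact: (continuous_comp (ac u) (hc _)).
have li : {in `[0, 1] &, injective l}.
  move=> u v; rewrite !in_itv/= => u01 v01 /hi E.
  have /addrI/mulIf := E (in_st _ (l_in _ u01)) (in_st _ (l_in _ v01)).
  by apply; rewrite subr_eq0 gt_eqF.
have l0 : l 0 = h s1 by rewrite /l mul0r addr0.
have l1 : l 1 = h t1 by rewrite /l mul1r subrKC.
have [S] : exists S : set X, homeomorphic (@unit_circle R) S; last exact: no_circle.
apply: (circle_of_two_arcs lc kc li ki).
- by rewrite l0 k0 g'p.
- by rewrite l1 k1 g'q.
move=> u v u01 v01 E.
have I0 : (0 : R) \in `[0, 1] by rewrite in_itv/= lexx ler01.
have I1 : (1 : R) \in `[0, 1] by rewrite in_itv/= lexx ler01.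
have Iu : u \in `[0, 1] by rewrite in_itv.
have Iv : v \in `[0, 1] by rewrite in_itv.
have [x xpq kx] := kim v; have [m mpq g'x] := g'im _ xpq.
have [mE|mE] := inside m _ mpq (l_in _ u01) (etrans (esym (etrans kx g'x)) (esym E)).
  left; split; [apply: li => //|apply: ki => //].
    by rewrite E kx g'x mE -gp1 l0.
  by rewrite kx g'x mE k0 g'p.
right; split; [apply: li => //|apply: ki => //].
  by rewrite E kx g'x mE -gq1 l1.
by rewrite kx g'x mE k1 g'q.
Qed.

Lemma path_covers_arc h a b (g : R -> X) p q s r t :
  arc_on h a b -> continuous g -> p <= q ->
  a <= s <= b -> a <= t <= b -> (s <= r <= t) || (t <= r <= s) ->
  g p = h s -> g q = h t ->
  exists2 m, p <= m <= q & g m = h r.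
Proof.
move=> harc gc pq /andP[as_ sb] /andP[at_ tb] /orP[/andP[sr rt]|/andP[tr rs]] gp gq.
  exact: (path_covers_arc_up harc gc pq as_ sr rt tb gp gq).
have [||||m mqp gm] := @path_covers_arc_up h a b (g \o -%R) (- q) (- p) t r s harc _ _ at_ tr rs sb.
- by move=> x; apply: continuous_comp; [exact: opp_continuous|exact: gc].
- by rewrite lerN2.
- by rewrite /= opprK.
- by rewrite /= opprK.
by exists (- m) => //; rewrite lerNr lerNl andbC.
Qed.
End uniquely_arcwise.

(** * Lifting segments *)

Section lifting.
Context {R : realType} {X : metricType R}.
Hypothesis no_circle : forall S : set X, ~ homeomorphic (@unit_circle R) S.
Implicit Types (h : R -> X) (F G : X -> X).

(** The order of the two ends is left free: a segment may be mapped across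
another one in either direction. *)
Definition matches F h p q u v :=
  (F (h p) = h u /\ F (h q) = h v) \/ (F (h p) = h v /\ F (h q) = h u).

Lemma matches_swap F h p q u v : matches F h p q u v -> matches F h q p u v.
Proof. by move=> [[? ?]|[? ?]]; [right|left]. Qed.

Lemma matches_comp F G h p q p' q' u v : matches G h p q p' q' ->
  matches F h p' q' u v -> matches (F \o G) h p q u v.
Proof.
rewrite /matches /=.
by move=> [[-> ->]|[-> ->]] // [[? ?]|[? ?]]; [right|left].
Qed.

(** The point s3 is found between the outer ones, then s2 on the subpath from
s1 to s3. *)
Lemma ordered_lift h a b (g : R -> X) s1 s2 s3 s4 x y :
  arc_on h a b -> continuous g -> a <= s1 -> s1 <= s2 -> s2 <= s3 -> s3 <= s4 ->
  s4 <= b -> g x = h s1 -> g y = h s4 ->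
  exists t2 t3, [/\ g t2 = h s2, g t3 = h s3 &
    (x <= t2 /\ t2 <= t3 /\ t3 <= y) \/ (y <= t3 /\ t3 <= t2 /\ t2 <= x)].
Proof.
move=> harc gc as1 s12 s23 s34 s4b gx gy.
have I1 : a <= s1 <= b by rewrite as1; lra.
have I3 : a <= s3 <= b by apply/andP; split; lra.
have I4 : a <= s4 <= b by rewrite s4b; lra.
have [xy|yx] := leP x y.
  have [|m /andP[xm my] gm] :=
    @path_covers_arc _ _ no_circle h a b g x y s1 s3 s4 harc gc xy I1 I4 _ gx gy.
    by apply/orP; left; apply/andP; split; lra.
  have [|n /andP[xn nm] gn] :=
    @path_covers_arc _ _ no_circle h a b g x m s1 s2 s3 harc gc xm I1 I3 _ gx gm.
    by apply/orP; left; apply/andP; split; lra.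
  by exists n, m; split => //; left.
have [|m /andP[xm my] gm] :=
  @path_covers_arc _ _ no_circle h a b g y x s4 s3 s1 harc gc (ltW yx) I4 I1 _ gy gx.
  by apply/orP; right; apply/andP; split; lra.
have [|n /andP[xn nm] gn] :=
  @path_covers_arc _ _ no_circle h a b g m x s3 s2 s1 harc gc my I3 I1 _ gm gx.
  by apply/orP; right; apply/andP; split; lra.
by exists n, m; split => //; right.
Qed.

(** Disjoint segments of the arc are lifted to disjoint segments, though their
order may be reversed. *)
Lemma ordered_lift_pairs h a b G (J : set R) s1 s2 s3 s4 :
  arc_on h a b -> continuous G ->
  (forall x y z, J x -> J z -> x <= y -> y <= z -> J y) ->
  a <= s1 -> s1 <= s2 -> s2 <= s3 -> s3 <= s4 -> s4 <= b ->
  (exists2 x, J x & G (h x) = h s1) -> (exists2 x, J x & G (h x) = h s4) ->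
  exists u1 u2 u3 u4, [/\ J u1, J u4, u1 <= u2, u2 <= u3 & u3 <= u4] /\
    ((matches G h u1 u2 s1 s2 /\ matches G h u3 u4 s3 s4) \/
     (matches G h u1 u2 s3 s4 /\ matches G h u3 u4 s1 s2)).
Proof.
move=> harc Gc Jconv as1 s12 s23 s34 s4b [x Jx Gx] [y Jy Gy].
have Ghc : continuous (G \o h).
  by move=> t; apply: continuous_comp; [exact: harc.1|exact: Gc].
have [t2 [t3 [G2 G3 [[? [? ?]]|[? [? ?]]]]]] :=
  ordered_lift harc Ghc as1 s12 s23 s34 s4b Gx Gy.
  by exists x, t2, t3, y; split => //; left; split; left.
exists y, t3, t2, x; split=> //; right; split; right; split=> //.
Qed.

Definition two_fold F h a b := exists p0 q0 p1 q1,
  [/\ a <= p0, p0 <= q0, q0 <= p1, p1 <= q1 & q1 <= b] /\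
  (matches F h p0 q0 a b /\ matches F h p1 q1 a b).

(** In the second iterate of a two-fold horseshoe there are four crossing
segments in a row; the first and the last one are disjoint. *)
Lemma two_fold_disjoint F h a b : continuous F -> arc_on h a b -> a < b ->
  two_fold F h a b -> exists p0 q0 p1 q1,
  [/\ a <= p0, p0 < q0, q0 < p1, p1 < q1 & q1 <= b] /\
  (matches (F \o F) h p0 q0 a b /\ matches (F \o F) h p1 q1 a b).
Proof.
move=> Fc harc ab [p0 [q0 [p1 [q1 [[ap0 p0q0 q0p1 p1q1 q1b] [m0 m1]]]]]].
have hab : h a <> h b.
  move=> /harc.2; rewrite !in_itv/= !lexx (ltW ab) => /(_ isT isT) E.
  by move: ab; rewrite E ltxx.
have lift p q : p <= q -> matches F h p q a b -> exists u1 u2 u3 u4,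
    [/\ p <= u1, u1 <= u2, u2 <= u3, u3 <= u4 & u4 <= q] /\
    (matches (F \o F) h u1 u2 a b /\ matches (F \o F) h u3 u4 a b).
  move=> pq mpq.
  have conv x y z : `[p, q]%classic x -> `[p, q]%classic z -> x <= y -> y <= z -> `[p, q]%classic y.
    rewrite /= !in_itv/= => /andP[px _] /andP[_ zq] xy yz.
    by rewrite (le_trans px) //= (le_trans yz).
  have Jp : `[p, q]%classic p by rewrite /= in_itv/= lexx.
  have Jq : `[p, q]%classic q by rewrite /= in_itv/= lexx pq.
  have cover u : a <= u -> u <= b -> exists2 x, `[p, q]%classic x & F (h x) = h u.
    move=> au ub; have Fhc : continuous (F \o h).
      by move=> t; apply: continuous_comp; [exact: harc.1|exact: Fc].
    have Ia : a <= a <= b by rewrite lexx ltW.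
    have Ib : a <= b <= b by rewrite lexx ltW.
    case: mpq => -[Fp Fq].
      have [|m mpq Fm] := path_covers_arc no_circle harc Fhc pq Ia Ib _ Fp Fq (r := u).
        by rewrite au ub.
      by exists m.
    have [|m mpq Fm] := path_covers_arc no_circle harc Fhc pq Ib Ia _ Fp Fq (r := u).
      by rewrite au ub orbT.
    by exists m.
  have [||u1 [u2 [u3 [u4 [[J1 J4 u12 u23 u34] mm]]]]] :=
      ordered_lift_pairs harc Fc conv ap0 p0q0 q0p1 p1q1 q1b.
  - by apply: cover => //; lra.
  - by apply: cover => //; lra.
  exists u1, u2, u3, u4; split.
    by move: J1 J4; rewrite /= !in_itv/= => /andP[? _] /andP[].
  by case: mm => -[M1 M2]; split; apply: matches_comp; eassumption.
have [u1 [u2 [u3 [u4 [[? ? ? ? ?] [M1 M2]]]]]] := lift _ _ p0q0 m0.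
have [v1 [v2 [v3 [v4 [[? ? ? ? ?] [M3 M4]]]]]] := lift _ _ p1q1 m1.
have strict p q : p <= q -> matches (F \o F) h p q a b -> p < q.
  move=> pq M; rewrite lt_neqAle pq andbT; apply/eqP => E.
  by case: M => -[]; rewrite E => -> // => /esym.
have s1 : u1 < u2 by exact: strict M1.
have s2 : u3 < u4 by exact: strict M2.
have s4 : v3 < v4 by exact: strict M4.
by exists u1, u2, v3, v4; split => //; split; lra.
Qed.
End lifting.

(** * Counting words of pieces *)

Section counting.
Context {R : realType} {X : metricType R}.
Hypothesis no_circle : forall S : set X, ~ homeomorphic (@unit_circle R) S.
Variables (h : R -> X) (a b : R) (G : X -> X) (r : nat) (d : nat -> R).
Hypotheses (harc : arc_on h a b) (Gc : continuous G).
Hypotheses (d_lt : forall l, d l < d l.+1) (d0 : d 0 = a) (dr : d r = b).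

Definition piece (l : 'I_r) : set R := `[d l, d l.+1]%classic.

Lemma d_mono l l' : (l <= l')%N -> d l <= d l'.
Proof.
move=> /subnK <-; elim: (l' - l)%N => [|k IH]; first by rewrite add0n.
by rewrite addSn (le_trans IH) // ltW.
Qed.

Lemma pieceP l t : piece l t -> d l <= t <= d l.+1.
Proof. by rewrite /piece /= in_itv. Qed.

Lemma piece_in l t : piece l t -> a <= t <= b.
Proof.
move=> /pieceP/andP[lt tl]; rewrite -d0 -dr (le_trans _ lt) ?d_mono //=.
by rewrite (le_trans tl) // d_mono // ltn_ord.
Qed.

Lemma piece_lt (l l' : 'I_r) t t' : (l < l')%N -> piece l t -> piece l' t' -> t <= t'.
Proof.
move=> ll' /pieceP/andP[_ H] /pieceP/andP[H' _].
by rewrite (le_trans H) // (le_trans _ H') // d_mono.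
Qed.

(** Only the points of the arc that G maps to the arc are followed. *)
Definition step (J : set R) (l : 'I_r) : set R :=
  [set t | piece l t /\ exists2 x, J x & G (h x) = h t].

Definition run (J : set R) (w : seq 'I_r) : set R := foldl step J w.

Definition convex_in (J : set R) :=
  (forall t, J t -> a <= t <= b) /\
  (forall x y z, J x -> J z -> x <= y -> y <= z -> J y).

Lemma piece_convex l : convex_in (piece l).
Proof.
split; first by move=> t /piece_in.
move=> x y z /pieceP/andP[lx _] /pieceP/andP[_ zl] xy yz.
by rewrite /piece /= in_itv/= (le_trans lx) //= (le_trans yz).
Qed.

Lemma image_covers J s u t : convex_in J -> a <= s <= b -> a <= t <= b ->
  s <= u -> u <= t -> (exists2 x, J x & G (h x) = h s) ->
  (exists2 x, J x & G (h x) = h t) -> exists2 x, J x & G (h x) = h u.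
Proof.
move=> [Jin Jc] sab tab su ut [x Jx Gx] [y Jy Gy].
have Ghc : continuous (G \o h).
  by move=> v; apply: continuous_comp; [exact: harc.1|exact: Gc].
have [xy|yx] := leP x y.
  have [|m /andP[xm my] Gm] :=
      path_covers_arc no_circle harc Ghc xy sab tab _ Gx Gy (r := u).
    by rewrite su ut.
  by exists m => //; exact: Jc xm my.
have [|m /andP[xm my] Gm] :=
    path_covers_arc no_circle harc Ghc (ltW yx) tab sab _ Gy Gx (r := u).
  by rewrite su ut orbT.
by exists m => //; exact: Jc xm my.
Qed.

Lemma step_convex J l : convex_in J -> convex_in (step J l).
Proof.
move=> Jc; split; first by move=> t [/piece_in].
move=> x y z [lx Gx] [lz Gz] xy yz; split; first exact: (piece_convex l).2 lx lz xy yz.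
by apply: (image_covers Jc _ _ xy yz) Gx Gz; [exact: piece_in lx|exact: piece_in lz].
Qed.

Lemma run_convex J w : convex_in J -> convex_in (run J w).
Proof. by elim: w J => [//|l w IH] J Jc; apply: IH; exact: step_convex. Qed.

Lemma step_mono J J' l : J `<=` J' -> step J l `<=` step J' l.
Proof. by move=> JJ t [lt [x Jx Gx]]; split=> //; exists x => //; exact: JJ. Qed.

Lemma run_mono J J' w : J `<=` J' -> run J w `<=` run J' w.
Proof. by elim: w J J' => [//|l w IH] J J' JJ; apply: IH; exact: step_mono. Qed.

Lemma run_cat J w w' : run J (w ++ w') = run (run J w) w'.
Proof. by rewrite /run foldl_cat. Qed.

Fixpoint nwords (n : nat) (J : set R) : nat :=
  if n is n'.+1 then (\sum_(l < r) nwords n' (step J l))%N else `[< J !=set0 >].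

Lemma nwords0 n : nwords n set0 = 0%N.
Proof.
elim: n => [|n IH] /=; first by apply/eqP; rewrite eqb0; apply/negP => /asboolP[].
by rewrite big1 // => l _; rewrite (_ : step _ _ = set0) // predeqE => t; split => // -[_ []].
Qed.

Definition partial J : pred 'I_r :=
  [pred l | `[< step J l !=set0 /\ ~ piece l `<=` step J l >]].

(** The image of an interval contains every piece lying between two pieces
that it meets. *)
Lemma card_partial J : convex_in J -> (#|partial J| <= 2)%N.
Proof.
move=> Jc; rewrite leqNgt; apply/card_gt2P => -[x [y [z [[xp yp zp] [xy yz zx]]]]].
have key (l1 l2 l3 : 'I_r) : (l1 < l2)%N -> (l2 < l3)%N -> l1 \in partial J ->
    l2 \in partial J -> l3 \in partial J -> False.
  move=> l12 l23 /asboolP[[t1 [p1 G1]] _].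
  move=> /asboolP[_ n2] /asboolP[[t3 [p3 G3]] _]; apply: n2 => t p2; split => //.
  apply: (image_covers Jc _ _ (piece_lt l12 p1 p2) (piece_lt l23 p2 p3)) G1 G3.
    exact: piece_in p1.
  exact: piece_in p3.
move: xy yz zx; rewrite -!val_eqE /=.
by case: ltngtP => // c1 _; case: ltngtP => // c2 _; case: ltngtP => // c3 _;
  eauto; lia.
Qed.

Definition reach (J : set R) (l : 'I_r) :=
  exists2 w, w != [::] & piece l `<=` run J w.

Definition reached (J : set R) : {set 'I_r} := [set l | `[< reach J l >]]%SET.

Lemma reachedP J l : reflect (reach J l) (l \in reached J).
Proof.
by rewrite /reached finset.in_set; apply: (iffP idP) => /asboolP.
Qed.

Lemma reach_step J l l' : reach (step J l') l -> reach J l.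
Proof. by move=> [w w0 lw]; exists (l' :: w). Qed.

Lemma reached_step J l : reached (step J l) \subset reached J.
Proof. by apply/fintype.subsetP => x /reachedP/reach_step/reachedP. Qed.

Lemma reached_full J l : piece l `<=` step J l -> l \in reached J.
Proof. by move=> lJ; apply/reachedP; exists [:: l]. Qed.

Lemma reached_run J w : reached (run J w) \subset reached J.
Proof.
elim: w J => [|l w IH] J //=.
exact: fintype.subset_trans (IH _) (reached_step _ _).
Qed.

Lemma step_full J l : piece l `<=` step J l -> step J l = piece l.
Proof. by move=> lJ; apply/seteqP; split => // t []. Qed.

Hypothesis one_loop : forall l w w', size w = size w' ->
  piece l `<=` run (piece l) w -> piece l `<=` run (piece l) w' -> w = w'.

(** If a piece can be covered again after w and after w', of equal lengths,
then composing the two loops in both orders shows that w = w'. *)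
Lemma returning_word_unique l w w' : size w = size w' ->
  l \in reached (run (piece l) w) -> l \in reached (run (piece l) w') -> w = w'.
Proof.
move=> sww /reachedP[z _ lz] /reachedP[z' _ lz'].
rewrite -!run_cat in lz lz'.
have E : (w ++ z) ++ (w' ++ z') = (w' ++ z') ++ (w ++ z).
  apply: (one_loop (l := l)); first by rewrite !size_cat addnC.
    by rewrite run_cat; apply: subset_trans lz' _; exact: run_mono.
  by rewrite run_cat; apply: subset_trans lz _; exact: run_mono.
move/eqP: E; rewrite -!catA eqseq_cat //.
by case/andP => /eqP.
Qed.

Lemma sum_leq_pred (A : pred 'I_r) (F : 'I_r -> nat) c e : (#|A| <= e)%N ->
  forall c', (forall l, (F l <= (l \in A) * c + c')%N) ->
  (\sum_(l < r) F l <= e * c + r * c')%N.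
Proof.
move=> Ae c' FP; apply: (@leq_trans (\sum_(l < r) ((l \in A) * c + c'))%N).
  by apply: leq_sum => l _; exact: FP.
rewrite big_split /= sum_nat_const card_ord leq_add2r -big_distrl /=.
by rewrite leq_mul2r -sum1_card big_mkcond /= in Ae *; rewrite Ae orbT.
Qed.

(** At each time at most one word leads to a set from which piece l can still
be covered; whenever a run leaves this word, the set of pieces that it can reach
has lost l, and the bound K for fewer reachable pieces applies. *)
Lemma nwords_loop rho K l : (0 < K)%N -> (forall J, convex_in J ->
    (#|reached J| < rho)%N -> forall n, (nwords n J <= K * 3 ^ n)%N) ->
  l \in reached (piece l) -> (#|reached (piece l)| < rho.+1)%N ->
  forall n w, w = [::] \/ l \in reached (run (piece l) w) ->
  (nwords n (run (piece l) w) <= (r * K + K) * 3 ^ n)%N.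
Proof.
move=> K0 KP lrec lrho; elim=> [|n IH] w wP.
  by rewrite expn0 muln1 /=; apply: leq_trans (leq_b1 _) _; lia.
have wl : l \in reached (run (piece l) w) by case: wP => // ->.
pose A := [pred l' | l \in reached (run (piece l) (rcons w l'))].
have A1 : (#|A| <= 1)%N.
  apply/card_le1_eqP => x y xA yA.
  have xA' : l \in reached (run (piece l) (rcons w x)) by [].
  have yA' : l \in reached (run (piece l) (rcons w y)) by [].
  have : rcons w x = rcons w y by apply: (returning_word_unique _ xA' yA'); rewrite !size_rcons.
  by move/eqP; rewrite eqseq_rcons eqxx /= => /eqP.
apply: (@leq_trans (1 * ((r * K + K) * 3 ^ n) + r * (K * 3 ^ n))%N); last first.
  by rewrite expnS; nia.
apply: (sum_leq_pred A1) => l'.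
have -> : step (run (piece l) w) l' = run (piece l) (rcons w l').
  by rewrite -cats1 run_cat.
have [lA|lA] := boolP (l' \in A).
  by rewrite mul1n; apply: leq_trans (leq_addr _ _); apply: IH; right.
rewrite mul0n add0n; apply: KP; first exact: run_convex (piece_convex _).
apply: leq_trans (_ : #|reached (piece l) :\ l| < _)%N; last first.
  by move: lrho; rewrite (cardsD1 l) lrec.
rewrite ltnS; apply/subset_leq_card/fintype.subsetP => x xr.
apply/finset.setD1P; split.
  by apply/eqP => xl; move/negP: lA; apply; rewrite xl in xr; exact: xr.
by have /fintype.subsetP/(_ _ xr) := reached_run (piece l) (rcons w l').
Qed.

(** Induction on the number of pieces that can be fully covered from J. Of the
pieces met by the image of J, at most two are covered partially; a piece covered
fully either cannot be covered again from itself, so that fewer pieces are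
reachable, or is bounded by the preceding lemma. The growth rate 3 absorbs the
factor 2 due to partial covers. *)
Lemma nwords_bound rho : exists2 K, (0 < K)%N & forall J, convex_in J ->
  (#|reached J| < rho)%N -> forall n, (nwords n J <= K * 3 ^ n)%N.
Proof.
elim: rho => [|rho [K K0 KP]]; first by exists 1%N.
pose K1 := (r * K + K)%N.
exists (r * K1 + K1)%N; first by rewrite /K1; lia.
move=> J Jc Jrho n; elim: n J Jc Jrho => [|n IH] J Jc Jrho.
  by rewrite expn0 muln1 /=; apply: leq_trans (leq_b1 _) _; rewrite /K1; lia.
apply: (@leq_trans (2 * ((r * K1 + K1) * 3 ^ n) + r * (K1 * 3 ^ n))%N); last first.
  by rewrite expnS; nia.
apply: (sum_leq_pred (card_partial Jc)) => l.
have [lp|lp] := boolP (l \in _).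
  rewrite mul1n; apply: leq_trans (leq_addr _ _); apply: IH.
    exact: step_convex.
  by apply: leq_ltn_trans Jrho; apply/subset_leq_card/reached_step.
rewrite mul0n add0n.
have [nJ|] := pselect (step J l !=set0); last first.
  by move=> /set0P/negP/negPn/eqP E; change (nwords n (step J l) <= K1 * 3 ^ n)%N; rewrite E nwords0.
have lfull : piece l `<=` step J l.
  apply: contrapT => nf; move/negP: lp; apply.
  exact/asboolP.
rewrite (step_full lfull).
have lJ := reached_full lfull.
have sub : reached (piece l) \subset reached J.
  by rewrite -(step_full lfull); exact: reached_step.
have [lrec|lnrec] := boolP (l \in reached (piece l)).
  apply: (nwords_loop K0 KP lrec _ _ (w := [::])); last by left.
  by apply: leq_ltn_trans Jrho; exact: subset_leq_card.
apply: (@leq_trans (K * 3 ^ n)%N); last by rewrite /K1; nia.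
apply: KP; first exact: piece_convex.
apply: leq_trans (_ : #|reached J :\ l| < _)%N; last first.
  by move: Jrho; rewrite (cardsD1 l) lJ.
rewrite ltnS; apply/subset_leq_card/fintype.subsetP => x xr.
apply/finset.setD1P; split; first by apply/eqP => xl; move/negP: lnrec; apply; rewrite -{1}xl.
by move/fintype.subsetP/(_ _ xr): sub.
Qed.
End counting.

(** * Segments following a word *)

Section horseshoe_of_coverings.
Context {R : realType} {X : metricType R}.
Hypothesis no_circle : forall S : set X, ~ homeomorphic (@unit_circle R) S.
Variables (h : R -> X) (a b : R) (G : X -> X).
Hypotheses (harc : arc_on h a b) (Gc : continuous G).

Section fixed_pieces.
Variables (r : nat) (d : nat -> R).
Hypotheses (d_lt : forall l, d l < d l.+1) (d0 : d 0 = a) (dr : d r = b).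
Local Notation piece := (@piece R r d).
Local Notation step := (@step R X h G r d).
Local Notation run := (@run R X h G r d).
Local Notation nwords := (@nwords R X h G r d).

Lemma run_matches w J u v : u <= v -> run J w u -> run J w v ->
  exists p q, [/\ J p, J q, p <= q & matches (iter (size w) G) h p q u v].
Proof.
elim: w J => [|l w IH] J uv /= ru rv; first by exists u, v; split => //; left.
have [p [q [[_ [x Jx Gx]] [_ [y Jy Gy]] pq m]]] := IH _ uv ru rv.
have m' : matches (iter (size w).+1 G) h x y u v.
  by rewrite /matches !iterSr Gx Gy.
have [xy|yx] := leP x y; first by exists x, y.
by exists y, x; split => //; [exact: ltW|exact: matches_swap].
Qed.

(** Two different words of the same length are followed along disjoint
segments: they are, at the first place where the words differ, in different
pieces, and the order is lifted back. *)
Lemma two_runs_matches w w' J u v : convex_in a b J -> size w = size w' -> w <> w' ->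
  u <= v -> run J w u -> run J w v -> run J w' u -> run J w' v ->
  exists p q p' q', [/\ J p, J q', p <= q, q <= p' & p' <= q'] /\
    (matches (iter (size w) G) h p q u v /\ matches (iter (size w) G) h p' q' u v).
Proof.
elim: w w' J => [[]//|l w IH] [//|l' w'] J Jc [sw] ww uv /= ru rv ru' rv'.
suff [s1 [s2 [s3 [s4 [[as1 s12 s23 s34] s4b [x1 Jx1 Gx1] [x4 Jx4 Gx4] [m m']]]]]] :
    exists s1 s2 s3 s4, [/\ [/\ a <= s1, s1 <= s2, s2 <= s3 & s3 <= s4], s4 <= b,
      exists2 x, J x & G (h x) = h s1, exists2 x, J x & G (h x) = h s4 &
      matches (iter (size w) G) h s1 s2 u v /\ matches (iter (size w) G) h s3 s4 u v].
  have [||u1 [u2 [u3 [u4 [[J1 J4 u12 u23 u34] mm]]]]] :=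
    ordered_lift_pairs no_circle harc Gc Jc.2 as1 s12 s23 s34 s4b.
  - by exists x1.
  - by exists x4.
  have E : iter (size w).+1 G = iter (size w) G \o G.
    by apply/funext => z; rewrite iterSr.
  exists u1, u2, u3, u4; split; first by split.
  by rewrite E; case: mm => -[M1 M2]; split; apply: matches_comp; eassumption.
have [ll|ll] := eqVneq l l'.
  subst l'; have {}ww : w <> w' by move=> E; apply: ww; rewrite E.
  have Jc' := step_convex no_circle harc Gc d_lt d0 dr l Jc.
  have [p [q [p' [q' [[sp sq' pq qp p'q'] mm]]]]] := IH w' _ Jc' sw ww uv ru rv ru' rv'.
  exists p, q, p', q'; split => //.
  - by split => //; have /andP[] := Jc'.1 _ sp.
  - by have /andP[] := Jc'.1 _ sq'.
  - by case: sp.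
  - by case: sq'.
have [p [q [sp sq pq m]]] := run_matches uv ru rv.
have [p' [q' [sp' sq' pq' m']]] := run_matches uv ru' rv'.
rewrite -sw in m'.
have pin := piece_in d_lt d0 dr.
have plt := piece_lt d_lt.
have [ll'|ll'] : (l < l')%N \/ (l' < l)%N.
  by move: ll; rewrite -val_eqE /=; case: ltngtP => // _ _; [left|right].
- exists p, q, p', q'; split => //.
  + split=> //; first by have /andP[] := pin _ _ sp.1.
    exact: plt ll' sq.1 sp'.1.
  + by have /andP[] := pin _ _ sq'.1.
  + by case: sp.
  + by case: sq'.
- exists p', q', p, q; split => //.
  + split=> //; first by have /andP[] := pin _ _ sp'.1.
    exact: plt ll' sq'.1 sp.1.
  + by have /andP[] := pin _ _ sq.1.
  + by case: sp'.
  + by case: sq.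
Qed.

Section lower_bound.
Variables (I : finType) (C : I -> set R) (lab : 'I_r -> I).
Hypotheses (Cin : forall i t, C i t -> a <= t <= b)
  (Ccov : forall i j t, C j t -> exists2 x, C i x & G (h x) = h t)
  (labP : forall l t i, piece l t -> C i t -> lab l = i).

Fixpoint realised (J : set R) (s : seq I) : Prop :=
  if s is i :: s' then exists2 l, lab l = i & realised (step J l) s'
  else J !=set0.

Lemma piece_cover t : a <= t <= b -> (0 < r)%N -> exists l, piece l t.
Proof.
move=> /andP[at_ tb] r0.
have dlast : t <= d r by rewrite dr.
have [[|n] tn nmin] := ex_minnP (ex_intro (fun n => t <= d n) r dlast).
  have -> : t = d 0 by apply/eqP; rewrite eq_le tn d0 at_.
  exists (Ordinal r0); rewrite /piece /= in_itv/= lexx /=.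
  exact: ltW.
have nr : (n < r)%N by apply: nmin.
exists (Ordinal nr); rewrite /piece /= in_itv/= tn andbT leNgt; apply/negP => H.
by have := nmin n (ltW H); rewrite ltnn.
Qed.

(** The covering relations are followed backwards, from the last letter of the
word to the first one. *)
Lemma all_realised (s : seq I) i : (0 < r)%N ->
  (exists t, C i t) -> exists2 t, C i t & forall J : set R, J t -> realised J s.
Proof.
move=> r0; elim: s i => [|j s IH] i [t Ct]; first by exists t => // J Jt; exists t.
have nej : exists t, C j t by have [x Cx _] := Ccov j Ct; exists x.
have [t' Ct' t'P] := IH j nej.
have [x Cx Gx] := Ccov i Ct'; exists x => // J Jx /=.
have [l lt'] := piece_cover (Cin Ct') r0.
by exists l; [exact: labP lt' Ct'|apply: t'P; split => //; exists x].
Qed.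

(** A word of pieces determines its word of labels. *)
Lemma realised_leq n J :
  (#|[set s : n.-tuple I | `[< realised J s >]]%SET| <= nwords n J)%N.
Proof.
elim: n J => [|n IH] J /=.
  have [Jn|Jn] := asboolP (J !=set0).
    apply: leq_trans (max_card _) _; rewrite card_tuple expn0 //.
  rewrite leqn0 cards_eq0; apply/eqP/setP => s; rewrite finset.in_set finset.in_set0.
  by rewrite tuple0 /=; apply/asboolP.
pose S l := [set s : n.-tuple I | `[< realised (step J l) s >]]%SET.
apply: (@leq_trans #|(\bigcup_l ((fun s => cons_tuple (lab l) s) @: S l))%SET|).
  apply/subset_leq_card/fintype.subsetP => s; rewrite finset.in_set => /asboolP.
  case/tupleP: s => i s /= [l li sP].
  apply/finset.bigcupP; exists l => //; apply/imsetP; exists s.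
    by rewrite finset.in_set; exact/asboolP.
  by rewrite li; apply: val_inj.
apply: (@leq_trans (\sum_l #|S l|)%N); last by apply: leq_sum => l _; exact: IH.
apply: (big_ind2 (fun (A : {set n.+1.-tuple I}) m => #|A| <= m)%N).
- by rewrite cards0.
- move=> A m B m' Am Bm; apply: leq_trans (leq_add Am Bm).
  by rewrite cardsU leq_subr.
- by move=> l _; exact: leq_imset_card.
Qed.
End lower_bound.
End fixed_pieces.
End horseshoe_of_coverings.

(** * Horseshoes from disjoint coverings *)

Lemma finite_uniform (R : realType) (I : finType) (Q : I -> R -> Prop) :
  (forall i e e', Q i e -> 0 < e' <= e -> Q i e') ->
  (forall i, exists2 e, 0 < e & Q i e) -> exists2 e, 0 < e & forall i, Q i e.
Proof.
move=> Qm Qe; suff [e e0 eP] : exists2 e, 0 < e & forall i, i \in enum I -> Q i e.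
  by exists e => // i; apply: eP; rewrite mem_enum.
elim: (enum I) => [|i s [e e0 eP]]; first by exists 1.
have [e' e'0 Qi] := Qe i; exists (Num.min e e'); first by rewrite lt_min e0.
move=> j; rewrite inE => /orP[/eqP ->|js].
  by apply: Qm Qi _; rewrite lt_min e0 e'0 /= ge_min lexx orbT.
by apply: Qm (eP j js) _; rewrite lt_min e0 e'0 /= ge_min lexx.
Qed.

Lemma pow4_gt K : exists n, (K * 3 ^ n < 4 ^ n)%N.
Proof.
have P n : ((n + 3) * 3 ^ n <= 4 ^ n * 3)%N.
  by elim: n => [//|n IH]; rewrite !expnS; nia.
by exists (3 * K)%N; have := P (3 * K)%N; have := expn_gt0 3 (3 * K); nia.
Qed.

Section horseshoe_exists.
Context {R : realType} {X : metricType R}.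
Hypothesis no_circle : forall S : set X, ~ homeomorphic (@unit_circle R) S.

(** Cut the arc into pieces so short that each of them meets at most one of the
four sets. All words in the four labels are realised, so that the number of
words of pieces grows at least like 4^n; then some piece returns over itself
along two different words of the same length. *)
Lemma two_fold_of_coverings (h : R -> X) a b G (I : finType) (C : I -> set R) :
  arc_on h a b -> continuous G -> a < b -> #|I| = 4%N ->
  (forall i, closed (C i)) -> (forall i, C i !=set0) ->
  (forall i t, C i t -> a <= t <= b) ->
  (forall i j t, C i t -> C j t -> i = j) ->
  (forall i j t, C j t -> exists2 x, C i x & G (h x) = h t) ->
  exists N u v, [/\ (0 < N)%N, a <= u, u < v, v <= b & two_fold (iter N G) h u v].
Proof.
move=> harc Gc ab cI Cc C0 Cin Cdis Ccov.
have /card_gt0P[i0 _] : (0 < #|I|)%N by rewrite cI.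
have [e e0 eP] : exists2 e : R, 0 < e & forall ij : I * I, ij.1 != ij.2 ->
    forall x y, C ij.1 x -> C ij.2 y -> e <= mdist (h x) (h y).
  apply: finite_uniform.
    move=> ij e e' eP /andP[_ e'e] ne x y Cx Cy; exact: le_trans e'e (eP ne x y Cx Cy).
  move=> [i j] /=; have [->|ne] := eqVneq i j; first by exists 1 => //; rewrite eqxx.
  have Ck k : compact (h @` C k).
    apply: continuous_compact; first by apply: continuous_subspaceT; exact: harc.1.
    apply: (subclosed_compact (Cc k) (@segment_compact _ a b)) => t /Cin.
    by rewrite /= in_itv.
  have [||e e0 eP] := compact_closed_dist (Ck i) (B := h @` C j).
  - by apply: compact_closed => //; exact: metric_hausdorff.
  - move=> _ [x Cx <-] [y Cy] /harc.2; rewrite !in_itv/= => /(_ (Cin _ _ Cy) (Cin _ _ Cx)) E.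
    by move/eqP: ne; apply; apply: Cdis Cx _; rewrite -E.
  by exists e => // _ x y Cx Cy; apply: eP; [exists x|exists y].
have [eta eta0 etaP] := uniform_continuity_segment a b harc.1 e0.
pose r := (Num.truncn ((b - a) / eta)).+1.
have r0 : 0 < r%:R :> R by rewrite ltr0n.
pose d l := a + l%:R * ((b - a) / r%:R).
have dab : 0 < (b - a) / r%:R by rewrite divr_gt0 // subr_gt0.
have dS l : d l.+1 = d l + (b - a) / r%:R by rewrite /d -natr1 mulrDl mul1r addrA.
have d_lt l : d l < d l.+1 by rewrite dS ltrDl.
have d0 : d 0 = a by rewrite /d mul0r addr0.
have dr : d r = b by rewrite /d mulrC divfK ?gt_eqF // subrKC.
have deta : (b - a) / r%:R < eta.
  by rewrite ltr_pdivrMr // mulrC -ltr_pdivrMr // /r; exact: Num.Theory.truncnS_gt.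
have dmono := d_mono d_lt.
have same (l : 'I_r) t t' i j : piece d l t -> piece d l t' -> C i t -> C j t' -> i = j.
  move=> /pieceP/andP[lt tl] /pieceP/andP[lt' tl'] Ct Ct'; rewrite dS in tl tl'.
  apply/eqP/negPn/negP => ne; have := eP (i, j) ne _ _ Ct Ct'.
  rewrite leNgt => /negP; apply; apply: etaP; first exact: Cin Ct.
  by rewrite ltr_norml; apply/andP; split; lra.
have labE (l : 'I_r) : exists i, forall t j, piece d l t -> C j t -> i = j.
  have [[i [t lt Ct]]|n] := pselect (exists i, exists2 t, piece d l t & C i t).
    by exists i => t' j lt' Ct'; exact: same lt lt' Ct Ct'.
  by exists i0 => t j lt Ct; case: n; exists j, t.
have [lab labP] := choice labE.
pose J0 : set R := `[a, b]%classic.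
have J0c : convex_in a b J0.
  split; first by move=> t; rewrite /J0 /= in_itv.
  move=> x y z; rewrite /J0 /= !in_itv/= => /andP[ax _] /andP[_ zb] xy yz.
  by rewrite (le_trans ax) // (le_trans yz).
have lower n : (4 ^ n <= @nwords R X h G r d n J0)%N.
  apply: leq_trans (realised_leq h G d lab n J0).
  rewrite -cI -card_tuple -cardsT; apply/subset_leq_card/fintype.subsetP => s _.
  rewrite finset.in_set; apply/asboolP.
  have [t Ct tP] := all_realised d_lt d0 dr Cin Ccov labP s (ltn0Sn _) (C0 i0).
  by apply: tP; rewrite /J0 /= in_itv/=; exact: Cin Ct.
have [one|] := pselect (forall (l : 'I_r) (w w' : seq 'I_r), size w = size w' ->
    @piece R r d l `<=` @run R X h G r d (piece d l) w ->
    @piece R r d l `<=` @run R X h G r d (piece d l) w' -> w = w').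
  have [K K0 KP] := nwords_bound no_circle harc Gc d_lt d0 dr one r.+1.
  have [n] := pow4_gt K; rewrite ltnNge => /negP; case.
  apply: leq_trans (lower n) _; apply: KP => //; rewrite ltnS.
  by apply: leq_trans (max_card _) _; rewrite card_ord.
move=> /existsNP[l /existsNP[w /existsNP[w' /not_implyP[sw /not_implyP[lw /not_implyP[lw' ww]]]]]].
have lu : piece d l (d l) by rewrite /piece /= in_itv/= lexx ltW.
have lv : piece d l (d l.+1) by rewrite /piece /= in_itv/= lexx ltW.
have [p [q [p' [q' [[lp lq' pq qp' pq'] [m m']]]]]] :=
  two_runs_matches no_circle harc Gc d_lt d0 dr (piece_convex d_lt d0 dr l) sw ww
   (ltW (d_lt l)) (lw _ lu) (lw _ lv) (lw' _ lu) (lw' _ lv).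
have /andP[al _] := piece_in d_lt d0 dr lu; have /andP[_ lb] := piece_in d_lt d0 dr lv.
exists (size w), (d l), (d l.+1); split => //.
  by rewrite lt0n; apply/eqP => w0; apply: ww; rewrite (size0nil w0) (size0nil (esym (etrans (esym w0) sw))).
exists p, q, p', q'; split=> //; split => //.
  by have /andP[] := pieceP lp.
by have /andP[] := pieceP lq'.
Qed.
End horseshoe_exists.

(** * Horseshoes from arc horseshoes *)

Section arc_horseshoes.
Context {R : realType} {X : metricType R}.
Hypothesis no_circle : forall S : set X, ~ homeomorphic (@unit_circle R) S.

Lemma arc_on_of_is_arc (A : set X) x y : is_arc A x y ->
  exists h : R -> X, [/\ arc_on h 0 1, h @` `[0, 1] = A, h 0 = x & h 1 = y].
Proof.
move=> [h [k [[[hA kA hk kh] [hc kc]] h0 h1]]].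
have E t : `[0, 1]%classic t -> (h \o clamp 0 1) t = h t.
  by rewrite /= in_itv/= => t01; rewrite clamp_id.
have I0 : `[0, 1]%classic (0 : R) by rewrite /= in_itv/= lexx ler01.
have I1 : `[0, 1]%classic (1 : R) by rewrite /= in_itv/= lexx ler01.
exists (h \o clamp 0 1); split.
- split; first exact: clamp_continuous.
  move=> u v uI vI; rewrite !E // => huv.
  by rewrite -(hk u) ?huv ?hk //; apply/mem_set.
- apply/seteqP; split=> [_ [t tI <-]|z Az].
    by rewrite E //; exact: hA.
  exists (k z); first exact: kA.
  by rewrite E; [apply: kh; exact/mem_set|exact: kA].
- by rewrite E.
- by rewrite E.
Qed.

Lemma arc_on_rev (h : R -> X) : arc_on h 0 1 ->
  arc_on (h \o (fun t => 1 - t)) 0 1 /\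
  (h \o (fun t => 1 - t)) @` `[0, 1] = h @` `[0, 1].
Proof.
move=> [hc hi]; have I (t : R) : (t \in `[0, 1]) = (1 - t \in `[0, 1]).
  by rewrite !in_itv/= subr_ge0 gerBl andbC.
have rc : continuous (fun t : R => 1 - t).
  by move=> t; apply: cvgB; [exact: cvg_cst|exact: cvg_id].
split; first split.
- by move=> t; exact: (continuous_comp (rc t) (hc _)).
- move=> u v; rewrite (I u) (I v) => uI vI /= /hi E.
  by have := E uI vI; lra.
apply/seteqP; split=> _ [t /= tI <-]; exists (1 - t); rewrite /= ?subKr //.
  by rewrite -I.
by rewrite -I.
Qed.

Lemma arc_from_end (A : set X) x y z : is_arc A x y -> z = x \/ z = y ->
  exists h : R -> X, [/\ arc_on h 0 1, h @` `[0, 1] = A, h 0 = z &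
    forall t, 0 < t -> t < 1 -> h t <> x /\ h t <> y].
Proof.
move=> /arc_on_of_is_arc[h [harc hA h0 h1]] zxy.
have int t : 0 < t -> t < 1 -> h t <> x /\ h t <> y.
  move=> t0 t1; split.
    rewrite -h0 => /harc.2; rewrite !in_itv/= lexx ler01 (ltW t0) (ltW t1).
    by move=> /(_ isT isT) E; move: t0; rewrite E ltxx.
  rewrite -h1 => /harc.2; rewrite !in_itv/= lexx ler01 (ltW t0) (ltW t1).
  by move=> /(_ isT isT) E; move: t1; rewrite E ltxx.
case: zxy => ->; first by exists h.
have [rarc rA] := arc_on_rev harc.
exists (h \o (fun t => 1 - t)); split => //; rewrite ?rA //=.
  by rewrite subr0.
by move=> t t0 t1; apply: int; lra.
Qed.

Lemma concat_continuous (f g : R -> X) t : continuous f -> continuous g ->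
  f t = g t -> continuous (fun x => if x <= t then f x else g x).
Proof.
move=> /metric_continuousP fc /metric_continuousP gc fg.
apply/metric_continuousP => x e e0.
have [df df0 dfP] := fc x e e0; have [dg dg0 dgP] := gc x e e0.
have [xt|tx|->] := ltrgtP x t.
- exists (Num.min df (t - x)); first by rewrite lt_min df0 subr_gt0.
  move=> s; rewrite lt_min => /andP[s1 s2].
  have -> : s <= t by move: s2; rewrite ltr_norml; lra.
  exact: dfP.
- exists (Num.min dg (x - t)); first by rewrite lt_min dg0 subr_gt0.
  move=> s; rewrite lt_min => /andP[s1 s2].
  have -> : (s <= t) = false.
    by apply/negbTE; rewrite -ltNge; move: s2; rewrite ltr_norml; lra.
  exact: dgP.
have [df' df0' dfP'] := fc t e e0; have [dg' dg0' dgP'] := gc t e e0.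
exists (Num.min df' dg'); first by rewrite lt_min df0' dg0'.
move=> s; rewrite lt_min => /andP[s1 s2].
by case: ifP => _; [exact: dfP'|rewrite fg; exact: dgP'].
Qed.

Section touching.
Variables (k l : R -> X).
Hypotheses (karc : arc_on k 0 1) (larc : arc_on l 0 1) (kl0 : k 0 = l 0).
Hypothesis kl : forall u v, 0 < u < 1 -> 0 <= v <= 1 -> k u <> l v.

(** Continued along the second arc back to the common end, the path joins both
ends of the first arc, hence covers it; off its ends the first arc is only met
by the path itself. *)
Lemma path_through_joint (g : R -> X) p q : continuous g -> p <= q ->
  g p = k 1 -> g q = l 1 -> exists2 m, p <= m <= q & g m = k 0.
Proof.
move=> gc pq gp gq.
have rc : continuous (fun x : R => 1 + q - x).
  by move=> t; apply: cvgB; [exact: cvg_cst|exact: cvg_id].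
pose G x := if x <= q then g x else l (1 + q - x).
have Gc : continuous G.
  apply: concat_continuous => //; last by rewrite gq addrK.
  by move=> x; exact: (continuous_comp (rc x) (larc.1 _)).
have pq1 : p <= q + 1 by lra.
have Gp : G p = k 1 by rewrite /G pq.
have Gq : G (q + 1) = k 0.
  rewrite /G; have -> : (q + 1 <= q) = false by lra.
  by rewrite kl0; congr l; lra.
have I0 : 0 <= (0 : R) <= 1 by rewrite lexx ler01.
have I1 : 0 <= (1 : R) <= 1 by rewrite lexx ler01.
have on u : 0 < u -> u < 1 -> (g @` `[p, q]) (k u).
  move=> u0 u1.
  have [|m /andP[pm mq] Gm] :=
      path_covers_arc no_circle karc Gc pq1 I1 I0 _ Gp Gq (r := u).
    by rewrite (ltW u0) (ltW u1) orbT.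
  move: Gm; rewrite /G; case: ifP => mq'.
    by move=> <-; exists m => //=; rewrite in_itv/= pm.
  move=> E; exfalso; apply: (kl _ _ (esym E)); first by rewrite u0.
  by apply/andP; split; move/negbT: mq'; rewrite -ltNge; lra.
have : (g @` `[p, q]) (k 0).
  apply: contrapT => n0.
  have [e e0 eP] := closed_dist_gt0 (path_image_closed (a := p) (b := q) gc) n0.
  have /metric_continuousP/(_ 0 e e0)[d d0 dP] := karc.1.
  pose u := Num.min (d / 2) (1 / 2).
  have u0 : 0 < u by rewrite lt_min !divr_gt0.
  have [ud u1] : u <= d / 2 /\ u <= 1 / 2 by rewrite /u !ge_min !lexx orbT.
  have := eP _ (on u u0 ltac:(lra)); rewrite leNgt => /negP; apply; apply: dP.
  by rewrite subr0 gtr0_norm //; lra.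
by move=> [m /=]; rewrite in_itv/= => mpq gm; exists m.
Qed.

Lemma path_through_joint_sym (g : R -> X) x y : continuous g ->
  g x = k 1 -> g y = l 1 ->
  exists2 m, (x <= m <= y) || (y <= m <= x) & g m = k 0.
Proof.
move=> gc gx gy; have [xy|yx] := leP x y.
  by have [m mxy gm] := path_through_joint gc xy gx gy; exists m; rewrite ?mxy.
have [||||m mxy gm] := @path_through_joint (g \o -%R) (- x) (- y).
- by move=> t; apply: continuous_comp; [exact: opp_continuous|exact: gc].
- by rewrite lerN2 ltW.
- by rewrite /= opprK.
- by rewrite /= opprK.
by exists (- m) => //; apply/orP; right; move: mxy => /andP[? ?]; apply/andP; split; lra.
Qed.

Lemma lift_two_points (w g : R -> X) x y u v : arc_on w 0 1 -> continuous g ->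
  g x = w 0 -> g y = w 1 -> 0 <= u <= 1 -> 0 <= v <= 1 ->
  exists t t', [/\ Num.min x y <= t, t <= t', t' <= Num.max x y &
    (g t = w u /\ g t' = w v) \/ (g t = w v /\ g t' = w u)].
Proof.
wlog uv : u v / u <= v => [hw|].
  move=> warc gc gx gy u01 v01; have [uv|vu] := leP u v; first exact: hw.
  have [t [t' [? ? ? m]]] := hw _ _ (ltW vu) warc gc gx gy v01 u01.
  by exists t, t'; split => //; case: m => ?; [right|left].
move=> warc gc gx gy /andP[u0 u1] /andP[v0 v1].
have [t2 [t3 [g2 g3 [[xt [tt ty]]|[yt [tt tx]]]]]] :=
  ordered_lift no_circle warc gc (lexx 0) u0 uv v1 (lexx 1) gx gy.
  by exists t2, t3; rewrite ge_min le_max xt ty orbT; split => //; left.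
by exists t3, t2; rewrite ge_min le_max yt tx orbT; split => //; right.
Qed.

(** The image of either arc visits both free ends, hence passes the joint in
between: it runs across both arcs, one after the other. *)
Lemma two_fold_touching (g : X -> X) : continuous g ->
  (forall z, (k @` `[0, 1]) z \/ (l @` `[0, 1]) z ->
     (exists2 t, 0 <= t <= 1 & g (k t) = z) /\
     (exists2 t, 0 <= t <= 1 & g (l t) = z)) ->
  two_fold (iter 2 g) k 0 1.
Proof.
move=> gc gcov.
have I1 : `[0, 1]%classic (1 : R) by rewrite /= in_itv/= lexx ler01.
have k1 : (k @` `[0, 1]) (k 1) by exists 1.
have l1 : (l @` `[0, 1]) (l 1) by exists 1.
have [[x1 x1I gx1] [y1 y1I gy1]] := gcov _ (or_introl k1).
have [[x3 x3I gx3] [y3 y3I gy3]] := gcov _ (or_intror l1).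
have gkc : continuous (g \o k).
  by move=> t; apply: continuous_comp; [exact: karc.1|exact: gc].
have glc : continuous (g \o l).
  by move=> t; apply: continuous_comp; [exact: larc.1|exact: gc].
have [x2 x2I gx2] := path_through_joint_sym gkc gx1 gx3.
have [y2 y2I gy2] := path_through_joint_sym glc gy1 gy3.
have x2J : 0 <= x2 <= 1 by move: x1I x2I x3I; lra.
have y2J : 0 <= y2 <= 1 by move: y1I y2I y3I; lra.
have [t [t' [xt tt tx mt]]] := lift_two_points karc gkc gx2 gx1 x1I x2J.
have gx2' : (g \o k) x2 = l 0 by rewrite gx2.
have [s [s' [xs ss sx ms]]] := lift_two_points larc gkc gx2' gx3 y1I y2J.
have Mt : matches (iter 2 g) k t t' 0 1.
  rewrite /matches /=; move: mt gx1 gx2 => /=.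
  by move=> [[-> ->]|[-> ->]] -> ->; [right|left].
have Ms : matches (iter 2 g) k s s' 0 1.
  rewrite /matches /=; move: ms gy1 gy2 => /=.
  by move=> [[-> ->]|[-> ->]] -> ->; [right|left].
move: xt tx xs sx; rewrite !ge_min !le_max.
have [x12|x21] := orP x2I.
  by exists t, t', s, s'; split => //; split => //; lra.
by exists s, s', t, t'; split => //; split => //; lra.
Qed.
End touching.

(** The points of the first arc are sorted according to the arcs that contain
their first two images. Since each arc is mapped over both arcs, the third
iterate maps each of the four classes over the first arc. *)
Lemma two_fold_separate (A B : set X) (h : R -> X) (g : X -> X) :
  continuous g -> arc_on h 0 1 -> h @` `[0, 1] = A -> closed B -> B !=set0 ->
  A `&` B = set0 -> A `|` B `<=` (g @` A) `&` (g @` B) ->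
  exists N u v, [/\ (0 < N)%N, 0 <= u, u < v, v <= 1 &
    two_fold (iter N (iter 3 g)) h u v].
Proof.
move=> gc harc hA Bc [z0 Bz0] AB gAB.
have Ac : closed A by rewrite -hA; apply: path_image_closed; exact: harc.1.
pose S (x : bool) := if x then A else B.
have Sc x : closed (S x) by case: x.
have Scov x y z : S y z -> exists2 w, S x w & g w = z.
  move=> Syz; have [|[w Aw gw] [w' Bw gw']] := gAB z.
    by case: y Syz; [left|right].
  by case: x; [exists w|exists w'].
have Sdis x y z : S x z -> S y z -> x = y.
  have n : ~ (A z /\ B z) by move=> ABz; have : (A `&` B) z by []; rewrite AB.
  by case: x; case: y => //= ? ?; case: n.
pose C (i : bool * bool) : set R := `[0, 1]%classic `&`
  (((g \o h) @^-1` S i.1) `&` ((g \o (g \o h)) @^-1` S i.2)).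
have ghc : continuous (g \o h).
  by move=> t; apply: continuous_comp; [exact: harc.1|exact: gc].
have gghc : continuous (g \o (g \o h)).
  by move=> t; apply: continuous_comp; [exact: ghc|exact: gc].
have Ccov i z : A z -> exists2 t, C i t & iter 3 g (h t) = z.
  move=> Az; have [w2 S2 g2] := Scov i.2 true z Az.
  have [w1 S1 g1] := Scov i.1 i.2 w2 S2.
  have [w0] := Scov true i.1 w1 S1; rewrite /= -hA => -[t tI <-] g0.
  exists t; last by rewrite /= g0 g1.
  by split => //; split; rewrite /= g0 ?g1.
have Ah t : 0 <= t <= 1 -> A (h t) by move=> tI; rewrite -hA; exists t => //=; rewrite in_itv.
apply: (two_fold_of_coverings no_circle (C := C)) => //.
- by elim: 3%N => [|n IH] x; [exact: cvg_id|apply: (continuous_comp (IH x)); exact: gc].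
- by rewrite card_prod card_bool.
- move=> i; apply: closedI; last apply: closedI.
  + exact: itv_closed.
  + exact: (closed_path_preimage ghc (Sc _)).
  + exact: (closed_path_preimage gghc (Sc _)).
- move=> i; have [t Ct _] := Ccov i (h 0) (Ah 0 ltac:(by rewrite lexx ler01)).
  by exists t.
- by move=> i t [] /=; rewrite in_itv.
- move=> [i1 i2] [j1 j2] t [_ [/= Ci1 Ci2]] [_ [/= Cj1 Cj2]].
  by rewrite (Sdis _ _ _ Ci1 Cj1) (Sdis _ _ _ Ci2 Cj2).
- by move=> i j t [/= tI _]; apply: Ccov; apply: Ah; rewrite in_itv in tI.
Qed.

Lemma iter_continuous (g : X -> X) n : continuous g -> continuous (iter n g).
Proof.
by move=> gc; elim: n => [|n IH] x; [exact: cvg_id|apply: (continuous_comp (IH x)); exact: gc].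
Qed.

Lemma iter_iter (T : Type) (g : T -> T) m n : iter m (iter n g) = iter (m * n) g.
Proof.
by elim: m => [//|m IH]; apply/funext => x; rewrite iterS IH mulSn iterD.
Qed.

(** Arcs with a common end follow each other along the image of either of them.
If the two arcs are disjoint, one of them may branch off in the middle of the
other, and the image of an arc need not run across them one after the other;
this is where the counting of words is needed. *)
Lemma disjoint_horseshoe (g : X -> X) : continuous g -> has_arc_horseshoe g ->
  exists N h a b p0 q0 p1 q1, [/\ (0 < N)%N, arc_on h a b,
    [/\ a <= p0, p0 < q0, q0 < p1, p1 < q1 & q1 <= b],
    matches (iter N g) h p0 q0 a b & matches (iter N g) h p1 q1 a b].
Proof.
move=> gc [A [B [x [x' [y [y' [arcA arcB AB gAB]]]]]]].
suff [N [h [a [b [N0 harc ab tf]]]]] : exists N h a b, [/\ (0 < N)%N, arc_on h a b,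
    a < b & two_fold (iter N g) h a b].
  have Nc := @iter_continuous g N gc.
  have [p0 [q0 [p1 [q1 [ord [m0 m1]]]]]] := two_fold_disjoint no_circle Nc harc ab tf.
  have E : iter N g \o iter N g = iter (N + N) g by apply/funext => z; rewrite iterD.
  by exists (N + N)%N, h, a, b, p0, q0, p1, q1; rewrite addn_gt0 N0 -E; split.
have [[p [Ap Bp]]|ABn] := pselect ((A `&` B) !=set0).
  have [pA pB] := AB _ (conj Ap Bp).
  have [k [karc kA k0 kint]] := arc_from_end arcA pA.
  have [l [larc lB l0 _]] := arc_from_end arcB pB.
  exists 2%N, k, 0, 1; split => //.
  apply: (@two_fold_touching k l karc larc) => //.
  - by rewrite k0 l0.
  - move=> u v /andP[u0 u1] v01 E; have [n1 n2] := kint u u0 u1.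
    have [|[]//] := AB (k u); split; first by rewrite -kA; exists u => //=; rewrite in_itv/= !ltW.
    by rewrite E -lB; exists v => //=; rewrite in_itv.
  move=> z; rewrite kA lB => ABz; have [[w + gw] [w' + gw']] := gAB z ABz.
  rewrite -{1}kA -{1}lB => -[t /= tI kt] [t' /= tI' lt].
  rewrite in_itv/= in tI; rewrite in_itv/= in tI'.
  by split; [exists t|exists t'] => //; rewrite ?kt ?lt.
have [h [harc hA _ _]] := arc_on_of_is_arc arcA.
have [l [larc lB _ _]] := arc_on_of_is_arc arcB.
have Bc : closed B by rewrite -lB; apply: path_image_closed; exact: larc.1.
have B0 : B !=set0 by exists (l 0); rewrite -lB; exists 0 => //=; rewrite in_itv/= lexx ler01.
have AB0 : A `&` B = set0 by apply/eqP; move/set0P/negP/negPn: ABn.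
have [N [u [v [N0 u0 uv v1 tf]]]] := two_fold_separate gc harc hA Bc B0 AB0 gAB.
exists (N * 3)%N, h, u, v; rewrite -iter_iter muln_gt0 N0; split => //.
exact: arc_onW harc.
Qed.
End arc_horseshoes.

(** * Symbolic coding *)

Definition window (u : nat -> bool) (n k : nat) : seq bool :=
  [seq u (n + i)%N | i <- iota 0 k].

Lemma size_window u n k : size (window u n k) = k.
Proof. by rewrite size_map size_iota. Qed.

Lemma windowD u n k l : window u n (k + l) = window u n k ++ window u (n + k) l.
Proof.
rewrite /window iotaD map_cat add0n -[X in iota X l]addn0 iotaDl -map_comp.
by congr (_ ++ _); apply: eq_map => i /=; rewrite addnA.
Qed.

Lemma eq_window u v m n k : (forall i, (i < k)%N -> u (m + i)%N = v (n + i)%N) ->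
  window u m k = window v n k.
Proof.
move=> uv; apply/eq_in_map => i; rewrite mem_iota add0n => /andP[_]; exact: uv.
Qed.

Lemma window_eqP u v m n k : window u m k = window v n k ->
  forall i, (i < k)%N -> u (m + i)%N = v (n + i)%N.
Proof.
move=> uv i ik; have := congr1 (nth false ^~ i) uv.
by rewrite !(nth_map 0%N) ?size_iota // !nth_iota.
Qed.

Section codings.
Context {R : realType} {X : metricType R}.

Definition coded (F : X -> X) (cyl : seq bool -> set X) (y : X) (u : nat -> bool) :=
  forall n k, cyl (window u n k) (iter n F y).

Definition shrinking (cyl : seq bool -> set X) (u : nat -> bool) :=
  forall e : R, 0 < e -> exists k, forall y z,
    cyl (window u 0 k) y -> cyl (window u 0 k) z -> mdist y z < e.

(** What the symbolic dynamics needs to know about a horseshoe. Points with the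
same code may differ; this is compensated by the last two clauses, according to
which large cylinders are rare. *)
Record coding (F : X -> X) (cyl : seq bool -> set X) : Prop := Coding {
  cyl_closed : forall w, closed (cyl w);
  coded_point : forall u, exists y, coded F cyl y u;
  coded_separated : exists2 e : R, 0 < e & forall y z u v n,
    coded F cyl y u -> coded F cyl z v -> u n <> v n ->
    e <= mdist (iter n F y) (iter n F z);
  few_large_cylinders : forall e : R, 0 < e -> exists K,
    forall k (A : {set k.-tuple bool}),
    (forall w, w \in A -> exists y z, [/\ cyl w y, cyl w z & e <= mdist y z]) ->
    (#|A| <= K)%N;
  countable_not_shrinking : countable [set u | ~ shrinking cyl u]
}.

End codings.

Section inverse_branches.
Context {R : realType} {X : metricType R}.
Hypothesis no_circle : forall S : set X, ~ homeomorphic (@unit_circle R) S.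
Variables (h : R -> X) (a b : R) (F : X -> X) (p q : bool -> R).
Hypotheses (harc : arc_on h a b) (Fc : continuous F).
Hypotheses (ap : a <= p false) (pq : forall i, p i < q i)
  (q0p1 : q false < p true) (qb : q true <= b).
Hypothesis Fm : forall i, matches F h (p i) (q i) a b.

Let ab : a < b.
Proof. by rewrite (le_lt_trans ap) // (lt_trans (pq _)) // (lt_trans q0p1) // (lt_le_trans (pq _)). Qed.

Let pq_in i t : p i <= t <= q i -> a <= t <= b.
Proof.
have H0 := pq false; have H1 := pq true; case: i => /andP[pt tq].
  by rewrite (le_trans _ pt) ?(le_trans tq) // (le_trans ap) // ltW // (lt_trans H0).
by rewrite (le_trans ap) ?(le_trans tq) // ltW // (lt_trans q0p1) // (lt_le_trans H1).
Qed.

Let Fhc : continuous (F \o h).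
Proof. by move=> t; apply: continuous_comp; [exact: harc.1|exact: Fc]. Qed.

Definition monotone_on (f : R -> R) :=
  (forall u v, a <= u -> u < v -> v <= b -> f u < f v) \/
  (forall u v, a <= u -> u < v -> v <= b -> f v < f u).

(** Taking the last time at which the path over a segment visits a given point
of the arc defines a monotone inverse branch, not continuous in general. *)
Lemma inverse_branch i : exists L : R -> R,
  (forall u, a <= u <= b -> p i <= L u <= q i /\ F (h (L u)) = h u) /\ monotone_on L.
Proof.
have hi := harc.2.
have last u : exists t, a <= u <= b -> [/\ p i <= t <= q i, F (h t) = h u &
    forall t', p i <= t' <= q i -> F (h t') = h u -> t' <= t].
  have [uab|] := pselect (a <= u <= b); last by exists 0.
  have Ia : a <= a <= b by rewrite lexx ltW.
  have Ib : a <= b <= b by rewrite lexx ltW.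
  have [s spq Fs] : exists2 s, p i <= s <= q i & F (h s) = h u.
    case: (Fm i) => -[Fp Fq].
      have [|s spq Fs] := path_covers_arc no_circle harc Fhc (ltW (pq i)) Ia Ib _ Fp Fq (r := u).
        by rewrite uab.
      by exists s.
    have [|s spq Fs] := path_covers_arc no_circle harc Fhc (ltW (pq i)) Ib Ia _ Fp Fq (r := u).
      by rewrite uab orbT.
    by exists s.
  have hu1 : closed [set h u] by apply: accessible_closed_set1; apply: hausdorff_accessible; exact: metric_hausdorff.
  have [|t Ft [tpq tmax]] := closed_max_in (a := p i) (b := q i) (closed_path_preimage Fhc hu1).
    by exists s.
  by exists t => _; split => // t' t'pq Ft'; exact: tmax.
have [L LP] := choice last.
have LPE u : a <= u <= b -> p i <= L u <= q i /\ F (h (L u)) = h u by move=> /LP[].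
exists L; split => //.
have ne u v : a <= u -> u < v -> v <= b -> L u != L v.
  move=> au uv vb; apply/eqP => E; have uI : a <= u <= b by lra.
  have vI : a <= v <= b by lra.
  have := hi u v; rewrite !in_itv/= uI vI => /(_ isT isT).
  rewrite -(LPE u uI).2 -(LPE v vI).2 E => /(_ erefl) uv'.
  by move: uv; rewrite uv' ltxx.
case: (Fm i) => -[Fp Fq]; [left|right] => u v au uv vb; rewrite lt_neqAle.
  have uI : a <= u <= b by lra.
  have vI : a <= v <= b by lra.
  have [/andP[pu uq] Fu _] := LP u uI; have [_ _ vmax] := LP v vI.
  have Ib : a <= b <= b by rewrite lexx ltW.
  have [|s /andP[us sq] Fs] := path_covers_arc no_circle harc Fhc uq uI Ib _ Fu Fq (r := v).
    by rewrite vb (ltW uv).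
  by rewrite ne //= (le_trans us) //; apply: vmax => //; rewrite sq (le_trans pu).
have uI : a <= u <= b by lra.
have vI : a <= v <= b by lra.
have [/andP[pv vq] Fv _] := LP v vI; have [_ _ umax] := LP u uI.
have Ia : a <= a <= b by rewrite lexx ltW.
have [|s /andP[us sq] Fs] := path_covers_arc no_circle harc Fhc vq vI Ia _ Fv Fq (r := u).
  by rewrite au (ltW uv) orbT.
by rewrite eq_sym ne //= (le_trans us) //; apply: umax => //; rewrite sq (le_trans pv).
Qed.

Definition branch (i : bool) : R -> R := sval (cid (inverse_branch i)).

Lemma branch_in i u : a <= u <= b -> p i <= branch i u <= q i.
Proof. by move=> uI; have [H _] := svalP (cid (inverse_branch i)); have [] := H u uI. Qed.

Lemma branchK i u : a <= u <= b -> F (h (branch i u)) = h u.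
Proof. by move=> uI; have [H _] := svalP (cid (inverse_branch i)); have [] := H u uI. Qed.

Lemma branch_monotone i : monotone_on (branch i).
Proof. by have [] := svalP (cid (inverse_branch i)). Qed.

Definition branches (w : seq bool) (u : R) : R := foldr branch u w.

Lemma branches_in w u : a <= u <= b -> a <= branches w u <= b.
Proof. by elim: w => //= i w IH uI; apply: (pq_in (i := i)); apply: branch_in; exact: IH. Qed.

Lemma branchesK w w' u : a <= u <= b ->
  iter (size w) F (h (branches (w ++ w') u)) = h (branches w' u).
Proof.
elim: w => [//|i w IH] uI; rewrite /= -iterS iterSr branchK; first exact: IH.
exact: branches_in.
Qed.

Lemma monotone_comp f g : monotone_on f -> monotone_on g ->
  (forall u, a <= u <= b -> a <= g u <= b) -> monotone_on (f \o g).
Proof.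
move=> fm gm gI; have I u v : a <= u -> u < v -> v <= b ->
    [/\ a <= g u, g u <= b, a <= g v & g v <= b].
  by move=> au uv vb; have /andP[? ?] := gI u ltac:(lra); have /andP[? ?] := gI v ltac:(lra).
case: fm => fm; case: gm => gm; [left|right|right|left] => u v au uv vb /=;
  have [? ? ? ?] := I _ _ au uv vb; apply: fm => //; exact: gm.
Qed.

Lemma branches_monotone w : monotone_on (branches w).
Proof.
elim: w => [|i w IH]; first by left.
apply: (monotone_comp (f := branch i) (g := branches w)) => //.
  exact: branch_monotone.
by move=> u; exact: branches_in.
Qed.

Definition lo w := Num.min (branches w a) (branches w b).
Definition hi w := Num.max (branches w a) (branches w b).

Lemma monotone_between f u : monotone_on f -> a <= u <= b ->
  Num.min (f a) (f b) <= f u <= Num.max (f a) (f b).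
Proof.
move=> fm /andP[au ub]; rewrite ge_min le_max.
have [->|ua] := eqVneq u a; first by rewrite lexx.
have [->|ub'] := eqVneq u b; first by rewrite lexx !orbT.
have {}au : a < u by rewrite lt_neqAle eq_sym ua.
have {}ub : u < b by rewrite lt_neqAle ub'.
case: fm => fm.
  by rewrite (ltW (fm _ _ (lexx _) au (ltW ub))) (ltW (fm _ _ (ltW au) ub (lexx _))) orbT.
by rewrite (ltW (fm _ _ (lexx _) au (ltW ub))) (ltW (fm _ _ (ltW au) ub (lexx _))) orbT.
Qed.

Lemma branches_lohi w w' u : a <= u <= b ->
  lo w <= branches (w ++ w') u <= hi w.
Proof.
move=> uI; rewrite /branches foldr_cat; apply: (monotone_between (branches_monotone w)).
exact: branches_in.
Qed.

Let Ia : a <= a <= b. Proof. by rewrite lexx ltW. Qed.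
Let Ib : a <= b <= b. Proof. by rewrite lexx ltW. Qed.

Lemma lohi_cat w w' : lo w <= lo (w ++ w') /\ hi (w ++ w') <= hi w.
Proof.
have /andP[? ?] := branches_lohi w w' Ia; have /andP[? ?] := branches_lohi w w' Ib.
by split; rewrite /lo /hi ?le_min ?ge_max; apply/andP; split.
Qed.

Lemma lohi_in w : a <= lo w /\ hi w <= b.
Proof.
have /andP[? ?] := branches_in w Ia; have /andP[? ?] := branches_in w Ib.
by split; rewrite /lo /hi ?le_min ?ge_max; apply/andP; split.
Qed.

Lemma lo_le_hi w : lo w <= hi w.
Proof. by rewrite /lo /hi ge_min !le_max lexx. Qed.

Lemma lohi_head i w : p i <= lo (i :: w) /\ hi (i :: w) <= q i.
Proof.
have /andP[? ?] := branch_in i (branches_in w Ia).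
have /andP[? ?] := branch_in i (branches_in w Ib).
by split; rewrite /lo /hi ?le_min ?ge_max; apply/andP; split.
Qed.

(** The one-letter segments are disjoint, and strictly monotone branches keep
segments apart. *)
Lemma lohi_disjoint w w' : size w = size w' -> w <> w' ->
  hi w < lo w' \/ hi w' < lo w.
Proof.
have cons i x : let f := branch i in
    lo (i :: x) = Num.min (f (lo x)) (f (hi x)) /\
    hi (i :: x) = Num.max (f (lo x)) (f (hi x)).
  rewrite /lo /hi /=; have [xy|xy] := leP (branches x a) (branches x b); first by [].
  by rewrite minC maxC.
elim: w w' => [[]//|i x IH] [//|j y] [sxy] ne.
have [ij|/eqP ij] := eqVneq i j; last first.
  have [pi qi] := lohi_head i x; have [pj qj] := lohi_head j y.
  case: i j ij pi qi pj qj {ne} => -[] // _ pi qi pj qj; [right|left].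
    by rewrite (le_lt_trans qj) // (lt_le_trans q0p1).
  by rewrite (le_lt_trans qi) // (lt_le_trans q0p1).
subst j; have {}ne : x <> y by move=> E; apply: ne; rewrite E.
have key x' y' : hi x' < lo y' ->
    hi (i :: x') < lo (i :: y') \/ hi (i :: y') < lo (i :: x').
  move=> xy; have [-> ->] := cons i x'; have [-> ->] := cons i y'.
  have [ax _] := lohi_in x'; have [_ yb] := lohi_in y'.
  have xl := lo_le_hi x'; have yl := lo_le_hi y'.
  have m u v (f := branch i) : a <= u -> u <= v -> v <= b ->
      (forall u v, a <= u -> u < v -> v <= b -> f u < f v) -> f u <= f v.
    by move=> au; rewrite le_eqVlt => /orP[/eqP -> //|uv] vb fm; exact: ltW (fm _ _ au uv vb).
  have m' u v (f := branch i) : a <= u -> u <= v -> v <= b ->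
      (forall u v, a <= u -> u < v -> v <= b -> f v < f u) -> f v <= f u.
    by move=> au; rewrite le_eqVlt => /orP[/eqP -> //|uv] vb fm; exact: ltW (fm _ _ au uv vb).
  have hxb : hi x' <= b by exact: le_trans (ltW xy) (le_trans yl yb).
  have aly : a <= lo y' by exact: le_trans ax (le_trans xl (ltW xy)).
  have ahx : a <= hi x' by exact: le_trans xl.
  have lyb : lo y' <= b by exact: le_trans yb.
  case: (branch_monotone i) => fm; [left|right].
    by rewrite max_r ?min_l; [exact: fm|exact: m|exact: m].
  by rewrite max_l ?min_r; [exact: fm|exact: m'|exact: m'].
by have [|] := IH y sxy ne => /key; [|case; [right|left]].
Qed.

Definition segment w : set R := `[lo w, hi w]%classic.

Lemma segment_inj w w' t : size w = size w' -> segment w t -> segment w' t -> w = w'.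
Proof.
rewrite /segment /= !in_itv/= => sw /andP[? ?] /andP[? ?]; apply: contrapT => ne.
by case: (lohi_disjoint sw ne); lra.
Qed.

Lemma long_segment_gridpoint eta w : 0 < eta -> eta <= hi w - lo w ->
  exists j : 'I_(Num.truncn ((b - a) / eta)).+1, segment w (a + j%:R * eta).
Proof.
move=> eta0 long; have [alo hib] := lohi_in w.
pose j := (Num.truncn ((lo w - a) / eta)).+1.
have j1 : lo w < a + j%:R * eta.
  by rewrite -ltrBlDl -ltr_pdivrMr // /j; exact: Num.Theory.truncnS_gt.
have j2 : a + j%:R * eta <= lo w + eta.
  have := @Num.Theory.truncn_le _ ((lo w - a) / eta).
  rewrite divr_ge0 ?subr_ge0 ?(ltW eta0) // => H.
  have : (j%:R - 1) * eta <= lo w - a by rewrite -ler_pdivlMr // /j -natr1 addrK.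
  by rewrite mulrBl mul1r; lra.
have jb : (j < (Num.truncn ((b - a) / eta)).+1)%N.
  rewrite ltnS Num.Theory.truncn_ge_nat ?divr_ge0 ?subr_ge0 ?(ltW ab) ?(ltW eta0) //.
  by rewrite ler_pdivlMr //; lra.
by exists (Ordinal jb); rewrite /segment /= in_itv/=; lra.
Qed.

(** Disjoint segments contain different points of a grid. *)
Lemma few_long_segments eta k (A : {set k.-tuple bool}) : 0 < eta ->
  (forall w, w \in A -> eta <= hi w - lo w) ->
  (#|A| <= (Num.truncn ((b - a) / eta)).+1)%N.
Proof.
move=> eta0 Along.
have jP (w : k.-tuple bool) : exists j : 'I_(Num.truncn ((b - a) / eta)).+1,
    w \in A -> segment w (a + j%:R * eta).
  have [wA|wA] := boolP (w \in A); last by exists ord0.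
  by have [j jw] := long_segment_gridpoint eta0 (Along _ wA); exists j.
have [f fP] := choice jP.
rewrite -(card_in_imset (f := f)); first by rewrite (leq_trans (max_card _)) // card_ord.
move=> w w' wA wA' E; apply: val_inj; apply: segment_inj (fP w wA) _.
  by rewrite !size_tuple.
by rewrite E; exact: fP.
Qed.

Definition cylinder w : set X := h @` segment w.

Lemma cylinder_closed w : closed (cylinder w).
Proof. by apply: path_image_closed; exact: harc.1. Qed.

(** A cluster point of the preimages of one point along longer and longer
prefixes of u. *)
Lemma exists_coded u : exists y, coded F cylinder y u.
Proof.
pose t m := branches (window u 0 m) a.
have tI m : `[a, b]%classic (t m) by rewrite /= in_itv/=; exact: branches_in.
have [s [_ scl]] : exists s, `[a, b]%classic s /\ cluster (t @ \oo) s.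
  have [|s [sI scl]] := @segment_compact _ a b (t @ \oo) _; last by exists s.
  by exists 0%N => // m _ /=; exact: tI.
exists (h s) => n k.
have Fnc : continuous (iter n F \o h).
  move=> x; apply: continuous_comp; first exact: harc.1.
  exact: iter_continuous.
have Dc := closed_path_preimage Fnc (@cylinder_closed (window u n k)).
suff : closure ((iter n F \o h) @^-1` cylinder (window u n k)) s by move=> /Dc.
move=> B sB; apply: scl => //; exists (n + k)%N => // m /= nkm.
have -> : t m = branches (window u 0 n ++
    (window u n k ++ window u (n + k) (m - (n + k)))) a.
  by rewrite /t -windowD -[n in window u n _]add0n -windowD addnA subnKC.
have := branchesK (window u 0 n)
  (window u n k ++ window u (n + k) (m - (n + k))) Ia.
rewrite size_window => ->.
exists (branches (window u n k ++ window u (n + k) (m - (n + k))) a) => //.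
by rewrite /segment /= in_itv/=; exact: branches_lohi.
Qed.

Lemma cylinder_head i w y : cylinder (i :: w) y -> (h @` `[p i, q i]) y.
Proof.
move=> [t + <-]; rewrite /segment /= in_itv/= => /andP[t1 t2]; exists t => //=.
have [? ?] := lohi_head i w.
by rewrite in_itv/= (le_trans _ t1) // (le_trans t2).
Qed.

Lemma cylinders_separated : exists2 e : R, 0 < e & forall y z u v n,
  coded F cylinder y u -> coded F cylinder z v -> u n <> v n ->
  e <= mdist (iter n F y) (iter n F z).
Proof.
have Ik i : compact (h @` `[p i, q i]).
  apply: continuous_compact; last exact: segment_compact.
  by apply: continuous_subspaceT; exact: harc.1.
have [||e e0 eP] := compact_closed_dist (Ik false) (B := h @` `[p true, q true]).
- by apply: path_image_closed; exact: harc.1.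
- move=> _ [t /= + <-] [t' /=]; rewrite !in_itv/= => tI tI' E.
  have := harc.2 t' t; rewrite !in_itv/= (pq_in tI) (pq_in tI') => /(_ isT isT E) tt.
  move: tI tI' => /andP[_ t1] /andP[t2 _]; move: q0p1; rewrite ltNge => /negP; apply.
  by rewrite (le_trans t2) // tt.
exists e => // y z u v n yu zv.
have := cylinder_head (yu n 1%N); have := cylinder_head (zv n 1%N).
rewrite !addn0; case: (u n); case: (v n) => // yI zI _; last exact: eP.
by rewrite metric_sym; exact: eP.
Qed.

Lemma large_cylinder_long e : 0 < e -> exists2 eta : R, 0 < eta & forall w y z,
  cylinder w y -> cylinder w z -> e <= mdist y z -> eta <= hi w - lo w.
Proof.
move=> e0; have [eta eta0 etaP] := uniform_continuity_segment a b harc.1 e0.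
exists eta => // w _ _ [s + <-] [t + <-]; rewrite /segment /= !in_itv/= => sI tI.
rewrite leNgt => /negP H; rewrite leNgt; apply/negP => short; apply: H.
have [? ?] := lohi_in w; apply: etaP; first by apply/andP; split; lra.
by rewrite ltr_norml; lra.
Qed.

(** If the cylinders of a sequence do not shrink, then all its segments have a
rational number in common, and this number determines the sequence. *)
Lemma cylinder_coding : coding F cylinder.
Proof.
split.
- exact: cylinder_closed.
- exact: exists_coded.
- exact: cylinders_separated.
- move=> e e0; have [eta eta0 etaP] := large_cylinder_long e0.
  exists (Num.truncn ((b - a) / eta)).+1 => k A Alarge.
  apply: few_long_segments => // w /Alarge[y [z [wy wz yz]]].
  exact: etaP wy wz yz.
have ratP u : exists r : rat, ~ shrinking cylinder u ->
    forall k, segment (window u 0 k) (ratr r).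
  have [|ns] := pselect (shrinking cylinder u); first by exists 0.
  have [e e0 eP] : exists2 e : R, 0 < e & forall k, exists y z,
      [/\ cylinder (window u 0 k) y, cylinder (window u 0 k) z & e <= mdist y z].
    apply: contrapT => n; apply: ns => e e0; apply: contrapT => nk; apply: n.
    exists e => // k; apply: contrapT => nyz; apply: nk; exists k => y z yc zc.
    by rewrite ltNge; apply/negP => H; apply: nyz; exists y, z.
  have [eta eta0 etaP] := large_cylinder_long e0.
  pose l k := lo (window u 0 k).
  have lmono k k' : l k + eta <= hi (window u 0 k').
    have long m : eta <= hi (window u 0 m) - lo (window u 0 m).
      by have [y [z [wy wz yz]]] := eP m; exact: etaP wy wz yz.
    have := long (k + k')%N.
    have [H1 _] : lo (window u 0 k) <= lo (window u 0 (k + k')) /\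
        hi (window u 0 (k + k')) <= hi (window u 0 k).
      by rewrite windowD; exact: lohi_cat.
    have [_ H2] : lo (window u 0 k') <= lo (window u 0 (k + k')) /\
        hi (window u 0 (k + k')) <= hi (window u 0 k').
      by rewrite addnC windowD; exact: lohi_cat.
    by rewrite /l; lra.
  have lub : has_ubound (range l).
    by exists (hi (window u 0 0)) => _ [k _ <-]; have := lmono k 0%N; lra.
  have lS k : l k <= sup (range l) by apply: ub_le_sup => //; exists k.
  have Sh k : sup (range l) <= hi (window u 0 k) - eta.
    apply: ge_sup; first by exists (l 0%N), 0%N.
    by move=> _ [m _ <-]; have := lmono m k; lra.
  have [|r] := @rat_in_itvoo R (sup (range l)) (sup (range l) + eta); first by rewrite ltrDl.
  rewrite in_itv/= => /andP[r1 r2]; exists r => _ k; rewrite /segment /= in_itv/=.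
  by have := lS k; have := Sh k; rewrite /l => ? ?; apply/andP; split; lra.
have [r rP] := choice ratP.
apply/countable_injP; exists (pickle \o r) => u v /set_mem /= un /set_mem /= vn.
move=> /(pcan_inj pickleK) ruv; apply/funext => n.
have E : window u 0 n.+1 = window v 0 n.+1.
  apply: (@segment_inj _ _ (ratr (r u))); first by rewrite !size_window.
    exact: rP.
  by rewrite ruv; exact: rP.
by have := window_eqP E (ltnSn n).
Qed.
End inverse_branches.

(** * Toeplitz sequences *)

(** For alternating x this is the period doubling sequence. The shift n + 1
avoids the valuation of 0. *)
Definition toeplitz (x : nat -> bool) (n : nat) : bool := x (logn 2 n.+1).

Definition no_triple (x : nat -> bool) :=
  forall e, ~ (x e.+1 = x e.+2 /\ x e.+2 = x e.+3).

Lemma logn2_eq x e : (0 < x)%N -> (2 ^ e %| x)%N -> ~~ (2 ^ e.+1 %| x)%N -> logn 2 x = e.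
Proof.
move=> x0; rewrite !pfactor_dvdn // -leqNgt => H1 H2.
by apply/eqP; rewrite eqn_leq H1 H2.
Qed.

Lemma logn2_lt x k : (0 < x)%N -> (x < 2 ^ k)%N -> (logn 2 x < k)%N.
Proof.
move=> x0 xk; rewrite -(@ltn_exp2l 2) //; apply: leq_ltn_trans xk.
by apply: dvdn_leq => //; rewrite pfactor_dvdn.
Qed.

Lemma logn2_mod p q k : (0 < p)%N -> (0 < q)%N -> p = q %[mod 2 ^ k] ->
  (logn 2 p < k)%N -> logn 2 q = logn 2 p.
Proof.
move=> p0 q0 pq lk.
have dv e : (e <= k)%N -> (2 ^ e %| q)%N = (2 ^ e %| p)%N.
  move=> ek; have D : (2 ^ e %| 2 ^ k)%N by rewrite dvdn_exp2l.
  by rewrite /dvdn -(modn_dvdm q D) -pq modn_dvdm.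
apply: logn2_eq => //; first by rewrite dv 1?ltnW // pfactor_dvdn.
by rewrite dv // pfactor_dvdn // -ltnNge.
Qed.

Lemma ex_logn2 i m : exists2 n, (n < 2 ^ m.+1)%N & logn 2 (i + n).+1 = m.
Proof.
pose N := (2 ^ m.+1)%N; have N0 : (0 < N)%N by rewrite expn_gt0.
pose n := ((2 ^ m + (N * i.+1 - i.+1)) %% N)%N.
exists n; first by rewrite ltn_mod.
have E : (i + n).+1 = 2 ^ m %[mod N].
  rewrite -addSn /n modnDmr addnCA subnKC; last by nia.
  by rewrite -modnDmr modnMr addn0.
have pm : logn 2 (2 ^ m) = m by rewrite pfactorK.
by rewrite -[RHS]pm; apply: (logn2_mod (k := m.+1)); rewrite ?expn_gt0 ?pm ?E.
Qed.

Lemma toeplitz_mod x i j k : i = j %[mod 2 ^ k] -> (logn 2 i.+1 < k)%N ->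
  toeplitz x j = toeplitz x i.
Proof.
move=> ij lk; rewrite /toeplitz (logn2_mod _ _ _ lk) //.
by rewrite -(addn1 i) -(addn1 j) -modnDml ij modnDml.
Qed.

(** Places whose index has valuation above that of the difference d of the two
positions are moved by d to places of one and the same valuation, so that x
would repeat a value; hence d is highly divisible, and valuations agree. *)
Lemma toeplitz_rigid x y i j k : no_triple x ->
  (forall n, (n < 2 ^ (k + 4))%N -> toeplitz x (i + n) = toeplitz y (j + n)) ->
  i = j %[mod 2 ^ k] /\ forall v, (v < k)%N -> x v = y v.
Proof.
move=> x3 xy.
have ij : i = j %[mod 2 ^ k].
  have [->//|ne] := eqVneq i j.
  pose d := (maxn i j - minn i j)%N.
  have d0 : (0 < d)%N by rewrite /d; move: ne; case: ltngtP => //; lia.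
  pose e := logn 2 d.
  have [ke|ek] := leqP k e.
    have kd : (2 ^ k %| d)%N by rewrite pfactor_dvdn.
    move: kd; rewrite /d; have [ij|ij] := leqP i j => kd; apply/eqP.
      by rewrite eq_sym eqn_mod_dvd.
    by rewrite eqn_mod_dvd // ltnW.
  have ed : (2 ^ e %| d)%N by rewrite pfactor_dvdn.
  have end_ : ~~ (2 ^ e.+1 %| d)%N by rewrite pfactor_dvdn // -ltnNge.
  have val m : (e < m)%N -> (m <= e.+3)%N -> x m = y e.
    move=> em me; have [n nm nv] := ex_logn2 i m.
    have nk : (n < 2 ^ (k + 4))%N.
      by apply: leq_trans nm _; rewrite leq_exp2l //; lia.
    have := xy n nk; rewrite /toeplitz nv => ->; congr y.
    have pd : (2 ^ e.+1 %| (i + n).+1)%N by rewrite pfactor_dvdn // nv.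
    have pd' : (2 ^ e %| (i + n).+1)%N by apply: dvdn_trans pd; rewrite dvdn_exp2l.
    have [ij|ij] := leqP i j.
      have E : (j + n).+1 = ((i + n).+1 + d)%N by rewrite /d; lia.
      by apply: logn2_eq => //; rewrite E dvdn_addr.
    have E : (i + n).+1 = ((j + n).+1 + d)%N by rewrite /d; lia.
    apply: logn2_eq => //; first by rewrite -(dvdn_addl _ ed) -E.
    by apply: contra end_ => H; rewrite -(dvdn_addr _ H) -E.
  by exfalso; apply: (x3 e); rewrite !val //; lia.
split => // v vk; have [n nv lv] := ex_logn2 i v.
have nk : (n < 2 ^ (k + 4))%N by apply: leq_trans nv _; rewrite leq_exp2l //; lia.
have := xy n nk; rewrite /toeplitz lv => ->; congr y.
rewrite -[RHS]lv; apply: (logn2_mod (k := k)); rewrite ?lv //.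
by rewrite -[(i + n).+1]addn1 -[(j + n).+1]addn1 -!addnA -(modnDml i) ij modnDml.
Qed.

(** The orbit closure of the Toeplitz sequence under the shift. *)
Definition toeplitz_hull (x u : nat -> bool) :=
  forall L, exists i, forall n, (n < L)%N -> u n = toeplitz x (i + n).

Lemma toeplitz_in_hull x : toeplitz_hull x (toeplitz x).
Proof. by move=> L; exists 0%N. Qed.

Lemma hull_shift x u m : toeplitz_hull x u -> toeplitz_hull x (fun n => u (m + n)%N).
Proof.
move=> ux L; have [i iP] := ux (m + L)%N; exists (i + m)%N => n nL.
by rewrite iP ?addnA // ltn_add2l.
Qed.

Lemma hull_disjoint x y u : no_triple x -> toeplitz_hull x u -> toeplitz_hull y u ->
  x =1 y.
Proof.
move=> x3 ux uy v; have [i iP] := ux (2 ^ (v.+1 + 4))%N.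
have [j jP] := uy (2 ^ (v.+1 + 4))%N.
apply: (toeplitz_rigid (i := i) (j := j) (k := v.+1) x3 _).2 => // n nk.
by rewrite -iP // -jP.
Qed.

(** Each block of the Toeplitz sequence recurs with a bounded period, hence
occurs in each sequence of the orbit closure. *)
Lemma hull_minimal x u i L : toeplitz_hull x u ->
  exists m, forall n, (n < L)%N -> u (m + n)%N = toeplitz x (i + n).
Proof.
move=> ux; pose k := (i + L)%N; have ik : (i + L < 2 ^ k)%N by rewrite ltn_expl.
have [j jP] := ux (2 ^ k + L)%N.
pose m := ((i + (2 ^ k * j - j)) %% 2 ^ k)%N.
have mk : (m < 2 ^ k)%N by rewrite ltn_mod expn_gt0.
have jm : (j + m)%N = i %[mod 2 ^ k].
  rewrite /m modnDmr addnCA subnKC; last by have := expn_gt0 2 k; nia.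
  by rewrite -modnDmr modnMr addn0.
exists m => n nL; rewrite jP; last by lia.
rewrite addnA; apply: (@toeplitz_mod _ _ _ k).
  by rewrite -modnDml -jm modnDml.
by apply: logn2_lt => //; lia.
Qed.

Lemma toeplitz_not_periodic x n : no_triple x ->
  (forall i, toeplitz x (n + i) = toeplitz x i) -> n = 0%N.
Proof.
move=> x3 xn; have [] := @toeplitz_rigid x x n 0 n x3; first by move=> i _; exact: xn.
by rewrite mod0n modn_small // ltn_expl.
Qed.

Lemma uncountable_bool_sequences : ~ countable [set: nat -> bool].
Proof.
move=> /countable_injP[f fi].
pose g n := if pselect (exists2 u, f u = n & u n) is left _ then false else true.
have gn : g (f g) <> g (f g).
  rewrite {1}/g; case: pselect => [[u fu uf] gf|n gf].
    have E : u = g by apply: fi; rewrite ?inE.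
    by move: uf; rewrite E -gf.
  by apply: n; exists g.
exact: gn.
Qed.

Section dyadic_integers.
Variable b : nat -> bool.

(** The binary digits of a 2-adic integer; infinitely many of them vanish, so
that it is not a negative integer and adding n + 1 never gives 0. *)
Definition digit (k : nat) : bool := odd k && b k./2.

Fixpoint truncation (k : nat) : nat :=
  if k is k'.+1 then (truncation k' + digit k' * 2 ^ k')%N else 0%N.

Lemma truncation_lt k : (truncation k < 2 ^ k)%N.
Proof.
elim: k => [|k IH] //=; rewrite expnS.
by case: (digit k); rewrite ?mul1n ?mul0n; lia.
Qed.

Lemma truncation_mod k l : truncation (k + l) = truncation k %[mod 2 ^ k].
Proof.
elim: l => [|l IH]; first by rewrite addn0.
rewrite addnS /= -modnDmr expnD mulnCA modnMr addn0 //.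
Qed.

(** The Toeplitz sequence read from a 2-adic starting point. As the digit of
index 2n vanishes, the truncation at 2n + 1 determines the n-th term. *)
Definition dyadic_toeplitz (x : nat -> bool) (n : nat) :=
  toeplitz x (truncation (n.*2).+1 + n).

Lemma dyadic_toeplitzE x n l :
  dyadic_toeplitz x n = toeplitz x (truncation ((n.*2).+1 + l) + n).
Proof.
apply/esym; apply: (@toeplitz_mod _ _ _ (n.*2).+1).
  by rewrite -modnDml -(modnDml (truncation (_ + _))) truncation_mod.
apply: logn2_lt => //=; rewrite /digit odd_double /= mul0n addn0.
have := truncation_lt n.*2; have := ltn_expl n.*2 (isT : (1 < 2)%N).
by rewrite expnS; lia.
Qed.

Lemma dyadic_toeplitz_hull x : toeplitz_hull x (dyadic_toeplitz x).
Proof.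
move=> L; exists (truncation (L.*2).+1) => n nL.
rewrite (dyadic_toeplitzE x n (L.*2 - n.*2)); congr (toeplitz x (truncation _ + _)).
by lia.
Qed.
End dyadic_integers.

Lemma dyadic_toeplitz_inj x b b' : no_triple x ->
  dyadic_toeplitz b x = dyadic_toeplitz b' x -> b = b'.
Proof.
move=> x3 E.
have T k : truncation b k = truncation b' k.
  pose L := (2 ^ (k + 4))%N; pose K := (L.*2).+1.
  have TL c n : (n < L)%N -> dyadic_toeplitz c x n = toeplitz x (truncation c K + n).
    move=> nL; rewrite (dyadic_toeplitzE c x n (L.*2 - n.*2)).
    by congr (toeplitz x (truncation _ _ + _)); rewrite /K; lia.
  have [|M _] := @toeplitz_rigid x x (truncation b K) (truncation b' K) k x3.
    by move=> n nL; rewrite -!TL // E.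
  have kK : (k <= K)%N.
    have := ltn_expl (k + 4) (isT : (1 < 2)%N); rewrite /K /L; lia.
  have Tk c : truncation c K = truncation c k %[mod 2 ^ k].
    by rewrite -(subnKC kK) truncation_mod.
  by move: M; rewrite !Tk !modn_small ?truncation_lt.
apply/funext => n; have := T (n.*2).+2; rewrite /= T /digit /= odd_double /=.
rewrite uphalf_double.
have := expn_gt0 2 (n.*2).+1; move: (2 ^ _)%N => P P0.
by case: (b n); case: (b' n) => //=; lia.
Qed.

(** The Toeplitz sequence may be read from uncountably many 2-adic starting
points, which can be recovered by rigidity. *)
Lemma uncountable_hull x : no_triple x -> ~ countable [set u | toeplitz_hull x u].
Proof.
move=> x3 hc; apply: uncountable_bool_sequences.
have /countable_injP[f fi] := hc; apply/countable_injP.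
exists (fun b => f (dyadic_toeplitz b x)) => b b' _ _ /fi E.
apply: (dyadic_toeplitz_inj x3); apply: E; rewrite inE; exact: dyadic_toeplitz_hull.
Qed.

(** The sequence a, interspersed with fixed values that rule out triples. *)
Definition spread (a : nat -> bool) (v : nat) : bool :=
  if (v %% 3 == 0)%N then false else if (v %% 3 == 1)%N then true else a (v %/ 3)%N.

Lemma spread_no_triple a : no_triple (spread a).
Proof.
move=> e; rewrite /spread.
have : (e %% 3 < 3)%N by rewrite ltn_mod.
have E1 : (e.+1 %% 3 = (e %% 3).+1 %% 3)%N by rewrite -addn1 -modnDml addn1.
have E2 : (e.+2 %% 3 = (e %% 3).+2 %% 3)%N by rewrite -addn2 -modnDml addn2.
have E3 : (e.+3 %% 3 = (e %% 3).+3 %% 3)%N by rewrite -addn3 -modnDml addn3.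
rewrite E1 E2 E3; case: (e %% 3)%N => [|[|[|//]]] _ /= [].
- by move=> <-.
- by [].
- by [].
Qed.

Lemma spread_inj a a' : spread a =1 spread a' -> a = a'.
Proof.
move=> aa; apply/funext => m; have := aa (3 * m + 2)%N.
by rewrite /spread mulnC modnMDl divnMDl //= addn0.
Qed.

(** * Blocks, upper limits and counting *)

Section blocks.

(** Consecutive blocks of places start at these; each block is longer than all the
preceding ones together, by a factor that tends to infinity. *)
Definition block_start (j : nat) : nat := (j.+1)`!.-1.

Lemma block_startS j : (block_start j.+1).+1 = (j.+2 * (block_start j).+1)%N.
Proof. by rewrite /block_start !prednK ?fact_gt0. Qed.

Lemma block_startE j : block_start j.+1 = (j.+2 * block_start j + j.+1)%N.
Proof. by have := block_startS j; rewrite mulnS; lia. Qed.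

Lemma block_start_lt j : (block_start j < block_start j.+1)%N.
Proof. by rewrite -ltnS block_startS; nia. Qed.

Lemma block_start_mono i j : (i <= j)%N -> (block_start i <= block_start j)%N.
Proof.
move=> /subnKC <-; elim: (j - i)%N => [|k IH]; first by rewrite addn0.
by rewrite addnS (leq_trans IH) // ltnW // block_start_lt.
Qed.

Lemma block_length j : (j <= block_start j.+1 - block_start j)%N.
Proof. by have := block_startS j; nia. Qed.

Lemma ex_block n : exists j, (block_start j <= n < block_start j.+1)%N.
Proof.
elim: n => [|n [j /andP[jn nj]]]; first by exists 0%N.
have [H|H] := ltnP n.+1 (block_start j.+1); first by exists j; rewrite H (leq_trans jn).
exists j.+1; rewrite H /=; apply: leq_ltn_trans (block_start_lt j.+1); exact: nj.
Qed.

Definition block (n : nat) : nat := sval (cid (ex_block n)).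

Lemma blockE n j : (block_start j <= n < block_start j.+1)%N -> block n = j.
Proof.
rewrite /block; case: cid => k /= /andP[kn nk] /andP[jn nj].
have [kj|jk|//] := ltngtP k j.
  by have := block_start_mono kj; lia.
by have := block_start_mono jk; lia.
Qed.

Definition concat_blocks (y : nat -> nat -> bool) (n : nat) : bool :=
  y (block n) (n - block_start (block n))%N.

Lemma concat_blocksE y j i : (block_start j + i < block_start j.+1)%N ->
  concat_blocks y (block_start j + i) = y j i.
Proof.
move=> ij; rewrite /concat_blocks (@blockE _ j) ?leq_addr ?ij //.
by rewrite addKn.
Qed.
End blocks.

Section upper_lower_limits.
Context {R : realType}.
Implicit Type u : nat -> R.

Lemma limn_sup_eq u (l : R) : bounded_fun u ->
  (forall e, 0 < e -> exists N, forall n, (N <= n)%N -> u n <= l + e) ->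
  (forall e N, 0 < e -> exists2 n, (N <= n)%N & l - e <= u n) ->
  limn_sup u = l.
Proof.
move=> ub ule uge; rewrite limn_supE //.
have ubd : has_ubound (range u) := bounded_fun_has_ubound ub.
have sge n : l <= sups u n.
  apply/ler_addgt0Pr => e e0; have [m nm um] := uge e n e0.
  rewrite -lerBlDr (le_trans um) //; apply: ub_le_sup; last by exists m.
  exact/has_ubound_sdrop.
apply/eqP; rewrite eq_le; apply/andP; split; last first.
  by apply: lb_le_inf; [exists (sups u 0%N), 0%N|move=> _ [n _ <-]; exact: sge].
apply/ler_addgt0Pr => e e0; have [N NP] := ule e e0.
apply: (@le_trans _ _ (sups u N)).
  by apply: ge_inf; [exists l => _ [n _ <-]; exact: sge|exists N].
apply: ge_sup; first by exists (u N), N => /=.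
by move=> _ [n /= Nn <-]; exact: NP.
Qed.

Lemma limn_inf_eq0 u : bounded_fun u -> (forall n, 0 <= u n) ->
  (forall e N, 0 < e -> exists2 n, (N <= n)%N & u n <= e) -> limn_inf u = 0.
Proof.
move=> ub u0 ue; rewrite limn_infE //.
have lbd : has_lbound (range u) by exists 0 => _ [n _ <-].
have ile n : infs u n <= 0.
  apply/ler_addgt0Pr => e e0; rewrite add0r; have [m nm um] := ue e n e0.
  apply: le_trans um; apply: ge_inf; last by exists m.
  exact/has_lbound_sdrop.
apply/eqP; rewrite eq_le; apply/andP; split.
  by apply: ge_sup; [exists (infs u 0%N), 0%N|move=> _ [n _ <-]; exact: ile].
apply: (@le_trans _ _ (infs u 0%N)); last first.
  by apply: ub_le_sup; [exists 0 => _ [n _ <-]; exact: ile|exists 0%N].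
apply: lb_le_inf; first by exists (u 0%N), 0%N.
by move=> _ [n _ <-].
Qed.
End upper_lower_limits.

Section counting_times.
Implicit Types P Q : pred nat.

Definition ncount P n : nat := (\sum_(0 <= i < n) P i)%N.

Lemma ncount_card P n : #|[pred k : 'I_n | P k]| = ncount P n.
Proof. by rewrite /ncount big_mkord -sum1_card big_mkcond; apply: eq_bigr => i _. Qed.

Lemma ncountC P n : (ncount P n + ncount (predC P) n)%N = n.
Proof.
rewrite /ncount -big_split /= (eq_bigr (fun _ => 1%N)) ?sum_nat_const_nat ?subn0 ?muln1 //.
by move=> i _; case: (P i).
Qed.

Lemma ncount_le P n : (ncount P n <= n)%N.
Proof. by have := ncountC P n; lia. Qed.

Lemma ncount_sub P Q n : (forall i, (i < n)%N -> P i -> Q i) ->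
  (ncount P n <= ncount Q n)%N.
Proof.
move=> PQ; rewrite /ncount !big_mkord; apply: leq_sum => i _.
by have := PQ i (ltn_ord i); case: (P i) => // ->.
Qed.

Lemma ncountD P m n : ncount P (m + n) = (ncount P m + ncount (fun i => P (m + i)%N) n)%N.
Proof.
rewrite /ncount (@big_cat_nat _ _ _ m) ?leq_addr //=; congr (_ + _)%N.
by rewrite -{1}[m]add0n big_addn addKn; apply: eq_bigr => i _; rewrite addnC.
Qed.

Lemma ncountU P Q n : (ncount (predU P Q) n <= ncount P n + ncount Q n)%N.
Proof.
rewrite /ncount -big_split /=; apply: leq_sum => i _.
by case: (P i); case: (Q i).
Qed.

(** Each time of the iterate stands for M times of the map itself. *)
Lemma ncount_mul P Q M n : (0 < M)%N ->
  (forall i, (i < n * M)%N -> P i -> Q (i %/ M)%N) ->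
  (ncount P (n * M) <= ncount Q n * M)%N.
Proof.
move=> M0; elim: n => [|n IH] PQ; first by rewrite mul0n /ncount big_geq.
have Qn : ncount Q n.+1 = (ncount Q n + Q n)%N by rewrite /ncount big_nat_recr.
rewrite mulSn addnC ncountD Qn mulnDl leq_add //.
  by apply: IH => i iM; apply: PQ; rewrite mulSn; lia.
have [QnT|QnF] := boolP (Q n); first by rewrite mul1n ncount_le.
rewrite mul0n leqn0 /ncount big_nat_cond big1 // => i /andP[/andP[_ iM] _].
apply/eqP; rewrite eqb0; apply: contra QnF => Pi.
have := PQ (n * M + i)%N; rewrite divnMDl // divn_small // addn0; apply => //.
by rewrite mulSn; lia.
Qed.
End counting_times.

(** * Orbits close or apart for long times *)

Lemma ncount_ltn b n : (ncount (fun t => t < b)%N n <= b)%N.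
Proof.
have [nb|bn] := leqP n b; first exact: leq_trans (ncount_le _ _) nb.
rewrite -(subnKC (ltnW bn)) ncountD -[leqRHS]addn0 leq_add ?ncount_le //.
by rewrite leqn0 /ncount big1 // => i _; rewrite ltnNge leq_addr.
Qed.

Lemma ncount_end L n : (ncount (fun i => n < i + L)%N n <= L)%N.
Proof.
have [nb|bn] := leqP n L; first exact: leq_trans (ncount_le _ _) nb.
rewrite -{2}(subnK (ltnW bn)) ncountD -[leqRHS]add0n leq_add ?ncount_le //.
rewrite leqn0 /ncount big_nat_cond big1 // => i /andP[/andP[_ iL] _].
by apply/eqP; rewrite eqb0; lia.
Qed.

Lemma exists_nat_ge (R : realType) (x : R) : exists n : nat, x <= n%:R.
Proof. by exists (Num.truncn x).+1; rewrite ltW // Num.Theory.truncnS_gt. Qed.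

Section close_frequencies.
Context {R : realType} {X : metricType R} (f : X -> X).

Lemma close_freqE x y delta n : close_freq f x y delta n =
  (ncount (fun k => mdist (iter k f x) (iter k f y) < delta) n.+1)%:R / n%:R.
Proof.
by rewrite /close_freq (ncount_card (fun k => mdist (iter k f x) (iter k f y) < delta)).
Qed.

Lemma close_freq_bounded x y delta : bounded_fun (close_freq f x y delta : R^o ^nat).
Proof.
exists 2; split; first by rewrite num_real.
move=> r r2 n _; apply: (le_trans _ (ltW r2)); rewrite close_freqE.
rewrite ger0_norm ?divr_ge0 //; case: n => [|n]; first by rewrite invr0 mulr0.
rewrite ler_pdivrMr ?ltr0n // -natrM ler_nat.
by apply: leq_trans (ncount_le _ _) _; lia.
Qed.
End close_frequencies.

Section coded_points.
Context {R : realType} {X : metricType R}.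
Variables (f : X -> X) (M : nat) (cyl : seq bool -> set X).
Hypotheses (Xc : compact [set: X]) (fc : continuous f) (M0 : (0 < M)%N).
Hypothesis cod : coding (iter M f) cyl.

Lemma coded_unique y u v : coded (iter M f) cyl y u -> coded (iter M f) cyl y v -> u = v.
Proof.
move=> yu yv; have [e e0 eP] := coded_separated cod.
apply/funext => n; apply: contrapT => uv.
by have := eP _ _ _ _ _ yu yv uv; rewrite mdistxx leNgt e0.
Qed.

Lemma uniform_iterates n e : 0 < e -> exists2 d : R, 0 < d &
  forall r x y, (r <= n)%N -> mdist x y < d -> mdist (iter r f x) (iter r f y) < e.
Proof.
move=> e0; elim: n => [|n [d d0 dP]].
  by exists e => // r x y; rewrite leqn0 => /eqP ->.
have [d' d'0 d'P] := uniform_continuity_compact Xc (@iter_continuous _ _ f n.+1 fc) e0.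
exists (Num.min d d'); first by rewrite lt_min d0.
move=> r x y; rewrite leq_eqVlt lt_min => /orP[/eqP ->|rn] /andP[xd xd'].
  exact: d'P.
exact: dP.
Qed.

Lemma compact_diam_ge (x y : X) : mdist x y <= diam X.
Proof.
apply: ub_le_sup; last by exists (x, y).
have [|e e0 eP] := @compact_uniform R X [set: X] (fun e z => mdist x z <= e^-1) Xc.
  move=> z _; pose d := mdist x z; have d0 : 0 <= d by exact: mdist_ge0.
  exists (d + 1)^-1; first by rewrite invr_gt0; lra.
  move=> z' e'; rewrite ballEmdist /= => zz' /andP[e'0 e'd].
  have d1 : 1 <= d + 1 by lra.
  have zz1 : mdist z z' < 1 by apply: lt_le_trans zz' _; rewrite invf_le1 //; lra.
  have e'inv : d + 1 <= e'^-1.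
    by rewrite -[leLHS]invrK lef_pV2 ?posrE ?invr_gt0 //; [exact: ltW|lra].
  have := metric_triangle x z z'; rewrite -/d; lra.
exists (e^-1 + e^-1) => _ [[z z'] _ <-] /=.
have := metric_triangle z x z'; have := eP z I; have := eP z' I.
by rewrite (metric_sym z x); lra.
Qed.

Definition theta := toeplitz (spread (fun _ => false)).

Definition large_at e k i : Prop :=
  exists y z, [/\ cyl (window theta i (2 ^ (k + 4))) y,
                  cyl (window theta i (2 ^ (k + 4))) z & e <= mdist y z].

(** A word of length 2^(k+4) occurs in the Toeplitz sequence at most once in
every 2^k places, and few words have large cylinders. *)
Lemma few_large_windows e : 0 < e -> exists K, forall k n,
  (ncount (fun i => `[< large_at e k i >]) n <= K * (n %/ 2 ^ k).+1)%N.
Proof.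
move=> e0; have [K KP] := few_large_cylinders cod e0; exists K => k n.
rewrite -(ncount_card (fun i => `[< large_at e k i >])).
pose L := (2 ^ (k + 4))%N.
pose A := [set w : L.-tuple bool | `[< exists y z, [/\ cyl w y, cyl w z & e <= mdist y z] >]]%SET.
have AK : (#|A| <= K)%N.
  by apply: KP => w; rewrite finset.in_set => /asboolP.
have wsize i : size (window theta i L) == L by rewrite size_window.
have k0 : (0 < 2 ^ k)%N by rewrite expn_gt0.
(* By rigidity, the word at place i determines i modulo 2^k. *)
pose g (i : 'I_n) := (Tuple (wsize i), inord (i %/ 2 ^ k) : 'I_(n %/ 2 ^ k).+1).
have gi : {in [pred i : 'I_n | `[< large_at e k i >]] &, injective g}.
  move=> i j _ _ [] /window_eqP ww /(congr1 val) /=.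
  rewrite !inordK ?ltnS ?leq_div2r ?(ltnW (ltn_ord _)) // => E.
  have [ij _] := toeplitz_rigid (@spread_no_triple _) (k := k) ww.
  apply: val_inj => /=; rewrite (divn_eq i (2 ^ k)) (divn_eq j (2 ^ k)).
  by rewrite E ij.
rewrite -(card_in_imset gi).
apply: (@leq_trans #|finset.setX A [set: 'I_(n %/ 2 ^ k).+1]%SET|).
  apply/subset_leq_card/fintype.subsetP => _ /imsetP[i il ->].
  rewrite inE /= finset.in_setT andbT finset.in_set; exact: il.
by rewrite cardsX cardsT card_ord leq_mul2r AK orbT.
Qed.

(** Long blocks of theta, on which two of these sequences agree, alternate with
long constant blocks; each term of a governs infinitely many of the latter. *)
Definition dc1_sequence (a : nat -> bool) : nat -> bool :=
  concat_blocks (fun j => if odd j then fun _ => a (logn 2 j./2.+1) else theta).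

Lemma dc1_sequence_even a j i : ~~ odd j ->
  (block_start j + i < block_start j.+1)%N ->
  dc1_sequence a (block_start j + i) = theta i.
Proof. by move=> /negbTE oj ij; rewrite /dc1_sequence concat_blocksE ?oj. Qed.

Lemma dc1_sequence_odd a j i : odd j ->
  (block_start j + i < block_start j.+1)%N ->
  dc1_sequence a (block_start j + i) = a (logn 2 j./2.+1).
Proof. by move=> oj ij; rewrite /dc1_sequence concat_blocksE ?oj. Qed.

Variables (a a' : nat -> bool) (x y : X).
Hypotheses (xa : coded (iter M f) cyl x (dc1_sequence a))
           (ya : coded (iter M f) cyl y (dc1_sequence a')).

Lemma iterM t r z : iter (t * M + r) f z = iter r f (iter t (iter M f) z).
Proof. by rewrite addnC iterD iter_iter. Qed.

(** Along an even block, at all places but those of large cylinders and the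
last ones, both orbits are in one small cylinder. *)
Lemma dc1_close e eta N : 0 < e -> 0 < eta ->
  exists2 n, (N <= n)%N & 1 - eta <= close_freq f x y e n.
Proof.
move=> e0 eta0; have [d d0 dP] := uniform_iterates M e0.
have [K KP] := few_large_windows d0.
(* Places of large cylinders have density at most about K / 2^k, which k makes at
   most eta / 4; then j, at least c, makes the block so late that the
   preceding blocks, its last L places and the rounding are negligible. *)
have [k kP] := exists_nat_ge (4 * K%:R / eta).
pose L := (2 ^ (k + 4))%N.
have [c cP] := exists_nat_ge (4 * (L + K + 1)%:R / eta).
pose j := (maxn N.+1 c).*2.
have oj : ~~ odd j by rewrite odd_double.
have [jc jN] : (c <= j)%N /\ (N < j)%N by rewrite /j; lia.
pose B := block_start j; pose B' := block_start j.+1.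
have BB : (B < B')%N by exact: block_start_lt.
pose l := (B' - B)%N.
pose bad t := d <= mdist (iter t (iter M f) x) (iter t (iter M f) y).
have badB : (ncount bad B' <= B + (L + K * (l %/ 2 ^ k).+1))%N.
  rewrite -(subnKC (ltnW BB)) ncountD leq_add ?ncount_le //.
  apply: (@leq_trans (ncount (predU (fun i => l < i + L)%N
      (fun i => `[< large_at d k i >])) l)%N).
    apply: ncount_sub => i il bi /=; rewrite orbC -implyNb; apply/implyP => nl.
    rewrite ltnNge; apply/negP => iL; move/negP: nl; apply; apply/asboolP.
    have win b : window (dc1_sequence b) (B + i) L = window theta i L.
      apply: eq_window => m mL; rewrite -addnA dc1_sequence_even //.
      by move: il iL; rewrite /l /B /B'; lia.
    exists (iter (B + i) (iter M f) x), (iter (B + i) (iter M f) y); split => //.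
      by rewrite -/L -(win a); exact: xa.
    by rewrite -/L -(win a'); exact: ya.
  by apply: leq_trans (ncountU _ _ _) _; rewrite leq_add ?ncount_end.
pose n := (B' * M).-1.
have n1 : n.+1 = (B' * M)%N by rewrite prednK // muln_gt0 M0 andbT; lia.
have BM : (B' <= B' * M)%N by rewrite leq_pmulr.
have jB' : (j < B')%N by rewrite /B' block_startE; lia.
exists n; first by lia.
pose P i := mdist (iter i f x) (iter i f y) < e.
have far : (ncount (predC P) n.+1 <= ncount bad B' * M)%N.
  rewrite n1; apply: ncount_mul => // i _ /=; apply: contraR; rewrite /bad -ltNge => ?.
  by rewrite /P (divn_eq i M) !iterM; apply: dP => //; rewrite ltnW // ltn_mod.
have near := ncountC P n.+1.
rewrite close_freqE -/P.
have n0 : (0 < n)%N by lia.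
rewrite ler_pdivlMr ?ltr0n //.
have nP : (n.+1 <= ncount P n.+1 + (B + (L + K * (l %/ 2 ^ k).+1)) * M)%N.
  by rewrite -{1}near leq_add2l (leq_trans far) // leq_mul2r badB orbT.
have ls : ((l %/ 2 ^ k) * 2 ^ k <= B')%N.
  by apply: leq_trans (leq_divM _ _) _; rewrite /l leq_subr.
have [eta1|eta1] := leP 1 eta.
  by apply: le_trans (ler0n _ _); rewrite mulr_le0_ge0 // subr_le0.
pose q := (l %/ 2 ^ k)%N.
have jB : (j * B <= B')%N.
  by rewrite /B' block_startE -/B (leq_trans _ (leq_addr _ _)) // leq_mul2r ltnW ?orbT // ltnW.
have real_le m p : (m <= p)%N -> m%:R <= p%:R :> R by rewrite ler_nat.
have c1 : 4 * (L%:R + K%:R + 1) <= eta * j%:R.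
  have : 4 * (L + K + 1)%:R / eta <= j%:R by apply: le_trans cP (real_le _ _ jc).
  by rewrite ler_pdivrMr // mulrC !natrD mulrC (mulrC eta).
have c2 : 4 * K%:R <= eta * (2 ^ k)%:R.
  have : 4 * K%:R / eta <= (2 ^ k)%:R by apply: le_trans kP (real_le _ _ (ltnW (ltn_expl _ _))).
  by rewrite ler_pdivrMr // (mulrC eta).
have H1 : eta * (j%:R * B%:R) <= eta * B'%:R by rewrite ler_pM2l // -natrM real_le.
have H2 : eta * j%:R <= eta * B'%:R by rewrite ler_pM2l // real_le // ltnW.
have H3 : eta * (q%:R * (2 ^ k)%:R) <= eta * B'%:R by rewrite ler_pM2l // -natrM real_le.
have Bge : 0 <= B%:R :> R by []. have qge : 0 <= q%:R :> R by [].
have Lge : 0 <= L%:R :> R by []. have Kge : 0 <= K%:R :> R by [].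
have H4 : 4 * K%:R * q%:R <= eta * (2 ^ k)%:R * q%:R by rewrite ler_wpM2r.
have H5 : 4 * (L%:R + K%:R + 1) * B%:R <= eta * j%:R * B%:R by rewrite ler_wpM2r.
have T : B%:R + (L%:R + K%:R * (q%:R + 1)) <= eta * B'%:R.
  have LB : 0 <= L%:R * B%:R :> R by rewrite mulr_ge0.
  have KB : 0 <= K%:R * B%:R :> R by rewrite mulr_ge0.
  move: (2 ^ k)%:R H3 H4 {c2} => w H3 H4.
  move: H1 H2 H3 H4 H5 c1 LB KB; rewrite !mulrA !mulrDl !mulrDr !mul1r !mulr1.
  rewrite -[eta * q%:R * w]mulrA -[eta * w * q%:R]mulrA (mulrC q%:R w) -!mulrA.
  lra.
have MT : (B%:R + (L%:R + K%:R * (q%:R + 1))) * M%:R <= eta * B'%:R * M%:R.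
  by rewrite ler_wpM2r.
have nR : (n%:R : R) + 1 = B'%:R * M%:R by rewrite natr1 n1 natrM.
have nP' : (n%:R : R) + 1 <= (ncount P n.+1)%:R +
    (B%:R + (L%:R + K%:R * (q%:R + 1))) * M%:R.
  by move: (real_le _ _ nP); rewrite -natr1 !natrD natrM !natrD natrM -natr1.
have : (1 - eta) * n%:R <= (1 - eta) * (n%:R + 1).
  by rewrite ler_wpM2l ?lerDl // subr_ge0 ltW.
by rewrite nR mulrBl mul1r; rewrite -mulrA in MT; lra.
Qed.

(** Along an odd block whose constant differs for both sequences, both orbits
are in different cylinders of length one. *)
Lemma dc1_far : a <> a' -> exists2 e : R, 0 < e &
  forall eta N, 0 < eta -> exists2 n, (N <= n)%N & close_freq f x y e n <= eta.
Proof.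
move=> aa'; have [v av] : exists v, a v <> a' v.
  by apply: contrapT => n; apply: aa'; apply/funext => v; apply: contrapT => ?; apply: n; exists v.
have [e0 e00 e0P] := coded_separated cod.
have [e e_gt0 eP] := uniform_iterates M e00.
exists e => // eta N eta0.
have [c cP] := exists_nat_ge (eta^-1).
have [m _ mv] := ex_logn2 (maxn N.+1 c) v.
pose j := (((maxn N.+1 c + m).*2).+1)%N.
have oj : odd j by rewrite /j /= odd_double.
have jv : logn 2 (j./2).+1 = v by rewrite /j /= uphalf_double.
have [jc jN] : (c <= j)%N /\ (N < j)%N by rewrite /j; lia.
pose B := block_start j; pose B' := block_start j.+1.
have BB : (B < B')%N by exact: block_start_lt.
pose n := ((B' - 1) * M).-1.
have jB' : (j < B')%N by rewrite /B' block_startE; lia.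
have n1 : n.+1 = ((B' - 1) * M)%N by rewrite prednK // muln_gt0 M0 andbT; lia.
have BM : (B' - 1 <= (B' - 1) * M)%N by rewrite leq_pmulr.
exists n; first by lia.
pose P i := mdist (iter i f x) (iter i f y) < e.
have closeP : (ncount P n.+1 <= B * M)%N.
  apply: (@leq_trans (ncount (fun t => t < B)%N (B' - 1) * M)%N); last first.
    by rewrite leq_mul2r ncount_ltn orbT.
  rewrite n1; apply: ncount_mul => // i iM Pi; rewrite ltnNge; apply/negP => Bi.
  (* The next multiple of M after time i: closeness at time i would last until
     then. *)
  pose t := (i %/ M).+1.
  have tB' : (t < B')%N by rewrite /t; have := ltn_divLR i (B' - 1) M0; lia.
  have [s st] : exists s, t = (B + s)%N by exists (t - B)%N; rewrite /t; lia.
  have rM : (t * M - i <= M)%N.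
    by rewrite /t mulSn; have := divn_eq i M; lia.
  have iT : (t * M - i + i)%N = (t * M)%N.
    by apply: subnK; rewrite /t mulSn; have := divn_eq i M; have := ltn_pmod i M0; lia.
  have := eP _ _ _ rM Pi; rewrite -!iterD iT -!iter_iter ltNge => /negP; apply.
  apply: (e0P _ _ _ _ _ xa ya); rewrite st !dc1_sequence_odd ?jv //.
    by move: tB'; rewrite st.
  by move: tB'; rewrite st.
rewrite close_freqE -/P.
have n0 : (0 < n)%N by lia.
rewrite ler_pdivrMr ?ltr0n //.
have jB : (j.+2 * B * M <= n)%N.
  have E : (B' - 1 = j.+2 * B + j)%N by rewrite /B' block_startE -/B; lia.
  have jM : (j <= j * M)%N by rewrite leq_pmulr.
  by move: n1; rewrite E mulnDl; lia.
have BR : (j.+2%:R * (B%:R * M%:R) : R) <= n%:R by rewrite -!natrM mulnA ler_nat.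
have jeta : 1 <= eta * j.+2%:R.
  rewrite mulrC -ler_pdivrMr // mul1r (le_trans cP) // ler_nat; lia.
apply: (@le_trans _ _ (B%:R * M%:R)); first by rewrite -natrM ler_nat.
apply: (@le_trans _ _ (eta * (j.+2%:R * (B%:R * M%:R)))); last by rewrite ler_pM2l.
by rewrite mulrA ler_peMl // mulr_ge0.
Qed.
End coded_points.

(** * Distributional chaos *)

Lemma uncountable_injective_image (T : Type) (A : set (nat -> bool)) (x : (nat -> bool) -> T) :
  ~ countable A -> {in A &, injective x} -> ~ countable (x @` A).
Proof.
move=> nA xi /countable_injP[g gi]; apply: nA; apply/countable_injP.
exists (g \o x) => a b aA bA /gi E; apply: xi => //; apply: E.
  by apply/mem_set; exists a => //; exact/set_mem.
by apply/mem_set; exists b => //; exact/set_mem.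
Qed.

Section distributional_chaos.
Context {R : realType} {X : metricType R}.
Variables (f : X -> X) (M : nat) (cyl : seq bool -> set X).
Hypotheses (Xc : compact [set: X]) (fc : continuous f) (M0 : (0 < M)%N).
Hypothesis cod : coding (iter M f) cyl.

Lemma Phi_sup_eq1 x y delta :
  (forall eta N, 0 < eta -> exists2 n, (N <= n)%N & 1 - eta <= close_freq f x y delta n) ->
  Phi_sup f x y delta = 1.
Proof.
move=> close; apply: limn_sup_eq; first exact: close_freq_bounded.
  move=> e e0; have [n ne] := exists_nat_ge e^-1.
  exists n.+1 => m nm; rewrite close_freqE.
  have m0 : 0 < m%:R :> R by rewrite ltr0n (leq_trans _ nm).
  rewrite ler_pdivrMr // mulrDl mul1r.
  apply: (@le_trans _ _ m.+1%:R); first by rewrite ler_nat ncount_le.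
  rewrite -natr1 lerD2l mulrC -ler_pdivrMr // mul1r (le_trans ne) // ler_nat.
  exact: ltnW.
by move=> e N e0; exact: close.
Qed.

Lemma Phi_inf_eq0 x y e e' : e <= e' ->
  (forall eta N, 0 < eta -> exists2 n, (N <= n)%N & close_freq f x y e' n <= eta) ->
  Phi_inf f x y e = 0.
Proof.
move=> ee far; apply: limn_inf_eq0; first exact: close_freq_bounded.
  by move=> n; rewrite close_freqE divr_ge0.
move=> eta N eta0; have [n Nn nf] := far eta N eta0; exists n => //.
apply: le_trans nf; rewrite !close_freqE ler_wpM2r ?invr_ge0 // ler_nat.
by apply: ncount_sub => i _ ie; exact: lt_le_trans ie ee.
Qed.

Lemma DC1u_of_coding : DC1u f.
Proof.
have [x xP] := choice (fun a => coded_point cod (dc1_sequence a)).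
exists (range x).
  apply: uncountable_injective_image; first exact: uncountable_bool_sequences.
  move=> a a' _ _ E; apply: contrapT => aa'.
  have [v av] : exists v, a v <> a' v.
    by apply: contrapT => n; apply: aa'; apply/funext => v; apply: contrapT => ?; apply: n; exists v.
  have xa' := xP a'; rewrite -E in xa'.
  have S := coded_unique cod (xP a) xa'.
  have [m _ mv] := ex_logn2 0 v; rewrite add0n in mv.
  have := congr1 (fun s => s (block_start m.*2.+1 + 0)%N) S.
  have jl : (block_start m.*2.+1 + 0 < block_start m.*2.+2)%N by rewrite addn0 block_start_lt.
  by rewrite /= !dc1_sequence_odd //= ?odd_double // uphalf_double mv.
move=> _ _ [a _ <-] [a' _ <-] xx.
have aa' : a <> a' by move=> E; apply: xx; rewrite E.
split.
  move=> delta /andP[d0 _]; apply: Phi_sup_eq1 => eta N eta0.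
  exact: (dc1_close Xc fc M0 cod (xP a) (xP a')).
have [e e0 far] := dc1_far Xc fc M0 cod (xP a) (xP a') aa'.
have dX : 0 < diam X.
  by apply: lt_le_trans (compact_diam_ge Xc (x a) (x a')); rewrite mdist_gt0; exact/eqP.
exists (Num.min e (diam X)); first by rewrite lt_min e0 dX ge_min lexx orbT.
by apply: Phi_inf_eq0 far; rewrite ge_min lexx.
Qed.
End distributional_chaos.

(** * Omega-limit sets and codes *)

Section omega_limits.
Context {R : realType} {X : metricType R}.
Implicit Type f : X -> X.

Lemma omega_limitP f x y : omega_limit f x y <->
  forall (d : R) N, 0 < d -> exists2 n, (N <= n)%N & mdist y (iter n f x) < d.
Proof.
split=> [oy d N d0|oy A B [N _ NA] /nbhs_ballP[d /= d0 dB]].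
  have [|z [[n Nn <-] /= yz]] := oy [set iter n f x | n in [set n | (N <= n)%N]] (ball y d) _ (nbhsx_ballx y d d0).
    by exists N => // n /= Nn; exists n.
  by exists n => //; rewrite ballEmdist in yz.
have [n Nn yn] := oy d N d0; exists (iter n f x); split; first exact: NA.
by apply: dB; rewrite ballEmdist.
Qed.

Variables (f : X -> X) (M : nat).
Hypotheses (Xc : compact [set: X]) (fc : continuous f) (M0 : (0 < M)%N).

Lemma omega_limit_iter x y : omega_limit (iter M f) x y -> omega_limit f x y.
Proof.
move=> /omega_limitP oy; apply/omega_limitP => d N d0; have [n Nn yn] := oy d N d0.
exists (n * M)%N; first by rewrite (leq_trans Nn) // leq_pmulr.
by rewrite -iter_iter.
Qed.

(** Otherwise the orbit of x under the iterate would, from some time on, stay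
away from all points y, f y, and so on up to the M-th one; but each passage of
the orbit near y is followed, at most M steps later, by a multiple of M. *)
Lemma omega_limit_some_iterate x y : omega_limit f x y ->
  exists2 j, (j <= M)%N & omega_limit (iter M f) x (iter j f y).
Proof.
move=> /omega_limitP oy; apply: contrapT => n.
(* One number serves as a distance and, by its inverse, as a time. *)
have nj (j : 'I_M.+1) : exists2 d : R, 0 < d & forall t, d^-1 <= t%:R ->
    d <= mdist (iter j f y) (iter t (iter M f) x).
  have : ~ omega_limit (iter M f) x (iter j f y).
    by move=> oj; apply: n; exists j => //; rewrite -ltnS.
  move=> /omega_limitP/existsNP[d /existsNP[N /not_implyP[d0 dN]]].
  have [N0|N0] := leqP N 0; first exists d => // t _.
    by rewrite leNgt; apply/negP => H; apply: dN; exists t => //; apply: leq_trans N0 _.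
  have NR : 0 < N%:R :> R by rewrite ltr0n.
  exists (Num.min d (N%:R)^-1); first by rewrite lt_min d0 invr_gt0.
  move=> t tN; rewrite ge_min; apply/orP; left; rewrite leNgt; apply/negP => H.
  apply: dN; exists t => //; rewrite -(ler_nat R); apply: le_trans tN.
  by rewrite -[leLHS]invrK lef_pV2 ?posrE ?lt_min ?invr_gt0 ?d0 // ge_min lexx orbT.
have [d d0 dP] : exists2 d : R, 0 < d & forall j : 'I_M.+1, forall t, d^-1 <= t%:R ->
    d <= mdist (iter j f y) (iter t (iter M f) x).
  apply: finite_uniform nj => j e e' eP /andP[e'0 e'e] t te'.
  have ep : 0 < e by exact: lt_le_trans e'e.
  apply: (le_trans e'e); apply: eP; apply: le_trans te'.
  by rewrite lef_pV2 ?posrE.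
have [e e0 eP] := uniform_iterates Xc fc M d0.
have [N NP] := exists_nat_ge d^-1.
have [m Nm ym] := oy e (N * M)%N e0.
pose t := (m %/ M).+1.
have mM : (m < t * M)%N by rewrite /t; exact: ltn_ceil.
have tM : (t * M - m <= M)%N by rewrite /t mulSn; have := divn_eq m M; lia.
have Nt : (N <= t)%N by rewrite /t leqW // leq_divRL.
have /(_ _ _ _ tM ym) := eP; rewrite -iterD subnK 1?ltnW // -iter_iter ltNge => /negP; apply.
have jM : (t * M - m < M.+1)%N by rewrite ltnS.
apply: (dP (Ordinal jM)); by rewrite (le_trans NP) // ler_nat.
Qed.
End omega_limits.

Section limit_codes.
Context {R : realType} {X : metricType R}.
Variables (f : X -> X) (M : nat) (cyl : seq bool -> set X).
Hypotheses (Xc : compact [set: X]) (fc : continuous f) (M0 : (0 < M)%N).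
Hypothesis cod : coding (iter M f) cyl.
Local Notation F := (iter M f).

(** In other words, u is in the omega-limit set of s under the shift. *)
Definition limit_of_shifts (s u : nat -> bool) :=
  forall L N, exists2 n, (N <= n)%N & forall m, (m < L)%N -> s (n + m)%N = u m.

Lemma coded_shift y u k : coded F cyl y u -> coded F cyl (iter k F y) (fun n => u (k + n)%N).
Proof.
move=> yu n l; rewrite -iterD addnC.
rewrite (@eq_window _ u n (k + n) l) //.
by move=> i _; rewrite addnA.
Qed.

Lemma limit_coded x s z u : coded F cyl x s -> coded F cyl z u -> shrinking cyl u ->
  limit_of_shifts s u -> omega_limit F x z.
Proof.
move=> xs zu us su; apply/omega_limitP => d N d0; have [k kP] := us d d0.
have [n Nn nP] := su k N; exists n => //; apply: kP; first exact: (zu 0%N k).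
by rewrite -(@eq_window s u n 0 k) ?add0n //; exact: xs.
Qed.

(** By separation of the cylinders, the codes of the points of the orbit that
are close enough to z agree on any given range of places. *)
Lemma coded_limit x s z : coded F cyl x s -> omega_limit F x z ->
  exists2 u, coded F cyl z u & limit_of_shifts s u.
Proof.
move=> xs /omega_limitP xz; have [e e0 eP] := coded_separated cod.
have Fc : continuous F by exact: iter_continuous.
have um m : exists b, exists2 d : R, 0 < d & forall n, mdist z (iter n F x) < d -> s (n + m)%N = b.
  have [d d0 dP] := uniform_iterates Xc Fc m (divr_gt0 e0 (ltr0Sn R 1)).
  have [n _ zn] := xz d 0%N d0; exists (s (n + m)%N), d => // n' zn'.
  apply: contrapT => ne.
  have := eP _ _ _ _ m (coded_shift n' xs) (coded_shift n xs) ne.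
  have := dP _ _ _ (leqnn m) zn; have := dP _ _ _ (leqnn m) zn'.
  have := metric_triangle (iter m F (iter n' F x)) (iter m F z) (iter m F (iter n F x)).
  rewrite (metric_sym _ (iter m F z)); lra.
have [u uP] := choice um.
have unif L : exists2 d : R, 0 < d & forall n, mdist z (iter n F x) < d ->
    forall m, (m < L)%N -> s (n + m)%N = u m.
  have [|m|d d0 dP] := @finite_uniform R 'I_L
      (fun m d => forall n, mdist z (iter n F x) < d -> s (n + m)%N = u m).
  - by move=> m d d' dP /andP[_ d'd] n zn; apply: dP; exact: lt_le_trans zn d'd.
  - exact: uP.
  by exists d => // n zn m mL; exact: (dP (Ordinal mL)).
exists u => [N k|L N]; last first.
  have [d d0 dP] := unif L; have [n Nn zn] := xz d N d0.
  by exists n => //; exact: dP.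
apply: contrapT => nc.
have [d d0 dP] := closed_dist_gt0 (@cyl_closed _ _ _ _ cod (window u N k)) nc.
have [d' d'0 d'P] := uniform_iterates Xc Fc N d0.
have [d'' d''0 d''P] := unif (N + k)%N.
have [|n _] := xz (Num.min d' d'') 0%N; first by rewrite lt_min d'0.
rewrite lt_min => /andP[zn zn'].
have := d'P _ _ _ (leqnn N) zn; rewrite ltNge => /negP; apply; apply: dP.
rewrite -(@eq_window (fun i => s (n + i)%N) u N N k); first exact: (coded_shift n xs).
by move=> i ik; rewrite addnA -addnA; apply: d''P => //; rewrite ltn_add2l.
Qed.
End limit_codes.

(** * Minimal parts and their images *)

Section independent_sets.

Lemma countable_union (T : Type) (A B : set T) :
  countable A -> countable B -> countable (A `|` B).
Proof.
move=> Ac Bc; rewrite -bigcup2E; apply: bigcup_countable => // i _.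
by rewrite /bigcup2; case: ifP => // _; case: ifP.
Qed.

Lemma countable_of_labels (T : Type) (A : set T) (Q : nat -> T -> Prop) :
  (forall x, A x -> exists j, Q j x) ->
  (forall j x y, A x -> A y -> Q j x -> Q j y -> x = y) -> countable A.
Proof.
move=> AQ Qu; have lab x : exists j, A x -> Q j x.
  by have [Ax|] := pselect (A x); [have [j] := AQ x Ax; exists j|exists 0%N].
have [j jP] := choice lab; apply/countable_injP; exists j => x y /set_mem Ax /set_mem Ay E.
by apply: (Qu (j x)) => //; [exact: jP|rewrite E; exact: jP].
Qed.

(** A maximal set of pairwise unrelated elements, together with the elements
related to one of its members, exhausts G; hence it cannot be countable. *)
Lemma uncountable_independent (T : Type) (G : set T) (r : T -> T -> Prop) :
  ~ countable G ->
  (forall x, G x -> countable [set y | G y /\ (r x y \/ r y x)]) ->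
  exists2 S, S `<=` G /\ ~ countable S &
    forall x y, S x -> S y -> x <> y -> ~ r x y.
Proof.
move=> nG rc.
pose P (S : set T) := S `<=` G /\ forall x y, S x -> S y -> x <> y -> ~ r x y.
have [F FP Ft|S [[SG Sr] Smax]] := @Zorn_bigcup _ P.
  split=> [x [S FS Sx]|x y [S FS Sx] [S' FS' Sy]]; first exact: (FP _ FS).1.
  case: (Ft _ _ FS FS') => sub.
    by apply: (FP _ FS').2 => //; exact: sub.
  by apply: (FP _ FS).2 => //; exact: sub.
exists S => //; split => // Sc; apply: nG.
have cover : G `<=` S `|` \bigcup_(x in S) [set y | G y /\ (r x y \/ r y x)].
  move=> y Gy; apply: contrapT => ny.
  have nSy : ~ S y by move=> Sy; apply: ny; left.
  apply: (Smax (S `|` [set y])).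
    by split; [left|move=> sub; apply: nSy; apply: sub; right].
  split=> [z [Sz|->//]|z w [Sz|->] [Sw|->] //]; first exact: SG.
  - exact: Sr.
  - by move=> _ rzy; apply: ny; right; exists z => //; split=> //; left.
  - by move=> _ ryw; apply: ny; right; exists w => //; split=> //; right.
apply: (sub_countable (subset_card_le cover)); apply: countable_union => //.
by apply: bigcup_countable => // x Sx; apply: rc; exact: SG.
Qed.
End independent_sets.

Definition hull (a u : nat -> bool) := toeplitz_hull (spread a) u.

Lemma hull_inj a b u : hull a u -> hull b u -> a = b.
Proof.
by move=> au bu; apply: spread_inj; apply: hull_disjoint au bu; exact: spread_no_triple.
Qed.


Section omega_sequences.
Variable a0 : nat -> bool.

(** Longer and longer prefixes of the Toeplitz sequences of parameters a and a0
in alternation. *)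
Definition omega_sequence (a : nat -> bool) : nat -> bool :=
  concat_blocks (fun j => toeplitz (spread (if odd j then a0 else a))).

Lemma omega_sequence_limit a c u : c = a \/ c = a0 -> hull c u ->
  limit_of_shifts (omega_sequence a) u.
Proof.
move=> ca cu L N; have [i iP] := cu L.
(* The parity of j selects a block that reads the sequence of c. *)
pose j := ((N + i + L).*2 + (c != a))%N.
have jc : (if odd j then a0 else a) = c.
  rewrite /j oddD odd_double /=; case: eqVneq => [->//|ne] /=.
  by case: ca ne => -> //; rewrite eqxx.
exists (block_start j + i)%N.
  have := block_startE j.-1; have : (0 < j)%N \/ N = 0%N by rewrite /j; lia.
  case=> [j0|-> //]; rewrite prednK // => E; rewrite E.
  by rewrite (leq_trans _ (leq_addr _ _)) // (leq_trans _ (leq_addl _ _)) // /j; lia.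
move=> m mL; rewrite /omega_sequence -addnA concat_blocksE; first by rewrite jc iP.
by have := block_length j; rewrite {1}/j; lia.
Qed.

(** A late window of this sequence meets at most two consecutive blocks, so a
limit of shifts either is a limit of words of one of both Toeplitz sequences or
ends with one of them. *)
Lemma omega_sequence_limit_tail a u : limit_of_shifts (omega_sequence a) u ->
  exists k c, (c = a \/ c = a0) /\ hull c (fun n => u (k + n)%N).
Proof.
move=> su; apply: contrapT => n.
have nh c : c = a \/ c = a0 -> ~ hull c u.
  by move=> ca cu; apply: n; exists 0%N, c; split.
have nL c : c = a \/ c = a0 -> exists L, forall i, ~ forall n, (n < L)%N -> u n = toeplitz (spread c) (i + n).
  move=> /nh /existsNP[L nL]; exists L => i iP; apply: nL; by exists i.
have [La LaP] := nL a (or_introl erefl); have [Lb LbP] := nL a0 (or_intror erefl).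
have nT c : c = a \/ c = a0 -> forall p, exists m, u (p + m)%N <> toeplitz (spread c) m.
  move=> ca p; apply: contrapT => np; apply: n; exists p, c; split=> // L; exists 0%N => m _.
  by rewrite add0n; apply: contrapT => ne; apply: np; exists m.
have [ma maP] := choice (nT a (or_introl erefl)).
have [mb mbP] := choice (nT a0 (or_intror erefl)).
(* No prefix of u of length L0 occurs in either Toeplitz sequence, and for p < L0
   the sequence u from place p on leaves both of them before place L. *)
pose L0 := (La + Lb)%N.
pose L := (L0 + \sum_(p < L0) (p + ma p + mb p).+1)%N.
have Lbig p : (p < L0)%N -> (p + ma p < L)%N /\ (p + mb p < L)%N.
  move=> pL; suff : (p + ma p + mb p < \sum_(p < L0) (p + ma p + mb p).+1)%N.
    by rewrite /L; move: (\sum_(_ < _) _)%N => S; lia.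
  by rewrite (bigD1 (Ordinal pL)) //= leq_addr.
have [N NL Nu] := su L (block_start L).
have jP := svalP (cid (ex_block N)); set j := sval _ in jP; move: jP => /andP[jN Nj].
have Lj : (L <= j)%N.
  rewrite leqNgt; apply/negP => jL; have := block_start_mono jL; lia.
have len := block_length j.+1.
pose T i := toeplitz (spread (if odd i then a0 else a)).
have in1 m : (N + m < block_start j.+1)%N -> omega_sequence a (N + m) = T j (N - block_start j + m)%N.
  move=> H; have -> : (N + m = block_start j + (N - block_start j + m))%N by lia.
  by rewrite /omega_sequence concat_blocksE //; lia.
have word i (q : nat) : (L0 <= q)%N -> ~ forall m, (m < q)%N -> u m = T i (N - block_start j + m)%N.
  move=> L0q H; rewrite /T in H; case: (odd i) H => H.
    by apply: (LbP (N - block_start j)%N) => m mL; apply: H; rewrite /L0 in L0q; lia.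
  by apply: (LaP (N - block_start j)%N) => m mL; apply: H; rewrite /L0 in L0q; lia.
pose p := (block_start j.+1 - N)%N.
have pL0 : (p < L0)%N.
  rewrite ltnNge; apply/negP => L0p; apply: (word j L0) => // m mL.
  have mL' : (m < L)%N by rewrite (leq_trans mL) // /L leq_addr.
  have Nm : (N + m < block_start j.+1)%N by move: L0p; rewrite /p; lia.
  by rewrite -in1 // Nu.
have tail m : (p + m < L)%N -> u (p + m)%N = T j.+1 m.
  move=> H; rewrite -Nu //.
  have -> : (N + (p + m) = block_start j.+1 + m)%N by rewrite /p; lia.
  by rewrite /omega_sequence concat_blocksE //; lia.
have [H1 H2] := Lbig p pL0; rewrite /T in tail; case: (odd j.+1) tail => tail.
  by apply: (mbP p); exact: tail.
by apply: (maP p); exact: tail.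
Qed.
End omega_sequences.

Section omega_chaos.
Context {R : realType} {X : metricType R}.
Variables (f : X -> X) (M : nat) (cyl : seq bool -> set X).
Hypotheses (Xc : compact [set: X]) (fc : continuous f) (M0 : (0 < M)%N).
Hypothesis cod : coding (iter M f) cyl.
Local Notation F := (iter M f).

Definition minimal_part a : set X := [set y | exists2 u, hull a u & coded F cyl y u].

Definition good_parameter a := forall u, hull a u -> shrinking cyl u.

(** Different parameters have disjoint hulls, so that each sequence without
shrinking cylinders spoils at most one parameter. *)
Lemma countable_bad_parameters : countable [set a | ~ good_parameter a].
Proof.
have [g gi] := countable_injP _ (countable_not_shrinking cod).
have bad a : exists u, ~ good_parameter a -> hull a u /\ ~ shrinking cyl u.
  have [ga|] := pselect (good_parameter a); first by exists a.
  by move=> /existsNP[u /not_implyP[? ?]]; exists u.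
have [u uP] := choice bad.
apply/countable_injP; exists (g \o u) => a b /set_mem na /set_mem nb /gi E.
have [ha sa] := uP a na; have [hb sb] := uP b nb.
apply: hull_inj ha _; rewrite E //; exact/mem_set.
Qed.

Lemma minimal_part_iter a y k : minimal_part a y -> minimal_part a (iter k F y).
Proof.
move=> [u au yu]; exists (fun n => u (k + n)%N); first exact: hull_shift.
exact: coded_shift.
Qed.

(** Each minimal part is the orbit closure of each of its points, and the
parameter can be read off the codes: a map commuting with the dynamics sends a
minimal part into at most one other one. *)
Lemma minimal_part_image b a1 a2 g y1 y2 : good_parameter b -> continuous g ->
  (forall y, g (F y) = F (g y)) -> minimal_part b y1 -> minimal_part b y2 ->
  minimal_part a1 (g y1) -> minimal_part a2 (g y2) -> a1 = a2.
Proof.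
move=> bgood gc gF [u1 bu1 yu1] [u2 bu2 yu2] [v1 av1 gv1] [v2 av2 gv2].
apply: (@hull_inj _ _ v2) av2 => L.
have [e e0 eP] := coded_separated cod.
have Fc : continuous F by exact: iter_continuous.
have [d d0 dP] := uniform_iterates Xc Fc L e0.
have [d' d'0 d'P] := uniform_continuity_compact Xc gc d0.
have [k kP] := bgood u2 bu2 d' d'0.
have [i iP] := bu2 k.
have [m mP] := @hull_minimal _ u1 i k bu1.
have near : mdist (iter m F y1) y2 < d'.
  apply: kP; last exact: (yu2 0%N k).
  rewrite -(@eq_window u1 u2 m 0 k); first exact: yu1.
  by move=> n nk; rewrite mP // add0n iP.
have gm : g (iter m F y1) = iter m F (g y1).
  by elim: m {mP near} => // m IH; rewrite !iterS gF IH.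
have [j jP] := @hull_shift _ _ m av1 L.
exists j => n nL; rewrite -jP //; apply: contrapT => ne.
have := dP n _ _ (ltnW nL) (d'P _ _ near); rewrite gm ltNge => /negP; apply.
apply: (eP _ _ _ _ n (coded_shift m gv1) gv2) => E; exact: ne.
Qed.

(** If the parts of a and b are unrelated, then the orbit of a point of the part
of a under f itself, not only under its iterate, avoids the part of b. *)
Definition related a b :=
  exists2 j, (j <= M)%N & exists2 y, minimal_part a y & minimal_part b (iter j f y).

Lemma iter_comm j y : iter j f (F y) = F (iter j f y).
Proof. by rewrite -!iterD addnC. Qed.

Lemma countable_related_to a : good_parameter a -> countable [set b | related a b].
Proof.
move=> ga; apply: (@countable_of_labels _ _
  (fun j b => exists2 y, minimal_part a y & minimal_part b (iter j f y))).
  by move=> b [j _ jb]; exists j.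
move=> j b b' _ _ [y ay by_] [y' ay' by'].
apply: (minimal_part_image ga _ _ ay ay' by_ by'); last exact: iter_comm.
exact: iter_continuous.
Qed.

(** Mapping on by the remaining M - j steps returns to the parts that one came
from. *)
Lemma countable_related_from b : good_parameter b -> countable [set a | related a b].
Proof.
move=> gb; apply: (@countable_of_labels _ _
  (fun j a => (j <= M)%N /\ exists2 y, minimal_part a y & minimal_part b (iter j f y))).
  by move=> a [j jM ja]; exists j.
move=> j a a' _ _ [jM [y ay by_]] [_ [y' ay' by']].
have back z : iter (M - j) f (iter j f z) = F z by rewrite -iterD subnK.
apply: (minimal_part_image (g := iter (M - j) f) gb _ _ by_ by').
- exact: iter_continuous.
- exact: iter_comm.
- by rewrite back; exact: (minimal_part_iter 1).
- by rewrite back; exact: (minimal_part_iter 1).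
Qed.
End omega_chaos.

(** * Omega-chaos and the theorem *)

(** For unrelated good parameters a and b, different from a0 and unrelated to
it, the omega-limit set of the point coded by the sequence of a contains the
part of a, which is uncountable and off the omega-limit set of the other point,
and contains the single point coded by the Toeplitz sequence of a0. *)
Lemma omega_chaotic_of_coding (R : realType) (X : metricType R) (f : X -> X) M cyl :
  compact [set: X] -> continuous f -> (0 < M)%N -> coding (iter M f) cyl ->
  omega_chaotic f.
Proof.
move=> Xc fc M0 cod.
have bad_countable := countable_bad_parameters cod.
have [a0 a0_good] : exists a0, good_parameter cyl a0.
  apply: contrapT => n; apply: uncountable_bool_sequences.
  apply: (sub_countable _ bad_countable); apply: subset_card_le => a _ ga.
  by apply: n; exists a.
pose G := [set a | good_parameter cyl a /\ ~ related f M cyl a a0].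
have nG : ~ countable G.
  move=> Gc; apply: uncountable_bool_sequences.
  have cover : [set: nat -> bool] `<=` G `|` ([set a | ~ good_parameter cyl a] `|`
      [set a | related f M cyl a a0]).
    move=> a _; have [ga|] := pselect (good_parameter cyl a); last by right; left.
    by have [ra|] := pselect (related f M cyl a a0); [right; right|left].
  apply: (sub_countable (subset_card_le cover)); apply: countable_union => //.
  by apply: countable_union => //; exact: (countable_related_from Xc fc cod).
have [|S [SG nS] Srel] := uncountable_independent (r := related f M cyl) nG.
  move=> a [ga _]; apply: (sub_countable (B := [set b | related f M cyl a b] `|`
      [set b | related f M cyl b a])).
    by apply: subset_card_le => b [_ []]; [left|right].
  apply: countable_union; first exact: (countable_related_to Xc fc cod).
  exact: (countable_related_from Xc fc cod).
have [x xP] := choice (fun a => coded_point cod (omega_sequence a0 a)).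
have [z zP] := choice (fun u => coded_point cod u).
have in_limit a c u : c = a \/ c = a0 -> good_parameter cyl c -> hull c u ->
    omega_limit (iter M f) (x a) (z u).
  move=> ca gc cu; apply: (limit_coded (xP a) (zP u)); first exact: gc.
  exact: omega_sequence_limit ca cu.
have off a b y : S a -> S b -> a <> b -> minimal_part f M cyl a y ->
    ~ omega_limit f (x b) y.
  move=> Sa Sb ab ay yb.
  have [j jM /(coded_limit Xc fc cod (xP b))[u yu us]] :=
    omega_limit_some_iterate Xc fc M0 yb.
  have [k [c [cb ck]]] := omega_sequence_limit_tail us.
  have rel : related f M cyl a c.
    exists j => //; exists (iter k (iter M f) y); first exact: minimal_part_iter.
    exists (fun n => u (k + n)%N) => //.
    have -> : iter j f (iter k (iter M f) y) = iter k (iter M f) (iter j f y).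
      by rewrite !iter_iter -!iterD addnC.
    exact: coded_shift.
  case: cb => cE; rewrite cE in rel; first exact: Srel Sa Sb ab rel.
  by have [_] := SG _ Sa; exact.
have zmin a u : hull a u -> minimal_part f M cyl a (z u) by move=> au; exists u.
have theta_hull a : hull a (toeplitz (spread a)) by exact: toeplitz_in_hull.
have x_inj : {in S &, injective x}.
  move=> a b /set_mem Sa /set_mem Sb E; apply: contrapT => ab.
  have [ga _] := SG _ Sa.
  apply: (off a b _ Sa Sb ab (zmin _ _ (theta_hull a))).
  rewrite -E; apply: (omega_limit_iter M0).
  by apply: in_limit (theta_hull a) => //; left.
have nSx := uncountable_injective_image nS x_inj.
exists (x @` S) => //; split.
  apply: contrapT => n; apply: nSx.
  (* A set without two different points is countable. *)
  apply: (@countable_of_labels _ _ (fun _ _ => True)); first by move=> *; exists 0%N.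
  by move=> _ y y' Sy Sy' _ _; apply: contrapT => ne; apply: n; exists y, y'.
move=> _ _ [a Sa <-] [b Sb <-] xab.
have ab : a <> b by move=> E; apply: xab; rewrite E.
have [ga _] := SG _ Sa; have [gb _] := SG _ Sb.
split.
- move=> Dc; apply: (uncountable_hull (@spread_no_triple a)).
  have zi : {in [set u | toeplitz_hull (spread a) u] &, injective z}.
    by move=> u v _ _ E; have zv := zP v; rewrite -E in zv; exact: (coded_unique cod (zP u) zv).
  apply: contrapT => nH; apply: (uncountable_injective_image nH zi).
  apply: (sub_countable _ Dc); apply: subset_card_le => _ [u au <-]; split.
    by apply: (omega_limit_iter M0); apply: in_limit au => //; left.
  exact: off Sa Sb ab (zmin _ _ au).
- exists (z (toeplitz (spread a0))); split; apply: (omega_limit_iter M0);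
    by apply: in_limit (theta_hull a0) => //; right.
move=> per; have [|n n0 nz] := per (z (toeplitz (spread a))).
  by apply: (omega_limit_iter M0); apply: in_limit (theta_hull a) => //; left.
have nF : iter n (iter M f) (z (toeplitz (spread a))) = z (toeplitz (spread a)).
  have fixed k : iter k (iter n f) (z (toeplitz (spread a))) = z (toeplitz (spread a)).
    by elim: k => // k IH; rewrite iterS IH.
  by rewrite iter_iter mulnC -iter_iter.
have zn := coded_shift n (zP (toeplitz (spread a))); rewrite nF in zn.
have E := coded_unique cod zn (zP _).
suff : n = 0%N by move=> E0; rewrite E0 in n0.
apply: (toeplitz_not_periodic (@spread_no_triple a)) => i.
exact: (congr1 (fun u => u i) E).
Qed.

Theorem theorem9 (R : realType) (X : metricType R) (f : X -> X) :
  dendrite X -> continuous f ->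
  (exists2 m : nat, (0 < m)%N & has_arc_horseshoe (iter m f)) ->
  DC1u f /\ omega_chaotic f.
Proof.
move=> [Xc _ _ no_circle] fc [m m0 horseshoe].
have [N [h [a [b [p0 [q0 [p1 [q1 [N0 harc [ap pq0 qp pq1 qb] M0 M1]]]]]]]]] :=
  disjoint_horseshoe no_circle (iter_continuous (n := m) fc) horseshoe.
rewrite iter_iter in M0 M1.
have Nm : (0 < N * m)%N by rewrite muln_gt0 N0.
pose p i := if i then p1 else p0; pose q i := if i then q1 else q0.
have pq i : p i < q i by case: i.
have Fm i : matches (iter (N * m) f) h (p i) (q i) a b by case: i.
have Fc : continuous (iter (N * m) f) by exact: iter_continuous.
have cod := cylinder_coding no_circle harc Fc (p := p) (q := q) ap pq qp qb Fm.
split; first exact: DC1u_of_coding cod.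
exact: omega_chaotic_of_coding cod.
Qed.
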